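(* Let $k$ be an algebraically closed field of characteristic $0$, and let $\mathcal A$ be a symmetric spherical order of rank $n^2$ on the irreducible projective nodal curve $C$ of arithmetic genus $1$ over $k$. Then there exist a vector bundle $\mathcal V$ of rank $n$ over $\mathbb P^1$ and a maximal isotropic subalgebra $I\subset\mathrm{End}(\mathcal V|_0)\oplus\mathrm{End}(\mathcal V|_\infty)$ such that $\mathcal A\simeq\mathcal A(\mathcal V,I)$. Furthermore, replacing $\mathcal V$ by $\mathcal V(i)$ for some $i\in\mathbb{Z}$, one can achieve that $\mathcal V\simeq\mathcal O^{\oplus m}\oplus\mathcal O(1)^{\oplus(n-m)}$ for some $m$.
   Context: An order over an integral projective curve $C$ is a torsion free coherent sheaf of $\mathcal O_C$-algebras $\mathcal A$ whose stalk at the generic point is a matrix algebra over the field of rational functions on $C$. An order $\mathcal A$ is spherical if it is a $1$-spherical object in $\mathrm{Perf}(\mathcal A)$ (the perfect derived category of left $\mathcal{A}$-modules); equivalently, $h^0(\mathcal A)=1$ and for a nonzero morphism of $\mathcal O_C$-modules $\tau:\mathcal A\to\omega_C$ (unique up to rescaling), the morphism $\nu:\mathcal A\to\underline{\mathrm{Hom}}(\mathcal A,\omega_C)$, $y\mapsto(x\mapsto\tau(xy))$, is an isomorphism, where $\omega_C$ is the dualizing sheaf. It is symmetric if in addition $\tau(xy)=\tau(yx)$. Let $\pi:\mathbb P^1\to C$ be the normalization, with $\pi(0)=\pi(\infty)$ the node. For a vector bundle $\mathcal V$ on $\mathbb P^1$, equip $\mathrm{End}(\mathcal V|_0)\oplus\mathrm{End}(\mathcal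 V|_\infty)$ with the symmetric pairing $\langle(a,b),(a',b')\rangle=\mathrm{tr}(aa')-\mathrm{tr}(bb')$. A maximal isotropic subalgebra $I$ is a (unital) subalgebra that is a maximal isotropic subspace for this pairing. The sheaf $\mathcal A(\mathcal V,I)\subset\pi_*\underline{\mathrm{End}}(\mathcal V)$ consists of the sections $a$ such that $(a(0),a(\infty))\in I$. *)

(* Defs.v *)
From HB Require Import structures.
From mathcomp Require Import all_boot all_order all_algebra.
From mathcomp Require Import boolp classical_sets cardinality.

Set Implicit Arguments.
Unset Strict Implicit.
Unset Printing Implicit Defensive.

Import GRing.Theory.
Local Open Scope classical_set_scope.
Local Open Scope ring_scope.

(* Curves are handled as varieties in the sense of Serre's FAC: the points are
   the closed points, the topology is the cofinite one, and the structure sheaf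
   is a subsheaf of the constant sheaf k(t).  Only nonempty opens are considered;
   on an irreducible space this loses nothing, since a sheaf vanishes on the
   empty set and two nonempty opens always meet. *)

Notation ratfun k := {fraction {poly k}}.
Notation fracp p := (@FracField.tofrac _ p).
Notation tvar k := (@FracField.tofrac {poly k} 'X).

(* A rational curve, given by the relation "f is regular at p with value c"
   (c being the class of f in the residue field k of the local ring at p). *)
Record curve (k : fieldType) := Curve {
  pt : Type;
  pt_infinite : infinite_set [set: pt];
  value : pt -> ratfun k -> k -> Prop;
  value_cst : forall p c, value p (fracp c%:P) c;
  valueB : forall p f g c d, value p f c -> value p g d -> value p (f - g) (c - d);
  valueM : forall p f g c d, value p f c -> value p g d -> value p (f * g) (c * d)
}.
Arguments value {k X} : rename.

Section Opens.
Variables (k : fieldType) (X : curve k).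

Record open := Open { oset :> pt X -> Prop; open_cofinite : finite_set (~` oset) }.

Implicit Types U V W : open.

Lemma openT_subproof : finite_set (~` [set: pt X]).
Proof. by rewrite setCT; exact: finite_set0. Qed.
Definition openT := Open openT_subproof.

Lemma openI_subproof (U V : open) : finite_set (~` (U `&` V)).
Proof. by rewrite setCI finite_setU; split; exact: open_cofinite. Qed.
Definition openI (U V : open) := Open (openI_subproof U V).
Definition openIl U V : openI U V `<=` U := @subIsetl _ _ _.
Definition openIr U V : openI U V `<=` V := @subIsetr _ _ _.

Lemma compl1_subproof (p : pt X) : finite_set (~` (~` [set p])).
Proof. by rewrite setCK; exact: finite_set1. Qed.
Definition compl1 (p : pt X) := Open (compl1_subproof p).

Lemma open_nonempty (U : open) : exists p, U p.
Proof.
apply/not_existsP => nU; apply: (@pt_infinite k X).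
rewrite (_ : [set: pt X] = ~` U) ?predeqE; first exact: open_cofinite.
by move=> p; split => // _ /nU.
Qed.

Definition sub_openT (U : open) : U `<=` openT := fun x _ => I.

Definition regular_on (U : open) : {pred ratfun k} :=
  fun f => `[< forall p, U p -> exists c, value p f c >].

Lemma regularP (U : open) f :
  reflect (forall p, U p -> exists c, value p f c) (f \in regular_on U).
Proof. exact: asboolP. Qed.

Lemma regular_subring_closed U : subring_closed (regular_on U).
Proof.
split.
- by apply/regularP => p _; exists 1; have := value_cst p 1; rewrite polyC1 rmorph1.
- move=> f g /regularP hf /regularP hg; apply/regularP => p pU.
  have [c hc] := hf p pU; have [d hd] := hg p pU.
  by exists (c - d); exact: valueB.
- move=> f g /regularP hf /regularP hg; apply/regularP => p pU.
  have [c hc] := hf p pU; have [d hd] := hg p pU.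
  by exists (c * d); exact: valueM.
Qed.

HB.instance Definition _ U :=
  GRing.isSubringClosed.Build (ratfun k) (regular_on U) (regular_subring_closed U).

Record structure_ring (U : open) :=
  Regular { rat_of :> ratfun k; rat_ofP : rat_of \in regular_on U }.

HB.instance Definition _ U := [isSub for @rat_of U].
HB.instance Definition _ U := [Choice of structure_ring U by <:].
HB.instance Definition _ U := [SubChoice_isSubComNzRing of structure_ring U by <:].

Local Notation O := structure_ring.

Lemma fun_res_subproof (U V : open) (h : V `<=` U) (f : O U) :
  rat_of f \in regular_on V.
Proof. by apply/regularP => p /h; move: p; apply/regularP/rat_ofP. Qed.
Definition fun_res U V (h : V `<=` U) (f : O U) : O V :=
  Regular (fun_res_subproof h f).

Lemma cst_subproof (U : open) (c : k) : fracp c%:P \in regular_on U.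
Proof. by apply/regularP => p _; exists c; exact: value_cst. Qed.
Definition constO U (c : k) : O U := Regular (cst_subproof U c).

Record is_sheaf (sec : forall U, lmodType (O U))
    (res : forall U V : open, V `<=` U -> sec U -> sec V) : Prop := IsSheaf {
  resD : forall U V (h : V `<=` U), {morph res U V h : s t / s + t};
  resZ : forall U V (h : V `<=` U) a s, res U V h (a *: s) = fun_res h a *: res U V h s;
  res_id : forall U (h : U `<=` U) s, res U U h s = s;
  res_comp : forall U V W (hVU : V `<=` U) (hWV : W `<=` V) (hWU : W `<=` U) s,
    res V W hWV (res U V hVU s) = res U W hWU s;
  res_sep : forall U (J : Type) (V : J -> open) (h : forall j, V j `<=` U),
    U `<=` \bigcup_j V j -> forall s t,
    (forall j, res _ _ (h j) s = res _ _ (h j) t) -> s = t;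
  res_glue : forall U (J : Type) (V : J -> open) (h : forall j, V j `<=` U),
    U `<=` \bigcup_j V j -> forall s : forall j, sec (V j),
    (forall i j, res _ _ (@openIl (V i) (V j)) (s i)
               = res _ _ (@openIr (V i) (V j)) (s j)) ->
    exists t, forall j, res _ _ (h j) t = s j
}.

Record sheaf := Sheaf {
  sec :> forall U, lmodType (O U);
  res : forall U V : open, V `<=` U -> sec U -> sec V;
  sheafP : is_sheaf res
}.
Arguments res F [U V] h s : rename.

(* [algType] requires 1 != 0; this is harmless for an order, whose generic
   stalk is a nonzero matrix algebra. *)
Record algsheaf := AlgSheaf {
  asec : forall U, algType (O U);
  ares : forall U V : open, V `<=` U -> asec U -> asec V;
  algsheafP : is_sheaf (sec := fun U => asec U) ares;
  ares1 : forall U V (h : V `<=` U), ares h 1 = 1;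
  aresM : forall U V (h : V `<=` U), {morph @ares U V h : x y / x * y}
}.
Arguments ares A [U V] h s : rename.

Definition sheaf_of_alg (A : algsheaf) : sheaf := Sheaf (algsheafP A).
Coercion sheaf_of_alg : algsheaf >-> sheaf.

(* The sections over U of the sheaf Hom(F, G), i.e. morphisms F|_U -> G|_U. *)
Record hom_on (F G : sheaf) (U : open) := Hom {
  happ :> forall W : open, W `<=` U -> F W -> G W;
  hom_linear : forall W h, linear (@happ W h);
  hom_res_comm : forall (V W : open) (hV : V `<=` U) (hW : W `<=` U) (h : W `<=` V) s,
    res G h (happ hV s) = happ hW (res F h s)
}.
Arguments happ {F G U} a [W] h s : rename.

Definition sheaf_iso (F G : sheaf) : Prop :=
  exists phi : hom_on F G openT, forall W h, bijective (happ phi (W := W) h).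

Definition hom_nonzero (F G : sheaf) U (phi : hom_on F G U) : Prop :=
  exists W h s, happ phi (W := W) h s != 0.

Section HomOps.
Variables (F : sheaf) (U : open).

Lemma hom_id_linear (W : open) (h : W `<=` U) : linear (fun s : F W => s).
Proof. by []. Qed.
Definition hom_id : hom_on F F U :=
  @Hom F F U (fun W _ s => s) hom_id_linear (fun _ _ _ _ _ _ => erefl).

Lemma hom_comp_linear (a b : hom_on F F U) (W : open) (h : W `<=` U) :
  linear (fun s : F W => a W h (b W h s)).
Proof. by move=> c x y; rewrite !hom_linear. Qed.
Lemma hom_comp_res (a b : hom_on F F U) (V W : open) (hV : V `<=` U) (hW : W `<=` U)
  (h : W `<=` V) s :
  res F h (a V hV (b V hV s)) = a W hW (b W hW (res F h s)).
Proof. by rewrite !(hom_res_comm _ _ hW). Qed.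
Definition hom_comp (a b : hom_on F F U) : hom_on F F U :=
  Hom (@hom_comp_linear a b) (@hom_comp_res a b).

Lemma hom_add_linear (a b : hom_on F F U) (W : open) (h : W `<=` U) :
  linear (fun s : F W => a W h s + b W h s).
Proof. by move=> c x y; rewrite !hom_linear scalerDr addrACA. Qed.
Lemma hom_add_res (a b : hom_on F F U) (V W : open) (hV : V `<=` U) (hW : W `<=` U)
  (h : W `<=` V) s :
  res F h (a V hV s + b V hV s) = a W hW (res F h s) + b W hW (res F h s).
Proof. by rewrite (resD (sheafP F)) !(hom_res_comm _ _ hW). Qed.
Definition hom_add (a b : hom_on F F U) : hom_on F F U :=
  Hom (@hom_add_linear a b) (@hom_add_res a b).

Lemma hom_scale_linear (f : O U) (a : hom_on F F U) (W : open) (h : W `<=` U) :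
  linear (fun s : F W => fun_res h f *: a W h s).
Proof. by move=> c x y; rewrite hom_linear scalerDr !scalerA mulrC. Qed.
Lemma hom_scale_res (f : O U) (a : hom_on F F U) (V W : open) (hV : V `<=` U)
  (hW : W `<=` U) (h : W `<=` V) s :
  res F h (fun_res hV f *: a V hV s) = fun_res hW f *: a W hW (res F h s).
Proof.
rewrite (resZ (sheafP F)) (hom_res_comm _ _ hW); congr (_ *: _); exact: val_inj.
Qed.
Definition hom_scale (f : O U) (a : hom_on F F U) : hom_on F F U :=
  Hom (@hom_scale_linear f a) (@hom_scale_res f a).

Lemma hom_restr_res (V : open) (hVU : V `<=` U) (a : hom_on F F U) (W W' : open)
  (hW : W `<=` V) (hW' : W' `<=` V) (h : W' `<=` W) s :
  res F h (a W (subset_trans hW hVU) s) = a W' (subset_trans hW' hVU) (res F h s).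
Proof. exact: hom_res_comm. Qed.
Definition hom_restr (V : open) (hVU : V `<=` U) (a : hom_on F F U) : hom_on F F V :=
  @Hom F F V (fun W hW => a W (subset_trans hW hVU))
       (fun W hW => hom_linear a (subset_trans hW hVU)) (@hom_restr_res V hVU a).
End HomOps.

Section Nu.
Variables (A : algsheaf) (G : sheaf) (tau : hom_on A G openT).

Lemma nu_linear U (y : asec A U) (W : open) (h : W `<=` U) :
  linear (fun x : asec A W => tau W (@sub_openT W) (x * ares A h y)).
Proof. by move=> c x x'; rewrite mulrDl -scalerAl hom_linear. Qed.
Lemma nu_res U (y : asec A U) (V W : open) (hV : V `<=` U) (hW : W `<=` U)
    (h : W `<=` V) (x : asec A V) :
  res G h (tau V (@sub_openT V) (x * ares A hV y)) =
  tau W (@sub_openT W) (ares A h x * ares A hW y).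
Proof.
rewrite (hom_res_comm _ _ (@sub_openT W)) /= aresM.
by rewrite (res_comp (algsheafP A) hV h hW).
Qed.
(* y |-> (x |-> tau (x y)) *)
Definition nu U (y : asec A U) : hom_on A G U :=
  @Hom A G U (fun W h (x : asec A W) => tau W (@sub_openT W) (x * ares A h y))
       (@nu_linear U y) (@nu_res U y).
End Nu.

Definition torsion_free (F : sheaf) : Prop :=
  forall U (f : O U) (s : F U), f *: s = 0 -> f = 0 \/ s = 0.

Definition finite_type (F : sheaf) : Prop :=
  forall p, exists U : open, U p /\ exists m (e : 'I_m -> F U),
  forall (V : open) (h : V `<=` U) (s : F V) q, V q ->
  exists (W : open) (hV : W `<=` V) (hU : W `<=` U), W q /\
  exists c : 'I_m -> O W, res F hV s = \sum_i c i *: res F hU (e i).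

(* The kernel of any O_U^m -> F|_U is of finite type. *)
Definition finite_type_relations (F : sheaf) : Prop :=
  forall (U : open) m (e : 'I_m -> F U) p, U p ->
  exists (U' : open) (h' : U' `<=` U), U' p /\
  exists l (r : 'I_l -> 'I_m -> O U'),
  (forall j, \sum_i r j i *: res F h' (e i) = 0) /\
  forall (V : open) (h : V `<=` U') (hU : V `<=` U) (c : 'I_m -> O V),
  \sum_i c i *: res F hU (e i) = 0 -> forall q, V q ->
  exists (W : open) (hV : W `<=` V) (hU' : W `<=` U'), W q /\
  exists d : 'I_l -> O W,
  forall i, fun_res hV (c i) = \sum_j d j * fun_res hU' (r j i).

Definition coherent (F : sheaf) : Prop := finite_type F /\ finite_type_relations F.

Definition vector_bundle (n : nat) (F : sheaf) : Prop :=
  forall p, exists U : open, U p /\ exists e : 'I_n -> F U,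
  forall (V : open) (h : V `<=` U) (s : F V),
  exists! c : 'rV[O V]_n, s = \sum_i c 0 i *: res F h (e i).

(* h^0(F) = d *)
Definition h0 (F : sheaf) (d : nat) : Prop :=
  exists e : 'I_d -> F openT,
  forall s, exists! c : 'rV[k]_d, s = \sum_i constO openT (c 0 i) *: e i.

(* The maps g identify the stalk of A at the generic point, the colimit of A(U)
   over all nonempty opens U, with the k(t)-algebra M_n(k(t)). *)
Record generic_stalk_iso (A : algsheaf) (n : nat)
    (g : forall U, asec A U -> 'M[ratfun k]_n) : Prop := GenericStalkIso {
  gstalkD : forall U, {morph g U : x y / x + y};
  gstalkZ : forall U (a : O U) x, g U (a *: x) = rat_of a *: g U x;
  gstalk1 : forall U, g U 1 = 1%:M;
  gstalkM : forall U, {morph g U : x y / x * y >-> x *m y};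
  gstalk_res : forall U V (h : V `<=` U) x, g V (ares A h x) = g U x;
  gstalk_surj : forall M, exists U x, g U x = M;
  gstalk_inj : forall U V (x : asec A U) (y : asec A V), g U x = g V y ->
    exists (W : open) (hU : W `<=` U) (hV : W `<=` V), ares A hU x = ares A hV y
}.

(* An order of rank n^2. *)
Definition is_order (n : nat) (A : algsheaf) : Prop :=
  [/\ torsion_free A, coherent A & exists g, @generic_stalk_iso A n g].

(* An identification of the fibre F_p / m_p F_p with k^n, given as the family of
   maps s |-> s(p) on sections defined near p. *)
Record fibre_frame (F : sheaf) (p : pt X) (n : nat) := FibreFrame {
  ev : forall U : open, U p -> F U -> 'cV[k]_n;
  evD : forall U (pU : U p), {morph ev pU : s t / s + t};
  evZ : forall (U : open) (pU : U p) (f : O U) c s,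
    value p f c -> ev pU (f *: s) = c *: ev pU s;
  ev_res : forall (U V : open) (pU : U p) (pV : V p) (h : V `<=` U) s,
    ev pV (res F h s) = ev pU s;
  ev_surj : forall v, exists (U : open) (pU : U p) s, ev pU s = v;
  ev_ker : forall (U : open) (pU : U p) s, ev pU s = 0 ->
    exists (W : open) (h : W `<=` U), W p /\
    exists m (f : 'I_m -> O W) (t : 'I_m -> F W),
    (forall j, value p (f j) 0) /\ res F h s = \sum_j f j *: t j
}.
Arguments ev {F p n} e [U] pU s : rename.

(* The endomorphism a of F|_U acts on the fibre at p by the matrix M. *)
Definition fibre_action (F : sheaf) p n (e : fibre_frame F p n) U
    (a : hom_on F F U) (M : 'M[k]_n) : Prop :=
  forall (W : open) (h : W `<=` U) (pW : W p) (s : F W),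
  ev e pW (a W h s) = M *m ev e pW s.

(* O_X-submodules of the constant sheaf with value a k(t)-vector space E, given
   by their stalks. *)
Section Subconstant.
Variable E : lmodType (ratfun k).

Record stalks := Stalks {
  stalk :> pt X -> E -> Prop;
  stalk0 : forall p, stalk p 0;
  stalkB : forall p x y, stalk p x -> stalk p y -> stalk p (x - y);
  stalkZ : forall p f c x, value p f c -> stalk p x -> stalk p (f *: x)
}.

Variable L : stalks.

Definition subconst (U : open) : {pred E} := fun x => `[< forall p, U p -> L p x >].

Lemma subconstP U x : reflect (forall p, U p -> L p x) (x \in subconst U).
Proof. exact: asboolP. Qed.

Lemma subconst_zmod_closed U : zmod_closed (subconst U).
Proof.
split; first by apply/subconstP => p _; exact: stalk0.
move=> x y /subconstP hx /subconstP hy; apply/subconstP => p pU.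
by apply: stalkB; [exact: hx | exact: hy].
Qed.
HB.instance Definition _ U :=
  GRing.isZmodClosed.Build E (subconst U) (subconst_zmod_closed U).

Record subconst_sec (U : open) :=
  SubconstSec { elt_of :> E; elt_ofP : elt_of \in subconst U }.
HB.instance Definition _ U := [isSub for @elt_of U].
HB.instance Definition _ U := [Choice of subconst_sec U by <:].
HB.instance Definition _ U := [SubChoice_isSubZmodule of subconst_sec U by <:].

Lemma subconst_scale_subproof U (f : O U) (x : subconst_sec U) :
  rat_of f *: elt_of x \in subconst U.
Proof.
apply/subconstP => p pU; have /regularP /(_ p pU) [c hc] := rat_ofP f.
by have /subconstP /(_ p pU) := elt_ofP x; exact: stalkZ hc.
Qed.
Definition subconst_scale U (f : O U) (x : subconst_sec U) : subconst_sec U :=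
  SubconstSec (subconst_scale_subproof f x).

Fact subconst_scaleA U (f g : O U) x :
  subconst_scale f (subconst_scale g x) = subconst_scale (f * g) x.
Proof. by apply: val_inj; rewrite /= scalerA. Qed.
Fact subconst_scale1 U : left_id 1 (@subconst_scale U).
Proof. by move=> x; apply: val_inj; rewrite /= scale1r. Qed.
Fact subconst_scaleDr U : right_distributive (@subconst_scale U) +%R.
Proof. by move=> f x y; apply: val_inj; rewrite /= scalerDr. Qed.
Fact subconst_scaleDl U (x : subconst_sec U) :
  {morph @subconst_scale U ^~ x : f g / f + g}.
Proof. by move=> f g; apply: val_inj; rewrite /= scalerDl. Qed.
HB.instance Definition _ U := GRing.Zmodule_isLmodule.Build (O U) (subconst_sec U)
  (@subconst_scaleA U) (@subconst_scale1 U) (@subconst_scaleDr U) (@subconst_scaleDl U).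

Lemma subconst_res_subproof (U V : open) (h : V `<=` U) (x : subconst_sec U) :
  elt_of x \in subconst V.
Proof. by apply/subconstP => p /h; move: p; apply/subconstP/elt_ofP. Qed.
Definition subconst_res U V (h : V `<=` U) (x : subconst_sec U) : subconst_sec V :=
  SubconstSec (subconst_res_subproof h x).

Lemma subconst_is_sheaf : is_sheaf (sec := subconst_sec) subconst_res.
Proof.
split.
- by move=> U V h s t; apply: val_inj.
- by move=> U V h a s; apply: val_inj.
- by move=> U h s; apply: val_inj.
- by move=> U V W h1 h2 h3 s; apply: val_inj.
- move=> U J V h cov s t eq_st; apply: val_inj => /=.
  have [p /cov [j _ _]] := open_nonempty U.
  by have /(congr1 val) := eq_st j.
- move=> U J V h cov s eq_s.
  have s_const i j : elt_of (s i) = elt_of (s j) by have /(congr1 val) := eq_s i j.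
  have [p0 /cov [j0 _ _]] := open_nonempty U.
  have sU : elt_of (s j0) \in subconst U.
    apply/subconstP => p /cov [j _ pVj]; rewrite (s_const j0 j).
    by have /subconstP /(_ p pVj) := elt_ofP (s j).
  by exists (SubconstSec sU) => j; apply: val_inj; rewrite /= (s_const j0 j).
Qed.
Definition subconst_sheaf : sheaf := Sheaf subconst_is_sheaf.
End Subconstant.
End Opens.

Arguments res {k X} F [U V] h s : rename.
Arguments ares {k X} A [U V] h s : rename.
Arguments happ {k X F G U} a [W] h s : rename.
Arguments ev {k X F p n} e [U] pU s : rename.
Arguments compl1 {k X} p.
Notation "''O' U" := (structure_ring U) (at level 8, U at level 2).

Section P1.
Variable k : closedFieldType.
Local Notation K := (ratfun k).
Local Notation t := (tvar k).

(* The points of the projective line: [Some a] is the point t = a, [None] is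
   t = infinity.  In the latter case u and v are multiplied by t^-d and then
   evaluated at t^-1 = 0. *)
Definition P1_value (x : option k) (f : K) (c : k) : Prop :=
  match x with
  | Some a => exists u v : {poly k},
      [/\ v.[a] != 0, f = fracp u / fracp v & c = u.[a] / v.[a]]
  | None => exists (d : nat) (u v : {poly k}),
      [/\ (size u <= d.+1)%N, (size v <= d.+1)%N, v`_d != 0,
          f = fracp u / fracp v & c = u`_d / v`_d]
  end.

Lemma closed_field_infinite : infinite_set [set: k].
Proof.
move=> /finite_seqP [s es].
pose p : {poly k} := \prod_(a <- s) ('X - a%:P) + 1.
have all_s a : a \in s by have : [set: k] a by []; rewrite es.
have sgt0 : (0 < size s)%N by case: (s) (all_s 0).
have : size p != 1%N.
  by rewrite size_polyDl size_prod_XsubC ?size_poly1 // eqSS -lt0n.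
move=> /closed_rootP [a]; rewrite /root hornerD hornerC.
have /rootP -> : root (\prod_(a <- s) ('X - a%:P)) a by rewrite root_prod_XsubC.
by rewrite add0r oner_eq0.
Qed.

Lemma P1_infinite : infinite_set [set: option k].
Proof.
move=> fin; apply: closed_field_infinite.
have := @finite_preimage _ _ [set: option k] Some.
by rewrite preimage_setT; apply => // x y _ _ [].
Qed.

Lemma P1_value_cst x c : P1_value x (fracp c%:P) c.
Proof.
case: x => [a|] /=.
- by exists c%:P, 1; rewrite !hornerC oner_eq0 rmorph1 !divr1.
- exists 0%N, c%:P, 1; rewrite !size_polyC !coefC rmorph1 !divr1 oner_eq0.
  by split=> //; case: (c != 0).
Qed.

Lemma fracp_neq0 (v : {poly k}) : v != 0 -> fracp v != 0.
Proof. by rewrite tofrac_eq0. Qed.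

Lemma coef_top (d e : nat) (u v : {poly k}) :
  (size u <= d.+1)%N -> (size v <= e.+1)%N -> (u * v)`_(d + e) = u`_d * v`_e.
Proof.
move=> su sv; rewrite coefM (bigD1 (inord d)) //= inordK ?ltnS ?leq_addr //.
rewrite addKn big1 ?addr0 // => i; rewrite -val_eqE /= inordK ?ltnS ?leq_addr //.
rewrite neq_ltn => /orP[lt_id|lt_di].
- by rewrite [v`__]nth_default ?mulr0 // (leq_trans sv) // ltn_subRL ltn_add2r.
- by rewrite nth_default ?mul0r // (leq_trans su).
Qed.

Lemma size_top (d e : nat) (u v : {poly k}) :
  (size u <= d.+1)%N -> (size v <= e.+1)%N -> (size (u * v)%R <= (d + e).+1)%N.
Proof.
move=> su sv; apply: leq_trans (size_polyMleq u v) _.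
by have := leq_add su sv; rewrite addSn addnS; case: (size u + size v)%N.
Qed.

Lemma P1_valueB x f g c d :
  P1_value x f c -> P1_value x g d -> P1_value x (f - g) (c - d).
Proof.
have sub_fracs (F : fieldType) (a b a' b' : F) : b != 0 -> b' != 0 ->
    a / b - a' / b' = (a * b' - a' * b) / (b * b').
  by move=> nb nb'; rewrite -mulNr addf_div // mulNr.
case: x => [a|] /=.
- move=> [u [v [nv -> ->]]] [u' [v' [nv' -> ->]]].
  exists (u * v' - u' * v), (v * v'); rewrite !hornerE mulf_neq0 //.
  have v0 w : w.[a] != 0 -> w != 0 by apply: contra_neq => ->; rewrite horner0.
  by rewrite !rmorphB !rmorphM /= !sub_fracs ?fracp_neq0 ?v0.
- move=> [m [u [v [su sv nv -> ->]]]] [m' [u' [v' [su' sv' nv' -> ->]]]].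
  exists (m + m')%N, (u * v' - u' * v), (v * v').
  have v0 i (w : {poly k}) : w`_i != 0 -> w != 0.
    by apply: contra_neq => ->; rewrite coef0.
  have top' : (u' * v)`_(m + m') = u'`_m' * v`_m by rewrite addnC coef_top.
  rewrite coefB top' (coef_top su sv') (coef_top sv sv').
  split; rewrite ?size_top ?mulf_neq0 //.
  + rewrite (leq_trans (size_polyD _ _)) // geq_max size_polyN size_top //=.
    by rewrite addnC size_top.
  + by rewrite !rmorphB !rmorphM /= sub_fracs ?fracp_neq0 ?(v0 _ _ nv) ?(v0 _ _ nv').
  + by rewrite sub_fracs.
Qed.

Lemma P1_valueM x f g c d :
  P1_value x f c -> P1_value x g d -> P1_value x (f * g) (c * d).
Proof.
case: x => [a|] /=.
- move=> [u [v [nv -> ->]]] [u' [v' [nv' -> ->]]].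
  by exists (u * u'), (v * v'); rewrite !hornerM mulf_neq0 // !mulf_div !rmorphM.
- move=> [m [u [v [su sv nv -> ->]]]] [m' [u' [v' [su' sv' nv' -> ->]]]].
  exists (m + m')%N, (u * u'), (v * v'); rewrite !coef_top //.
  by rewrite !size_top // mulf_neq0 // !mulf_div !rmorphM.
Qed.

Arguments P1_value : simpl never.

Definition P1 : curve k :=
  Curve P1_infinite P1_value_cst P1_valueB P1_valueM.

(* The nodal curve of arithmetic genus 1: the projective line with 0 and
   infinity glued to the node [None].  The local ring at a point consists of the
   functions on the normalization which are regular, with the same value, at all
   the points above it. *)
Definition normalization (x : option k) : option {a : k | a != 0} := obind insub x.

Definition nodal_value (q : option {a : k | a != 0}) (f : K) (c : k) : Prop :=
  forall x, normalization x = q -> P1_value x f c.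

Lemma normalizationK x : x = Some 0 \/ x = omap val (normalization x).
Proof.
case: x => [a|]; last by right.
have [->|a0] := eqVneq a 0; first by left.
by right; rewrite /= insubT.
Qed.

Lemma normalization_finite (F : set (option {a : k | a != 0})) :
  finite_set F -> finite_set (normalization @^-1` F).
Proof.
move=> finF; apply: (@sub_finite_set _ _ ([set Some 0] `|` omap val @` F)).
  move=> x Fx; have [->|xE] := normalizationK x; first by left.
  by right; exists (normalization x).
by rewrite finite_setU; split; [exact: finite_set1 | exact: finite_image].
Qed.

Lemma nodal_infinite : infinite_set [set: option {a : k | a != 0}].
Proof.
by move=> /normalization_finite; rewrite preimage_setT; exact: P1_infinite.
Qed.

Lemma nodal_value_cst q c : nodal_value q (fracp c%:P) c.
Proof. by move=> x _; exact: P1_value_cst. Qed.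
Lemma nodal_valueB q f g c d :
  nodal_value q f c -> nodal_value q g d -> nodal_value q (f - g) (c - d).
Proof. by move=> hf hg x xq; apply: P1_valueB; [exact: hf | exact: hg]. Qed.
Lemma nodal_valueM q f g c d :
  nodal_value q f c -> nodal_value q g d -> nodal_value q (f * g) (c * d).
Proof. by move=> hf hg x xq; apply: P1_valueM; [exact: hf | exact: hg]. Qed.

Definition nodal_curve : curve k :=
  Curve nodal_infinite nodal_value_cst nodal_valueB nodal_valueM.
Local Notation C := nodal_curve.

Lemma preim_subproof (U : open C) : finite_set (~` (normalization @^-1` U)).
Proof. exact: (normalization_finite (open_cofinite U)). Qed.
Definition preim (U : open C) : open P1 := @Open _ P1 _ (preim_subproof U).

Lemma preimS (U V : open C) : V `<=` U -> preim V `<=` preim U.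
Proof. by move=> h x /h. Qed.

Lemma pullback_subproof (U : open C) (f : 'O U) : rat_of f \in regular_on (preim U).
Proof.
apply/regularP => x xU; have /regularP /(_ _ xU) [c hc] := rat_ofP f.
by exists c; exact: hc.
Qed.
Definition pullback (U : open C) (f : 'O U) : 'O (preim U) :=
  Regular (pullback_subproof f).

(* The dualizing sheaf, as the sheaf of regular differentials in the sense of
   Rosenlicht and Serre; f stands for the differential f dt.  At the node these
   are the differentials of the normalization with at most simple poles at 0 and
   infinity and opposite residues there.  The residues of f dt are the value of
   t f at t = 0, and that of - t f at t = infinity since dt/t = - ds/s for
   s = 1/t. *)
Definition omega_stalk (q : pt C) (f : K) : Prop :=
  match q with
  | Some a => exists c, P1_value (Some (val a)) f c
  | None => exists r0 roo, [/\ P1_value (Some 0) (t * f) r0,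
                               P1_value None (- (t * f)) roo & r0 + roo = 0]
  end.

Lemma P1_value0 x : P1_value x 0 0.
Proof. by have := P1_value_cst x 0; rewrite polyC0 rmorph0. Qed.
Lemma P1_valueN x f c : P1_value x f c -> P1_value x (- f) (- c).
Proof. by move=> hf; have := P1_valueB (P1_value0 x) hf; rewrite !sub0r. Qed.

Lemma omega_stalk0 q : omega_stalk q 0.
Proof.
case: q => [a|]; first by exists 0; exact: P1_value0.
by exists 0, 0; rewrite mulr0 oppr0 addr0; split=> //; exact: P1_value0.
Qed.
Lemma omega_stalkB q f g : omega_stalk q f -> omega_stalk q g -> omega_stalk q (f - g).
Proof.
case: q => [a|] /=; first by move=> [c hc] [d hd]; exists (c - d); exact: P1_valueB.
move=> [r [r' [h h' e]]] [s [s' [hs hs' e']]]; exists (r - s), (r' - s').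
rewrite mulrBr opprD; split.
- exact: P1_valueB.
- exact: P1_valueB.
- by rewrite addrACA -opprD e e' subr0.
Qed.
Lemma omega_stalkZ q f c g : @value _ C q f c -> omega_stalk q g -> omega_stalk q (f * g).
Proof.
case: q => [a|] /= hf.
  move=> [d hd]; exists (c * d); apply: P1_valueM hd; apply: hf.
  by rewrite /= insubT ?(valP a) // => ?; congr Some; exact: val_inj.
move=> [r [r' [h h' e]]]; exists (c * r), (c * r').
rewrite -mulrDr e mulr0 [t * _]mulrCA -mulrN; split=> //; apply: P1_valueM => //.
- by apply: hf; rewrite /= insubF // eqxx.
- exact: hf.
Qed.

Definition omega : sheaf C :=
  subconst_sheaf (@Stalks _ C K^o omega_stalk omega_stalk0 omega_stalkB omega_stalkZ).

(* The direct sum of the O(d_i) = O(d_i infinity). *)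
Definition line_sum_stalk n (d : 'I_n -> int) (x : pt P1) (v : 'rV[K]_n) : Prop :=
  forall i, exists c, P1_value x (if x is Some _ then v 0 i else v 0 i / t ^ d i) c.

Lemma line_sum_stalk0 n (d : 'I_n -> int) x : line_sum_stalk d x 0.
Proof.
move=> i; exists 0; rewrite mxE mul0r; case: x => [a|]; exact: P1_value0.
Qed.
Lemma line_sum_stalkB n (d : 'I_n -> int) x v w :
  line_sum_stalk d x v -> line_sum_stalk d x w -> line_sum_stalk d x (v - w).
Proof.
move=> hv hw i; have [c hc] := hv i; have [c' hc'] := hw i; exists (c - c').
by rewrite !mxE; case: x hc hc' {hv hw} => [a|] hc hc'; rewrite ?mulrBl; exact: P1_valueB.
Qed.
Lemma line_sum_stalkZ n (d : 'I_n -> int) x f c v :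
  @value _ P1 x f c -> line_sum_stalk d x v -> line_sum_stalk d x (f *: v).
Proof.
move=> hf hv i; have [c' hc'] := hv i; exists (c * c').
by rewrite !mxE; case: x hf hc' {hv} => [a|] hf hc'; rewrite -?mulrA; exact: P1_valueM.
Qed.
Definition line_sum n (d : 'I_n -> int) : sheaf P1 :=
  subconst_sheaf (Stalks (line_sum_stalk0 d) (@line_sum_stalkB n d) (@line_sum_stalkZ n d)).

(* The twist V(i): the restrictions of V to the charts t <> infinity and t <> 0
   are glued along multiplication by t^i.  A section of V(i) over U is a pair of
   sections a, b of V over the two parts of U such that a = t^i b on the overlap. *)
Section Twist.
Implicit Types U V W : open P1.

Definition chart0 U : open P1 := openI U (compl1 (None : pt P1)).
Definition chartoo U : open P1 := openI U (compl1 (Some 0 : pt P1)).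
Definition overlap U : open P1 := openI (chart0 U) (chartoo U).
Definition torus : open P1 := overlap (openT P1).

Lemma sub_torus U : overlap U `<=` torus.
Proof. by move=> x [[_ x0] [_ xoo]]; do !split. Qed.

Lemma chart0S U V : V `<=` U -> chart0 V `<=` chart0 U.
Proof. exact: setSI. Qed.
Lemma chartooS U V : V `<=` U -> chartoo V `<=` chartoo U.
Proof. exact: setSI. Qed.
Lemma overlapS U V : V `<=` U -> overlap V `<=` overlap U.
Proof. by move=> h; apply: setISS; exact: setSI. Qed.
Definition chart0_sub U : chart0 U `<=` U := @subIsetl _ _ _.
Definition chartoo_sub U : chartoo U `<=` U := @subIsetl _ _ _.
Definition overlap0 U : overlap U `<=` chart0 U := @subIsetl _ _ _.
Definition overlapoo U : overlap U `<=` chartoo U := @subIsetr _ _ _.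

Lemma t_regular : t \in regular_on torus.
Proof.
apply/regularP => -[a|] [[_ /= noo] _]; last by case: noo.
by exists a, 'X, 1; rewrite !hornerE oner_neq0 tofrac1 !divr1.
Qed.
Lemma tV_regular : t^-1 \in regular_on torus.
Proof.
apply/regularP => -[a|] [[_ noo] [_ n0]]; last by case: noo.
exists a^-1, 1, 'X; rewrite !hornerE; split=> //.
by apply/eqP => a0; apply: n0; rewrite /= a0.
Qed.
Lemma tpow_subproof (i : int) : t ^ i \in regular_on torus.
Proof.
case: i => i; first by rewrite -exprnP rpredX // t_regular.
by rewrite NegzE -exprnN -exprVn rpredX // tV_regular.
Qed.
Definition tpow (i : int) : 'O torus := Regular (tpow_subproof i).

Variables (F : sheaf P1) (i : int).

Definition twist_pred U : {pred F (chart0 U) * F (chartoo U)} := fun x =>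
  `[< res F (@overlap0 U) x.1 = fun_res (@sub_torus U) (tpow i) *: res F (@overlapoo U) x.2 >].
Arguments twist_pred : clear implicits.

Lemma twist_predP U x :
  reflect (res F (@overlap0 U) x.1 =
           fun_res (@sub_torus U) (tpow i) *: res F (@overlapoo U) x.2)
          (x \in twist_pred U).
Proof. exact: asboolP. Qed.

Lemma sheaf_res0 U V (h : V `<=` U) : res F h 0 = 0.
Proof. by apply: (addIr (res F h 0)); rewrite -(resD (sheafP F)) !add0r. Qed.
Lemma sheaf_resB U V (h : V `<=` U) : {morph res F h : x y / x - y}.
Proof.
move=> x y; apply: (addIr (res F h y)).
by rewrite -(resD (sheafP F)) !subrK.
Qed.
Lemma sheaf_res_sum U V (h : V `<=` U) m (s : 'I_m -> F U) :
  res F h (\sum_j s j) = \sum_j res F h (s j).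
Proof. exact: (big_morph _ (resD (sheafP F) h) (sheaf_res0 h)). Qed.

Lemma twist_zmod_closed U : zmod_closed (twist_pred U).
Proof.
split; first by apply/twist_predP; rewrite /= !sheaf_res0 scaler0.
move=> x y /twist_predP hx /twist_predP hy; apply/twist_predP.
by rewrite /= !sheaf_resB hx hy scalerBr.
Qed.
HB.instance Definition _ U :=
  GRing.isZmodClosed.Build _ (twist_pred U) (twist_zmod_closed U).

Record twist_sec U :=
  TwistSec { twist_pair :> F (chart0 U) * F (chartoo U);
             twist_pairP : twist_pair \in twist_pred U }.
HB.instance Definition _ U := [isSub for @twist_pair U].
HB.instance Definition _ U := [Choice of twist_sec U by <:].
HB.instance Definition _ U := [SubChoice_isSubZmodule of twist_sec U by <:].

Lemma twist_scale_subproof U (f : 'O U) (x : twist_sec U) :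
  (fun_res (@chart0_sub U) f *: (twist_pair x).1,
   fun_res (@chartoo_sub U) f *: (twist_pair x).2) \in twist_pred U.
Proof.
apply/twist_predP; rewrite /= !(resZ (sheafP F)).
have /twist_predP -> := twist_pairP x.
rewrite !scalerA [in RHS]mulrC; congr (_ * _ *: _); exact: val_inj.
Qed.
Definition twist_scale U (f : 'O U) (x : twist_sec U) : twist_sec U :=
  TwistSec (twist_scale_subproof f x).

Fact twist_scaleA U (f g : 'O U) x :
  twist_scale f (twist_scale g x) = twist_scale (f * g) x.
Proof.
by apply: val_inj; congr pair; rewrite /= scalerA; congr (_ *: _); exact: val_inj.
Qed.
Fact twist_scale1 U : left_id 1 (@twist_scale U).
Proof.
move=> x; apply: val_inj => /=; case: (twist_pair x) => a b /=.
by congr pair; rewrite -[RHS]scale1r; congr (_ *: _); exact: val_inj.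
Qed.
Fact twist_scaleDr U : right_distributive (@twist_scale U) +%R.
Proof. by move=> f x y; apply: val_inj; congr pair; rewrite /= scalerDr. Qed.
Fact twist_scaleDl U (x : twist_sec U) :
  {morph @twist_scale U ^~ x : f g / f + g}.
Proof.
by move=> f g; apply: val_inj; congr pair; rewrite /= -scalerDl; congr (_ *: _);
  exact: val_inj.
Qed.
HB.instance Definition _ U := GRing.Zmodule_isLmodule.Build ('O U) (twist_sec U)
  (@twist_scaleA U) (@twist_scale1 U) (@twist_scaleDr U) (@twist_scaleDl U).

Lemma twist_res_subproof U V (h : V `<=` U) (x : twist_sec U) :
  (res F (chart0S h) (twist_pair x).1, res F (chartooS h) (twist_pair x).2)
    \in twist_pred V.
Proof.
apply/twist_predP => /=.
rewrite (res_comp (sheafP F) _ _ (subset_trans (overlapS h) (@overlap0 U))).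
rewrite (res_comp (sheafP F) _ _ (subset_trans (overlapS h) (@overlapoo U))).
rewrite -(res_comp (sheafP F) (@overlap0 U) (overlapS h)).
rewrite -(res_comp (sheafP F) (@overlapoo U) (overlapS h)).
have /twist_predP -> := twist_pairP x.
by rewrite (resZ (sheafP F)); congr (_ *: _); exact: val_inj.
Qed.
Definition twist_res U V (h : V `<=` U) (x : twist_sec U) : twist_sec V :=
  TwistSec (twist_res_subproof h x).

Lemma twist_is_sheaf : is_sheaf (sec := twist_sec) twist_res.
Proof.
have cover_chart (D : set (pt P1)) U J (V : J -> open P1) :
    U `<=` \bigcup_j V j -> U `&` D `<=` \bigcup_j (V j `&` D).
  by move=> cov x [/cov[j _ xj] xD]; exists j.
split.
- by move=> U V h x y; apply: val_inj; congr pair; exact: (resD (sheafP F)).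
- move=> U V h f x; apply: val_inj; congr pair; rewrite /= (resZ (sheafP F));
  by congr (_ *: _); exact: val_inj.
- move=> U h x; apply: val_inj => /=; case: (twist_pair x) => a b /=.
  by rewrite !(res_id (sheafP F)).
- by move=> U V W h1 h2 h3 x; apply: val_inj; congr pair; exact: (res_comp (sheafP F)).
- move=> U J V h cov x y eq_xy; apply: val_inj.
  rewrite /= [twist_pair x]surjective_pairing [twist_pair y]surjective_pairing.
  congr pair.
  + apply: (res_sep (sheafP F) (V := fun j => chart0 (V j))
    (h := fun j => chart0S (h j))).
      exact: cover_chart.
    by move=> j; have /(congr1 val) [] := eq_xy j.
  + apply: (res_sep (sheafP F) (V := fun j => chartoo (V j))
    (h := fun j => chartooS (h j))).
      exact: cover_chart.
    by move=> j; have /(congr1 val) [] := eq_xy j.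
- move=> U J V h cov s eq_s.
  have sub0 i1 i2 : openI (chart0 (V i1)) (chart0 (V i2)) `<=` chart0 (openI (V i1) (V i2)).
    by move=> x [[x1 ?] [x2 _]]; do !split.
  have suboo i1 i2 : openI (chartoo (V i1)) (chartoo (V i2)) `<=` chartoo (openI (V i1) (V i2)).
    by move=> x [[x1 ?] [x2 _]]; do !split.
  have [||a aE] := res_glue (sheafP F) (U := chart0 U) (V := fun j => chart0 (V j))
    (fun j => chart0S (h j)) _ (s := fun j => (twist_pair (s j)).1).
  + exact: cover_chart.
  + move=> i1 i2; have /(congr1 val) [e _] := eq_s i1 i2.
    have /= := congr1 (res F (sub0 i1 i2)) e.
    by rewrite (res_comp (sheafP F) _ _ (@openIl _ _ (chart0 (V i1)) (chart0 (V i2))))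
               (res_comp (sheafP F) _ _ (@openIr _ _ (chart0 (V i1)) (chart0 (V i2)))).
  have [||b bE] := res_glue (sheafP F) (U := chartoo U) (V := fun j => chartoo (V j))
    (fun j => chartooS (h j)) _ (s := fun j => (twist_pair (s j)).2).
  + exact: cover_chart.
  + move=> i1 i2; have /(congr1 val) [_ e] := eq_s i1 i2.
    have /= := congr1 (res F (suboo i1 i2)) e.
    by rewrite (res_comp (sheafP F) _ _ (@openIl _ _ (chartoo (V i1)) (chartoo (V i2))))
               (res_comp (sheafP F) _ _ (@openIr _ _ (chartoo (V i1)) (chartoo (V i2)))).
  have ab : (a, b) \in twist_pred U.
    apply/twist_predP => /=.
    apply: (res_sep (sheafP F) (V := fun j => overlap (V j))
    (h := fun j => overlapS (h j))).
      by move=> x [[xU x0] [_ xoo]]; have [j _ xj] := cov x xU; exists j => //; do !split.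
    move=> j.
    rewrite (resZ (sheafP F)).
    rewrite (res_comp (sheafP F) _ _ (subset_trans (@overlap0 (V j)) (chart0S (h j)))).
    rewrite (res_comp (sheafP F) _ _ (subset_trans (@overlapoo (V j)) (chartooS (h j)))).
    rewrite -(res_comp (sheafP F) (chart0S (h j)) (@overlap0 (V j))).
    rewrite -(res_comp (sheafP F) (chartooS (h j)) (@overlapoo (V j))).
    rewrite aE bE; have /twist_predP -> := twist_pairP (s j).
    by congr (_ *: _); exact: val_inj.
  exists (TwistSec ab) => j; apply: val_inj => /=; rewrite aE bE.
  by case: (twist_pair (s j)).
Qed.
Definition twist : sheaf P1 := Sheaf twist_is_sheaf.

Lemma tpowN U (s : F (overlap U)) :
  fun_res (@sub_torus U) (tpow (- i)) *: (fun_res (@sub_torus U) (tpow i) *: s) = s.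
Proof.
rewrite scalerA -[RHS]scale1r; congr (_ *: _); apply: val_inj => /=.
by rewrite -expfzDr ?addNr // fracp_neq0 // polyX_eq0.
Qed.
Lemma tpowNV U (s : F (overlap U)) :
  fun_res (@sub_torus U) (tpow i) *: (fun_res (@sub_torus U) (tpow (- i)) *: s) = s.
Proof. by rewrite -[RHS]tpowN !scalerA mulrC. Qed.

Lemma res_inj U V (h : V `<=` U) (h' : U `<=` V) : injective (res F h).
Proof.
move=> s s' /(congr1 (res F h')).
by rewrite !(res_comp (sheafP F) _ _ (@subset_refl _ U)) !(res_id (sheafP F)).
Qed.

Lemma lift0_sub W : W `<=` compl1 (None : pt P1) -> chartoo W `<=` overlap W.
Proof. by move=> h x [xW x0]; do !split => //; exact: h. Qed.
Lemma liftoo_sub W : W `<=` compl1 (Some 0 : pt P1) -> chart0 W `<=` overlap W.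
Proof. by move=> h x [xW x0]; do !split => //; exact: h. Qed.

Lemma lift0_subproof W (h : W `<=` compl1 (None : pt P1)) (s : F W) :
  (res F (@chart0_sub W) s,
   fun_res (subset_trans (lift0_sub h) (@sub_torus W)) (tpow (- i)) *:
     res F (@chartoo_sub W) s) \in twist_pred W.
Proof.
apply/twist_predP; rewrite /= (resZ (sheafP F)).
rewrite !(res_comp (sheafP F) _ _ (subset_trans (@overlap0 W) (@chart0_sub W))).
rewrite -[LHS]tpowNV; congr (_ *: (_ *: _)); exact: val_inj.
Qed.
Definition lift0 W (h : W `<=` compl1 (None : pt P1)) (s : F W) : twist_sec W :=
  TwistSec (lift0_subproof h s).

Lemma liftoo_subproof W (h : W `<=` compl1 (Some 0 : pt P1)) (s : F W) :
  (fun_res (subset_trans (liftoo_sub h) (@sub_torus W)) (tpow i) *: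
     res F (@chart0_sub W) s,
   res F (@chartoo_sub W) s) \in twist_pred W.
Proof.
apply/twist_predP; rewrite /= (resZ (sheafP F)).
rewrite !(res_comp (sheafP F) _ _ (subset_trans (@overlap0 W) (@chart0_sub W))).
congr (_ *: _); exact: val_inj.
Qed.
Definition liftoo W (h : W `<=` compl1 (Some 0 : pt P1)) (s : F W) : twist_sec W :=
  TwistSec (liftoo_subproof h s).

Lemma twist_eq0 W (h : W `<=` compl1 (None : pt P1)) (x y : twist_sec W) :
  (twist_pair x).1 = (twist_pair y).1 -> x = y.
Proof.
have /twist_predP := twist_pairP x; have /twist_predP := twist_pairP y.
move=> hy hx e1; have e2 : (twist_pair x).2 = (twist_pair y).2.
  apply: (res_inj (h := @overlapoo W) (lift0_sub h)).
  by rewrite -[LHS]tpowN -hx -[RHS]tpowN -hy e1.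
apply: val_inj; rewrite /= [twist_pair x]surjective_pairing.
by rewrite [twist_pair y]surjective_pairing e1 e2.
Qed.
Lemma twist_eqoo W (h : W `<=` compl1 (Some 0 : pt P1)) (x y : twist_sec W) :
  (twist_pair x).2 = (twist_pair y).2 -> x = y.
Proof.
have /twist_predP := twist_pairP x; have /twist_predP := twist_pairP y.
move=> hy hx e2; have e1 : (twist_pair x).1 = (twist_pair y).1.
  by apply: (res_inj (h := @overlap0 W) (liftoo_sub h)); rewrite hx hy e2.
apply: val_inj; rewrite /= [twist_pair x]surjective_pairing.
by rewrite [twist_pair y]surjective_pairing e1 e2.
Qed.

Lemma chart0_mem U : U (Some 0 : pt P1) -> chart0 U (Some 0).
Proof. by move=> U0; split. Qed.
Lemma chartoo_mem U : U (None : pt P1) -> chartoo U None.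
Proof. by move=> Uoo; split. Qed.

Section Frames.
Variable n : nat.

Section Frame0.
Variable e : fibre_frame F (Some 0 : pt P1) n.

Definition twist_ev0 U (pU : U (Some 0 : pt P1)) (x : twist U) : 'cV[k]_n :=
  ev e (chart0_mem pU) (twist_pair x).1.

Lemma twist_ev0D U (pU : U (Some 0 : pt P1)) : {morph twist_ev0 pU : s s' / s + s'}.
Proof. by move=> s s'; exact: evD. Qed.
Lemma twist_ev0Z U (pU : U (Some 0 : pt P1)) (f : 'O U) c s :
  value (Some 0 : pt P1) f c -> twist_ev0 pU (f *: s) = c *: twist_ev0 pU s.
Proof. by move=> hf; exact: evZ. Qed.
Lemma twist_ev0_res U V (pU : U (Some 0 : pt P1)) (pV : V (Some 0)) (h : V `<=` U) s :
  twist_ev0 pV (res twist h s) = twist_ev0 pU s.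
Proof. exact: ev_res. Qed.
Lemma twist_ev0_surj v : exists U (pU : U (Some 0 : pt P1)) s, twist_ev0 pU s = v.
Proof.
have [U [pU [s <-]]] := ev_surj e v.
exists (chart0 U), (chart0_mem pU), (lift0 (@openIr _ _ U (compl1 _)) (res F (@chart0_sub U) s)).
by rewrite /twist_ev0 /= !(ev_res e (chart0_mem pU)) (ev_res e pU).
Qed.
Lemma twist_ev0_ker U (pU : U (Some 0 : pt P1)) s : twist_ev0 pU s = 0 ->
  exists W (h : W `<=` U), W (Some 0 : pt P1) /\
  exists m (f : 'I_m -> 'O W) (u : 'I_m -> twist W),
  (forall j, value (Some 0 : pt P1) (f j) 0) /\ res twist h s = \sum_j f j *: u j.
Proof.
move=> /ev_ker [W [h [pW [m [f [u [f0 es]]]]]]].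
have hoo : W `<=` compl1 (None : pt P1) by move=> x /h [].
exists W, (subset_trans h (@chart0_sub U)); split=> //.
exists m, f, (fun j => lift0 hoo (u j)); split=> //.
apply: (twist_eq0 hoo).
rewrite (big_morph (fun x : twist W => (twist_pair x).1) (id1 := 0) (op1 := +%R)) //=.
transitivity (res F (@chart0_sub W) (\sum_j f j *: u j)).
  rewrite -es (res_comp (sheafP F) h (@chart0_sub W) (subset_trans (@chart0_sub W) h)).
  by congr (res _ _ _); exact: Prop_irrelevance.
rewrite sheaf_res_sum.
by apply: eq_bigr => j _; rewrite (resZ (sheafP F)).
Qed.

(* V(i)|_0 = V|_0 through the chart t <> infinity. *)
Definition twist_frame0 : fibre_frame twist (Some 0 : pt P1) n :=
  FibreFrame twist_ev0D twist_ev0Z twist_ev0_res twist_ev0_surj twist_ev0_ker.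
End Frame0.

Section Frameoo.
Variable e : fibre_frame F (None : pt P1) n.

Definition twist_evoo U (pU : U (None : pt P1)) (x : twist U) : 'cV[k]_n :=
  ev e (chartoo_mem pU) (twist_pair x).2.

Lemma twist_evooD U (pU : U (None : pt P1)) : {morph twist_evoo pU : s s' / s + s'}.
Proof. by move=> s s'; exact: evD. Qed.
Lemma twist_evooZ U (pU : U (None : pt P1)) (f : 'O U) c s :
  value (None : pt P1) f c -> twist_evoo pU (f *: s) = c *: twist_evoo pU s.
Proof. by move=> hf; exact: evZ. Qed.
Lemma twist_evoo_res U V (pU : U (None : pt P1)) (pV : V None) (h : V `<=` U) s :
  twist_evoo pV (res twist h s) = twist_evoo pU s.
Proof. exact: ev_res. Qed.
Lemma twist_evoo_surj v : exists U (pU : U (None : pt P1)) s, twist_evoo pU s = v.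
Proof.
have [U [pU [s <-]]] := ev_surj e v.
exists (chartoo U), (chartoo_mem pU), (liftoo (@openIr _ _ U (compl1 _)) (res F (@chartoo_sub U) s)).
by rewrite /twist_evoo /= !(ev_res e (chartoo_mem pU)) (ev_res e pU).
Qed.
Lemma twist_evoo_ker U (pU : U (None : pt P1)) s : twist_evoo pU s = 0 ->
  exists W (h : W `<=` U), W (None : pt P1) /\
  exists m (f : 'I_m -> 'O W) (u : 'I_m -> twist W),
  (forall j, value (None : pt P1) (f j) 0) /\ res twist h s = \sum_j f j *: u j.
Proof.
move=> /ev_ker [W [h [pW [m [f [u [f0 es]]]]]]].
have hoo : W `<=` compl1 (Some 0 : pt P1) by move=> x /h [].
exists W, (subset_trans h (@chartoo_sub U)); split=> //.
exists m, f, (fun j => liftoo hoo (u j)); split=> //.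
apply: (twist_eqoo hoo).
rewrite (big_morph (fun x : twist W => (twist_pair x).2) (id1 := 0) (op1 := +%R)) //=.
transitivity (res F (@chartoo_sub W) (\sum_j f j *: u j)).
  rewrite -es (res_comp (sheafP F) h (@chartoo_sub W) (subset_trans (@chartoo_sub W) h)).
  by congr (res _ _ _); exact: Prop_irrelevance.
rewrite sheaf_res_sum.
by apply: eq_bigr => j _; rewrite (resZ (sheafP F)).
Qed.

(* V(i)|_infinity = V|_infinity through the chart t <> 0. *)
Definition twist_frameoo : fibre_frame twist (None : pt P1) n :=
  FibreFrame twist_evooD twist_evooZ twist_evoo_res twist_evoo_surj twist_evoo_ker.
End Frameoo.

End Frames.
End Twist.

Section OrderOfBundle.
Variable n : nat.

(* I is a subset of End(V|_0) x End(V|_infinity), the fibres being identified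
   with k^n. *)
Local Notation endpair := ('M[k]_n * 'M[k]_n)%type.

Definition trace_pairing (x y : endpair) : k := \tr (x.1 *m y.1) - \tr (x.2 *m y.2).

Definition isotropic (I : {vspace endpair}) : Prop :=
  forall x y, x \in I -> y \in I -> trace_pairing x y = 0.

Definition maximal_isotropic (I : {vspace endpair}) : Prop :=
  isotropic I /\ forall J, isotropic J -> (I <= J)%VS -> J = I.

Definition unital_subalgebra (I : {vspace endpair}) : Prop :=
  (1%:M, 1%:M) \in I /\
  forall x y, x \in I -> y \in I -> (x.1 *m y.1, x.2 *m y.2) \in I.

Definition maximal_isotropic_subalgebra (I : {vspace endpair}) : Prop :=
  unital_subalgebra I /\ maximal_isotropic I.

Variables (V : sheaf P1) (e0 : fibre_frame V (Some 0 : pt P1) n)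
  (eoo : fibre_frame V (None : pt P1) n) (I : {vspace endpair}).

(* The sections over U of the subsheaf A(V, I) of the direct image of End(V). *)
Definition AVI_section (U : open C) (a : hom_on V V (preim U)) : Prop :=
  U None -> exists M, [/\ M \in I, fibre_action e0 a M.1 & fibre_action eoo a M.2].

(* phi is an isomorphism of sheaves of O_C-algebras from A onto A(V, I). *)
Record iso_onto_AVI (A : algsheaf C)
    (phi : forall U, asec A U -> hom_on V V (preim U)) : Prop := IsoOntoAVI {
  isoAVI_D : forall U, {morph phi U : x y / x + y >-> hom_add x y};
  isoAVI_Z : forall U (f : 'O U) x, phi U (f *: x) = hom_scale (pullback f) (phi U x);
  isoAVI_1 : forall U, phi U 1 = hom_id V (preim U);
  isoAVI_M : forall U, {morph phi U : x y / x * y >-> hom_comp x y};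
  isoAVI_res : forall (U U' : open C) (h : U' `<=` U) x,
    phi U' (ares A h x) = hom_restr (preimS h) (phi U x);
  isoAVI_inj : forall U, injective (phi U);
  isoAVI_im : forall U a, AVI_section a <-> exists x, phi U x = a
}.

Definition isomorphic_to_AVI (A : algsheaf C) : Prop :=
  exists phi, @iso_onto_AVI A phi.
End OrderOfBundle.

(* tau : A -> omega is such that nu : A -> Hom(A, omega) is an isomorphism. *)
Definition spherical_form (A : algsheaf C) (tau : hom_on A omega (openT C)) : Prop :=
  hom_nonzero tau /\ forall U, bijective (nu tau (U := U)).

Definition symmetric_form (A : algsheaf C) (tau : hom_on A omega (openT C)) : Prop :=
  forall (U : open C) (h : U `<=` openT C) (x y : asec A U),
  happ tau h (x * y) = happ tau h (y * x).

(* Such a tau is unique up to rescaling: nu identifies Hom(A, omega) with the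
   global sections of A, which are the constants. *)
Definition symmetric_spherical (A : algsheaf C) : Prop :=
  h0 A 1 /\ exists tau : hom_on A omega (openT C), spherical_form tau /\ symmetric_form tau.

End P1.
Arguments nodal_curve k : clear implicits.
Arguments line_sum {k n} d.

(* Main.v *)
Require Import Defs.
From HB Require Import structures.
From mathcomp Require Import all_boot all_order all_algebra generic_quotient.
From mathcomp Require Import boolp classical_sets cardinality.
From mathcomp Require Import ring zify.
Set Implicit Arguments.
Unset Strict Implicit.
Unset Printing Implicit Defensive.
Import Order.TTheory GRing.Theory Num.Theory.
Local Open Scope quotient_scope.
Local Open Scope classical_set_scope.
Local Open Scope ring_scope.

(** Write [K] for the field of rational functions. A coherent torsion free sheaf
    is determined by its stalks inside its generic stalk ([germ_map],
    [germ_glue]), and a morphism of such sheaves is a linear map between the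
    generic stalks respecting all the stalks ([hom_of_linear],
    [linear_of_hom]). So the order is a family of subalgebras of [M_n(K)], a
    bundle on the line a family of lattices in [K^n], and everything becomes
    linear algebra over [K] and over the local rings.

    Existence of the bundle. Let the lattice at a point of the line be generated
    by the standard one under the action of the stalk of the order at the image
    of the point ([order_lattice]). As the order is of finite type these lattices
    form a vector bundle ([order_locally_free]), on which the order acts. By
    symmetry [tau] is the trace times a rational differential, and since
    [tau 1] is a global section of the dualizing sheaf and [n] is invertible,
    this differential is a nonzero constant multiple of [dt / t] ([trace_form]).
    Sphericity says that the order is its own dual for [tau] ([self_dual]): a
    matrix stabilizing the lattices is in the order away from the node, because
    its products with elements of the order have regular traces, and it is in
    the order at the node when its action on the two fibres is orthogonal to the
    set [I] of actions of the order ([order_section]). Products of elements of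
    the order have residues with sum zero at the node, so [I] is isotropic, and
    since any pair of endomorphisms of the fibres lifts to a matrix stabilizing
    the two lattices ([approximation]), [I] is its own orthogonal, hence maximal
    isotropic, and the order consists of the endomorphisms acting through [I].

    Splitting type. Every bundle on the line is a sum of line bundles
    ([birkhoff_grothendieck]), here proved with a basis of successive minima for
    the order of the pole at infinity. Were two degrees to differ by at least
    two, there would be a nonzero nilpotent endomorphism vanishing at zero and at
    infinity; it would belong to the order whatever [I] is, against
    [h0 A 1] ([degrees_close]). So the degrees take at most two consecutive
    values, and a twist, which changes neither the endomorphisms nor their action
    on the fibres ([twist_AVI]), brings them to 0 and 1. *)

(** * Local rings *)

Section LocalRing.
Variables (k : fieldType) (X : curve k).

Definition local_ring (p : pt X) : {pred ratfun k} :=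
  fun f => `[< exists c, value p f c >].

Lemma local_ringP p f : reflect (exists c, value p f c) (f \in local_ring p).
Proof. exact: asboolP. Qed.

Lemma local_ring_subring_closed p : subring_closed (local_ring p).
Proof.
split.
- by apply/local_ringP; exists 1; have := value_cst p 1; rewrite polyC1 rmorph1.
- move=> f g /local_ringP[c hc] /local_ringP[d hd]; apply/local_ringP.
  by exists (c - d); exact: valueB.
- move=> f g /local_ringP[c hc] /local_ringP[d hd]; apply/local_ringP.
  by exists (c * d); exact: valueM.
Qed.

HB.instance Definition _ p :=
  GRing.isSubringClosed.Build (ratfun k) (local_ring p) (local_ring_subring_closed p).

Lemma value_local p f c : value p f c -> f \in local_ring p.
Proof. by move=> hf; apply/local_ringP; exists c. Qed.

Lemma cst_local p c : fracp c%:P \in local_ring p.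
Proof. exact: value_local (value_cst p c). Qed.

Lemma regular_onP (U : open X) f :
  (f \in regular_on U) <-> (forall p, U p -> f \in local_ring p).
Proof.
split=> [/regularP h p /h hp|h]; first exact/local_ringP.
by apply/regularP => p /h /local_ringP.
Qed.

Lemma rat_of_local (U : open X) (f : 'O U) p : U p -> rat_of f \in local_ring p.
Proof. by move=> pU; have /regular_onP := rat_ofP f; apply. Qed.
End LocalRing.

Section P1LocalRing.
Variable k : closedFieldType.
Local Notation K := (ratfun k).
Local Notation t := (tvar k).
Local Notation O x := (@local_ring k (P1 k) x).

Lemma P1_value_local x (f : K) c : P1_value x f c -> f \in O x.
Proof. exact: (@value_local _ (P1 k)). Qed.

Lemma fracpK (u v : {poly k}) : v != 0 -> fracp u / fracp v * fracp v = fracp u.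
Proof. by move=> nv; rewrite divfK // fracp_neq0. Qed.

Lemma fracp_div_eq (u v u' v' : {poly k}) : v != 0 -> v' != 0 ->
  fracp u / fracp v = fracp u' / fracp v' -> u * v' = u' * v.
Proof.
move=> nv nv' /eqP; rewrite eqr_div ?fracp_neq0 // -!rmorphM /=.
by rewrite tofrac_eq => /eqP.
Qed.

Lemma ratfunW (P : K -> Prop) :
  (forall u v, v != 0 -> P (fracp u / fracp v)) -> forall f, P f.
Proof.
move=> h; elim/quotW => x.
have -> : \pi x = fracp \n_x / fracp \d_x.
  have nd : fracp \d_x != 0 :> K by rewrite fracp_neq0 ?denom_ratioP.
  apply: (mulIf nd); rewrite divfK //; unlock FracField.tofrac.
  rewrite -[LHS]FracField.pi_mul; apply/eqmodP.
  rewrite /= FracField.equivfE /FracField.mulf.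
  by rewrite !numden_Ratio ?mulf_neq0 ?oner_eq0 ?denom_ratioP // !mulr1 mulrC.
by apply: h; exact: denom_ratioP.
Qed.

Lemma horner_neq0 (v : {poly k}) a : v.[a] != 0 -> v != 0.
Proof. by apply: contra_neq => ->; rewrite horner0. Qed.
Lemma coef_neq0 (v : {poly k}) d : v`_d != 0 -> v != 0.
Proof. by apply: contra_neq => ->; rewrite coef0. Qed.

Lemma P1_value_uniq x (f : K) c c' : P1_value x f c -> P1_value x f c' -> c = c'.
Proof.
case: x => [a|].
- move=> [u [v [nv -> ->]]] [u' [v' [nv' e ->]]].
  have := fracp_div_eq (horner_neq0 nv) (horner_neq0 nv') e.
  move=> /(congr1 (fun p => p.[a])); rewrite !hornerM => e'.
  by apply/eqP; rewrite eqr_div //; apply/eqP.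
- move=> [d [u [v [su sv nv -> ->]]]] [d' [u' [v' [su' sv' nv' e ->]]]].
  have := fracp_div_eq (coef_neq0 nv) (coef_neq0 nv') e.
  move=> /(congr1 (fun p : {poly k} => p`_(d + d'))).
  rewrite coef_top // [in RHS]addnC coef_top // => e'.
  by apply/eqP; rewrite eqr_div //; apply/eqP.
Qed.

Lemma P1_valueV x (f : K) c : P1_value x f c -> c != 0 -> P1_value x f^-1 c^-1.
Proof.
case: x => [a|].
- move=> [u [v [nv -> ->]]] nc; exists v, u; rewrite !invf_div; split=> //.
  by apply: contra_neq nc => ->; rewrite mul0r.
- move=> [d [u [v [su sv nv -> ->]]]] nc; exists d, v, u; rewrite !invf_div.
  by split=> //; apply: contra_neq nc => ->; rewrite mul0r.
Qed.

(** After cancelling the common zeros of numerator and denominator at the point,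
    one of the two does not vanish there; so the local rings are valuation
    rings. *)
Lemma local_ring_total x (f : K) : f \in O x \/ f^-1 \in O x.
Proof.
move: f; apply: ratfunW => u v nv.
case: x => [a|].
- wlog : u v nv / (size u <= size v)%N => [hw|].
    have [le_uv|/ltnW le_vu] := leqP (size u) (size v); first exact: hw.
    have [->|nu] := eqVneq u 0; first by left; rewrite rmorph0 mul0r rpred0.
    have [h|h] := hw v u nu le_vu; first by right; rewrite invf_div.
    by left; rewrite -invf_div.
  move=> _; have [m] := ubnP (size v); elim: m => // m IH in u v nv * => sv.
  have [va|va] := eqVneq v.[a] 0; last first.
    by left; apply/local_ringP; exists (u.[a] / v.[a]), u, v.
  have [ua|ua] := eqVneq u.[a] 0; last first.
    by right; apply/local_ringP; exists (v.[a] / u.[a]), v, u; rewrite invf_div.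
  have /factor_theorem[v' ev] : root v a by apply/rootP.
  have /factor_theorem[u' eu] : root u a by apply/rootP.
  have nv' : v' != 0 by apply: contra_neq nv => v0; rewrite ev v0 mul0r.
  have nXa : fracp ('X - a%:P) != 0 :> K by rewrite fracp_neq0 // polyXsubC_eq0.
  suff -> : fracp u / fracp v = fracp u' / fracp v' :> K.
    apply: IH => //; move: sv; rewrite ev size_Mmonic ?monicXsubC //.
    by rewrite size_XsubC addn2 /=.
  by rewrite eu ev !rmorphM /= -mulf_div divff // mulr1.
- have top (w z : {poly k}) : z != 0 -> (size w <= size z)%N ->
      fracp w / fracp z \in O (None : pt (P1 k)).
    move=> nz le_wz; apply/local_ringP.
    have zS : size z = (size z).-1.+1 by rewrite prednK // size_poly_gt0.
    exists (w`_(size z).-1 / z`_(size z).-1), (size z).-1, w, z.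
    by rewrite -zS -lead_coefE lead_coef_eq0.
  have [le_uv|/ltnW le_vu] := leqP (size u) (size v); first by left; apply: top.
  have [->|nu] := eqVneq u 0; first by left; rewrite rmorph0 mul0r rpred0.
  by right; rewrite invf_div; apply: top.
Qed.

Lemma poly_local a (p : {poly k}) : fracp p \in O (Some a : pt (P1 k)).
Proof.
apply/local_ringP; exists p.[a], p, 1.
by rewrite hornerC oner_neq0 rmorph1 !divr1.
Qed.

Lemma t_value a : P1_value (Some a) t a.
Proof. by exists 'X, 1; rewrite !hornerE oner_neq0 rmorph1 !divr1. Qed.

Lemma tV_value_oo : P1_value None t^-1 0.
Proof.
by exists 1%N, 1, 'X; rewrite size_poly1 size_polyX coefX coef1 rmorph1 div1r mul0r oner_neq0.
Qed.

Lemma t_neq0 : t != 0 :> K.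
Proof. by rewrite fracp_neq0 // polyX_eq0. Qed.

Lemma texp_neq0 (i : int) : t ^ i != 0 :> K.
Proof. by rewrite expfz_neq0 // t_neq0. Qed.

Lemma tV_local a : a != 0 -> t^-1 \in O (Some a : pt (P1 k)).
Proof. by move=> na; apply: (value_local (c := a^-1)); apply: P1_valueV (t_value a) na. Qed.

(** A root of the denominator has to be a root of the numerator, and the
    corresponding factor cancels. *)
Lemma local_finite_poly (f : K) :
  (forall a, f \in O (Some a : pt (P1 k))) -> exists p, f = fracp p.
Proof.
move: f; apply: ratfunW => u v nv.
have [m] := ubnP (size v); elim: m => // m IH in u v nv * => sv reg.
have [sv1|sv1] := eqVneq (size v) 1%N.
  have /size_poly1P[c nc ->] : size v == 1%N by apply/eqP.
  exists (c^-1 *: u); apply: (mulIf (fracp_neq0 (v := c%:P) _)).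
    by rewrite polyC_eq0.
  by rewrite fracpK ?polyC_eq0 // -rmorphM /= mulrC -scalerAr mul_polyC scalerA mulVf ?scale1r.
have [a va] := closed_rootP v sv1.
have /local_ringP[_ [u' [v' [nv' e _]]]] := reg a.
have := fracp_div_eq nv (horner_neq0 nv') e.
move=> /(congr1 (fun p => p.[a])); rewrite !hornerM (rootP va) mulr0 => /eqP.
rewrite mulf_eq0 (negPf nv') orbF => ua.
have /factor_theorem[v1 ev] := va; have /factor_theorem[u1 eu] : root u a by [].
have nv1 : v1 != 0 by apply: contra_neq nv => v0; rewrite ev v0 mul0r.
have nXa : fracp ('X - a%:P) != 0 :> K by rewrite fracp_neq0 // polyXsubC_eq0.
have e1 : fracp u / fracp v = fracp u1 / fracp v1 :> K.
  by rewrite eu ev !rmorphM /= -mulf_div divff // mulr1.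
rewrite e1; apply: IH => // [|b]; last by rewrite -e1.
by move: sv; rewrite ev size_Mmonic ?monicXsubC // size_XsubC addn2.
Qed.

Lemma local_everywhere_cst (f : K) : (forall x : pt (P1 k), f \in O x) ->
  exists c, f = fracp c%:P.
Proof.
move=> reg; have [p ep] := local_finite_poly (fun a => reg (Some a)).
have /local_ringP[_ [d [u [v [su sv nv e _]]]]] := reg None.
have : fracp p / fracp 1 = fracp u / fracp v :> K by rewrite -ep -e rmorph1 divr1.
move=> /fracp_div_eq -/(_ (oner_neq0 _) (coef_neq0 nv)); rewrite mulr1 => epu.
have [p0|np] := eqVneq p 0; first by exists 0; rewrite ep p0.
have svd : size v = d.+1.
  apply/eqP; rewrite eqn_leq sv ltnNge; apply: contra_neqN nv => ?.
  by rewrite nth_default.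
have sp : (size p <= 1)%N.
  have := su; rewrite -epu size_mul ?(coef_neq0 nv) // svd.
  by case: (size p) => [|[|m]] //=; lia.
by exists p`_0; rewrite ep {1}(size1_polyC sp).
Qed.

Lemma tpow_value_oo m (f : K) : exists N, forall e, (N <= e)%N ->
  P1_value None (f / t ^+ (m + e)) 0.
Proof.
move: f; apply: ratfunW => u v nv; exists (size u).+1 => e lee.
have svS : size v = (size v).-1.+1 by rewrite prednK // size_poly_gt0.
have nx : size (v * 'X^(m + e)) = (size v + (m + e))%N.
  by rewrite size_Mmonic ?monicXn // size_polyXn addnS.
exists (m + e + (size v).-1)%N, u, (v * 'X^(m + e)).
have lu : (size u <= m + e + (size v).-1)%N.
  by apply: leq_trans (leq_addr _ _); apply: leq_trans (leq_addl _ _); exact: ltnW.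
split.
- exact: ltnW.
- by rewrite nx; lia.
- by rewrite coefMXn ltnNge leq_addr /= addKn -lead_coefE lead_coef_eq0.
- by rewrite rmorphM rmorphXn /= invfM mulrA.
- by rewrite nth_default // mul0r.
Qed.

Lemma tpow_value0 (f : K) : exists N, forall e, (N <= e)%N ->
  P1_value (Some 0) (f * t ^+ e) 0.
Proof.
move: f; apply: ratfunW => u v nv.
have [m [v1 v10 ->]] := multiplicity_XsubC v 0.
rewrite nv /= in v10; exists m.+1 => e lee.
exists (u * 'X^(e - m)), v1; split.
- exact: v10.
- rewrite subr0 !rmorphM !rmorphXn /=.
  have gen (F : fieldType) (x y z : F) : z != 0 -> (m <= e)%N ->
      x / (y * z ^+ m) * z ^+ e = x * z ^+ (e - m) / y.
    move=> nz le_me; rewrite -{1}(subnK le_me) exprD invfM mulrA -!mulrA.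
    by rewrite [z ^+ (e - m) * _]mulrC mulKf ?expf_neq0 // [y^-1 * _]mulrC.
  by apply: gen; [exact: t_neq0|exact: ltnW].
- by rewrite hornerM hornerXn expr0n subn_eq0 leqNgt lee mulr0 mul0r.
Qed.

Definition uniformizer (x : pt (P1 k)) : K :=
  if x is Some a then fracp ('X - a%:P) else t^-1.

Lemma uniformizer_neq0 x : uniformizer x != 0.
Proof. by case: x => [a|] /=; rewrite ?invr_eq0 fracp_neq0 ?polyXsubC_eq0 ?polyX_eq0. Qed.

Lemma value0_uniformizer x (f : K) : P1_value x f 0 -> (uniformizer x)^-1 * f \in O x.
Proof.
case: x => [a|] /=.
- move=> [u [v [nv -> /esym/eqP]]].
  rewrite mulf_eq0 invr_eq0 (negPf nv) orbF => /factor_theorem[u1 ->].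
  apply/local_ringP; exists (u1.[a] / v.[a]), u1, v; split=> //.
  rewrite rmorphM /= mulrA [_^-1 * _]mulrC mulfK // fracp_neq0 // polyXsubC_eq0 //.
- move=> [d [u [v [su sv nv -> /esym/eqP]]]].
  rewrite mulf_eq0 invr_eq0 (negPf nv) orbF => /eqP ud; rewrite invrK.
  apply/local_ringP.
  exists (('X * u)`_d / v`_d), d, ('X * u), v; split=> //.
  + have [->|nu] := eqVneq u 0; first by rewrite mulr0 size_poly0.
    rewrite mulrC size_mulX // ltnS; move: su; rewrite leq_eqVlt ltnS => /predU1P[e|//].
    by move: nu; rewrite -lead_coef_eq0 lead_coefE e /= ud eqxx.
  + by rewrite rmorphM mulrA.
Qed.

Lemma uniformizerV_local x y : x != y -> y != None -> 
  (uniformizer x)^-1 \in O y.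
Proof.
case: y => // b; case: x => [a|] nab _ /=; last by rewrite invrK poly_local.
have nba : b - a != 0.
  by rewrite subr_eq0; apply: contra_neq nab => ->.
apply: (value_local (c := (b - a)^-1)); apply: P1_valueV nba.
by exists ('X - a%:P), 1; rewrite !hornerE oner_neq0 rmorph1 !divr1.
Qed.

Lemma uniformizerV_oo a : t / uniformizer (Some a) \in O (None : pt (P1 k)).
Proof.
apply/local_ringP.
exists (('X : {poly k})`_1 / ('X - a%:P)`_1), 1%N, 'X, ('X - a%:P).
by rewrite size_polyX size_XsubC coefB coefX coefC subr0 oner_neq0.
Qed.

(** The only possible poles are infinity and the roots of a denominator. *)
Lemma local_ring_cofinite (f : K) : finite_set [set x : pt (P1 k) | f \notin O x].
Proof.
move: f; apply: ratfunW => u v nv.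
have [s ev] := closed_field_poly_normal v.
apply: (@sub_finite_set _ _ ([set None] `|` Some @` [set` s])); last first.
  by rewrite finite_setU; split; [exact: finite_set1|exact: finite_image (finite_seq s)].
move=> [a|] /= nreg; [right|by left]; exists a => //; apply: contraNT nreg => nas.
apply/local_ringP; exists (u.[a] / v.[a]), u, v; split=> //.
move: nas; rewrite -root_prod_XsubC; apply: contra.
by rewrite {1}ev hornerZ mulf_eq0 lead_coef_eq0 (negPf nv).
Qed.

Lemma regular_locus_cofinite m n (M : 'M[K]_(m, n)) :
  finite_set (~` [set x : pt (P1 k) | M \is a mxOver (O x)]).
Proof.
apply: (@sub_finite_set _ _
  (\bigcup_(i in [set: 'I_m * 'I_n]) [set x : pt (P1 k) | M i.1 i.2 \notin O x])).
  move=> x /= nM; apply: contrapT => nE; apply: nM; apply/mxOverP => i j.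
  by apply: contrapT => /negP nMij; apply: nE; exists (i, j).
apply: bigcup_finite => [|i _]; last exact: local_ring_cofinite.
exact: finite_finset.
Qed.

Definition regular_locus m n (M : 'M[K]_(m, n)) : open (P1 k) :=
  Open (regular_locus_cofinite M).

Lemma regular_locusP m n (M : 'M[K]_(m, n)) x :
  regular_locus M x <-> M \is a mxOver (O x).
Proof. by []. Qed.

(** * Values of functions and matrices at a point *)

(** Outside the local ring the value is the junk value 0. *)
Definition residue (x : pt (P1 k)) (f : K) : k := xget 0 [set c | P1_value x f c].

Lemma residueP x f : f \in O x -> P1_value x f (residue x f).
Proof. by move=> /local_ringP[c hc]; rewrite /residue; case: xgetP => [c' _//|/(_ c)]. Qed.

Lemma residueE x f c : P1_value x f c -> residue x f = c.
Proof.
move=> hc; exact: P1_value_uniq (residueP (P1_value_local hc)) hc.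
Qed.

Lemma residue_cst x c : residue x (fracp c%:P) = c.
Proof. exact: residueE (P1_value_cst x c). Qed.

Lemma residueB x f g : f \in O x -> g \in O x ->
  residue x (f - g) = residue x f - residue x g.
Proof. by move=> hf hg; apply: residueE; apply: P1_valueB; exact: residueP. Qed.

Lemma residue0 x : residue x 0 = 0.
Proof. by apply: residueE; exact: P1_value0. Qed.

Lemma residueD x f g : f \in O x -> g \in O x ->
  residue x (f + g) = residue x f + residue x g.
Proof.
move=> hf hg; rewrite -{1}[g]opprK residueB ?rpredN //.
by rewrite -[- g]sub0r residueB ?rpred0 // residue0 sub0r opprK.
Qed.

Lemma residueM x f g : f \in O x -> g \in O x ->
  residue x (f * g) = residue x f * residue x g.
Proof. by move=> hf hg; apply: residueE; apply: P1_valueM; exact: residueP. Qed.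

Lemma residue_sum x (J : Type) (r : seq J) (P : pred J) (F : J -> K) :
  (forall j, P j -> F j \in O x) ->
  residue x (\sum_(j <- r | P j) F j) = \sum_(j <- r | P j) residue x (F j).
Proof.
move=> hF; suff [] : \sum_(j <- r | P j) F j \in O x /\
    residue x (\sum_(j <- r | P j) F j) = \sum_(j <- r | P j) residue x (F j) by [].
elim/big_ind2: _ => [|f c g d [hf <-] [hg <-]|j Pj]; rewrite ?rpred0 ?residue0 //.
- by rewrite rpredD ?residueD.
- by split=> //; exact: hF.
Qed.

Lemma residue_prod x (J : Type) (r : seq J) (P : pred J) (F : J -> K) :
  (forall j, P j -> F j \in O x) ->
  residue x (\prod_(j <- r | P j) F j) = \prod_(j <- r | P j) residue x (F j).
Proof.
move=> hF; suff [] : \prod_(j <- r | P j) F j \in O x /\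
    residue x (\prod_(j <- r | P j) F j) = \prod_(j <- r | P j) residue x (F j) by [].
elim/big_ind2: _ => [|f c g d [hf <-] [hg <-]|j Pj].
- by rewrite rpred1 -tofrac1 -polyC1 residue_cst.
- by rewrite rpredM ?residueM.
- by split=> //; exact: hF.
Qed.

Definition residue_mx x m n (M : 'M[K]_(m, n)) : 'M[k]_(m, n) := map_mx (residue x) M.

Lemma residue_mxD x m n (M N : 'M[K]_(m, n)) :
  M \is a mxOver (O x) -> N \is a mxOver (O x) ->
  residue_mx x (M + N) = residue_mx x M + residue_mx x N.
Proof.
move=> /mxOverP hM /mxOverP hN; apply/matrixP => i j.
by rewrite !mxE residueD.
Qed.

Lemma residue_mxZ x m n f (M : 'M[K]_(m, n)) : f \in O x -> M \is a mxOver (O x) ->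
  residue_mx x (f *: M) = residue x f *: residue_mx x M.
Proof.
by move=> hf /mxOverP hM; apply/matrixP => i j; rewrite !mxE residueM.
Qed.

Lemma residue_mxM x m n p (M : 'M[K]_(m, n)) (N : 'M[K]_(n, p)) :
  M \is a mxOver (O x) -> N \is a mxOver (O x) ->
  residue_mx x (M *m N) = residue_mx x M *m residue_mx x N.
Proof.
move=> /mxOverP hM /mxOverP hN; apply/matrixP => i j.
rewrite !mxE residue_sum => [|l _]; last by rewrite rpredM.
by apply: eq_bigr => l _; rewrite !mxE residueM.
Qed.

Definition cst_mx m n (M : 'M[k]_(m, n)) : 'M[K]_(m, n) := map_mx (fun c => fracp c%:P) M.

Lemma cst_mx_local x m n (M : 'M[k]_(m, n)) : cst_mx M \is a mxOver (O x).
Proof. by apply/mxOverP => i j; rewrite mxE; exact: cst_local. Qed.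

Lemma residue_cst_mx x m n (M : 'M[k]_(m, n)) : residue_mx x (cst_mx M) = M.
Proof. by apply/matrixP => i j; rewrite !mxE residue_cst. Qed.

Lemma residue_mx0 x m n : residue_mx x (0 : 'M[K]_(m, n)) = 0.
Proof. by apply/matrixP => i j; rewrite !mxE residue0. Qed.

Lemma residue_mx1 x n : residue_mx x (1%:M : 'M[K]_n) = 1%:M.
Proof.
apply/matrixP => i j; rewrite !mxE; case: eqP => _; rewrite ?mulr0n ?mulr1n ?residue0 //.
by rewrite -tofrac1 -polyC1 residue_cst.
Qed.

Lemma residue_tr x n (M : 'M[K]_n) : M \is a mxOver (O x) ->
  \tr M \in O x /\ residue x (\tr M) = \tr (residue_mx x M).
Proof.
move=> /mxOverP hM; split; first by apply: rpred_sum => i _.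
by rewrite /mxtrace residue_sum => [|i _//]; apply: eq_bigr => i _; rewrite mxE.
Qed.

Lemma det_local x n (M : 'M[K]_n) : M \is a mxOver (O x) -> \det M \in O x.
Proof.
move=> /mxOverP hM; apply: rpred_sum => s _; rewrite rpredM ?rpredX ?rpredN ?rpred1 //.
by apply: rpred_prod => i _.
Qed.

Lemma residue_det x n (M : 'M[K]_n) : M \is a mxOver (O x) ->
  residue x (\det M) = \det (residue_mx x M).
Proof.
move=> /mxOverP hM; have hN1 (s : bool) : (-1) ^+ s \in O x by rewrite rpredX ?rpredN ?rpred1.
rewrite /determinant residue_sum => [|s _]; last first.
  by rewrite rpredM ?hN1 ?rpred_prod.
apply: eq_bigr => s _; rewrite residueM ?hN1 ?rpred_prod //; congr (_ * _).
  have -> : (-1) ^+ (perm.odd_perm s) = fracp ((-1) ^+ (perm.odd_perm s))%:P :> K.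
    by rewrite rmorphXn rmorphN1 rmorphXn rmorphN1.
  by rewrite residue_cst.
by rewrite residue_prod //; apply: eq_bigr => i _; rewrite mxE.
Qed.

(** The determinant is a unit of the local ring, its residue not being zero. *)
Lemma residue_unitmx x n (M : 'M[K]_n) : M \is a mxOver (O x) ->
  residue_mx x M \in unitmx -> M \in unitmx /\ invmx M \is a mxOver (O x).
Proof.
move=> hM; rewrite unitmxE -residue_det // unitfE => nd.
have hd := residueP (det_local hM).
have uM : M \in unitmx.
  rewrite unitmxE unitfE; apply: contra_neq nd => d0.
  by rewrite d0 residue0.
split=> //; rewrite /invmx uM; apply: mxOverZ.
  exact: P1_value_local (P1_valueV hd nd).
apply/mxOverP => i j; rewrite mxE; apply: rpredM; first by rewrite rpredX ?rpredN ?rpred1.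
by apply: det_local; apply/mxOverP => i' j'; rewrite !mxE (mxOverP hM).
Qed.

End P1LocalRing.

Section LinearFunctions.
Variables (R : nzRingType) (E E' : lmodType R) (f : E -> E') (lf : linear f).

Lemma linear_fun0 : f 0 = 0.
Proof. by apply: (addrI (f 0)); have := lf 1 0 0; rewrite !scale1r !addr0 => <-. Qed.

Lemma linear_funZ c v : f (c *: v) = c *: f v.
Proof. by have := lf c v 0; rewrite linear_fun0 !addr0. Qed.

Lemma linear_funD v w : f (v + w) = f v + f w.
Proof. by have := lf 1 v w; rewrite !scale1r. Qed.
End LinearFunctions.

(** * Sheaves inside a vector space over the function field *)

Section Germs.
Variables (k : fieldType) (X : curve k).
Local Notation K := (ratfun k).
Implicit Types (U V W : open X) (F G : sheaf X).

(** An embedding of the sheaf into the constant sheaf [E] identifying [E] with the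
    generic stalk. *)
Record germ_map F (E : lmodType K) (g : forall U, F U -> E) : Prop := GermMap {
  germD : forall U, {morph g U : s t / s + t};
  germZ : forall U (f : 'O U) s, g U (f *: s) = rat_of f *: g U s;
  germ_res : forall U V (h : V `<=` U) s, g V (res F h s) = g U s;
  germ_inj : forall U, injective (g U);
  germ_surj : forall v, exists U s, g U s = v
}.

Definition germ_stalk F (E : lmodType K) (g : forall U, F U -> E) (p : pt X) (v : E) :=
  exists U (_ : U p) s, g U s = v.

Section OneSheaf.
Variables (F : sheaf X) (E : lmodType K) (g : forall U, F U -> E) (gm : germ_map g).

Lemma germ0 U : g (0 : F U) = 0.
Proof. by apply: (addrI (g (0 : F U))); rewrite -(germD gm) !addr0. Qed.

Lemma germ_sum U m (s : 'I_m -> F U) : g (\sum_i s i) = \sum_i g (s i).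
Proof. exact: (big_morph _ (germD gm (U := U)) (germ0 U)). Qed.

Lemma germ_stalk_sec U (s : F U) p : U p -> germ_stalk g p (g s).
Proof. by move=> pU; exists U, pU, s. Qed.

(** Sections are determined by their germs, so local sections with a common
    germ glue. *)
Lemma germ_glue U v : (forall p, U p -> germ_stalk g p v) -> exists s : F U, g s = v.
Proof.
move=> h; pose J := {p | U p}.
have choose (j : J) : {V : open X & {s : F V | V (sval j) /\ g s = v}}.
  have [V /cid[pV /cid[s es]]] := cid (h _ (svalP j)).
  by exists V, s.
pose V j := openI (projT1 (choose j)) U.
pose s j : F (V j) := res F (@openIl _ _ _ _) (sval (projT2 (choose j))).
have gs j : g (s j) = v.
  by rewrite (germ_res gm); case: (svalP (projT2 (choose j))).
have cov : U `<=` \bigcup_j V j.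
  move=> p pU; exists (exist _ p pU) => //; split=> //.
  by case: (svalP (projT2 (choose (exist _ p pU)))).
have [|s' es'] := res_glue (sheafP F) (fun j => @openIr _ _ _ U) cov (s := s).
  by move=> i j; apply: (germ_inj gm); rewrite (germ_res gm) gs [RHS](germ_res gm) gs.
exists s'; have [p /cov [j _ _]] := open_nonempty U.
by rewrite -(gs j) -es' (germ_res gm).
Qed.

Lemma germ_surj_in U v : exists W (h : W `<=` U) (s : F W), g s = v.
Proof.
have [W [s <-]] := germ_surj gm v.
by exists (openI W U), (@openIr _ _ _ _), (res F (@openIl _ _ _ _) s); rewrite (germ_res gm).
Qed.
End OneSheaf.

Lemma hom_eq F G U (a b : hom_on F G U) :
  (forall W (h : W `<=` U) s, a W h s = b W h s) -> a = b.
Proof.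
case: a b => [a al ar] [b bl br] /= e.
have eab : a = b.
  apply: functional_extensionality_dep => W.
  by apply: functional_extensionality_dep => h; exact/funext/e.
by subst b; rewrite (Prop_irrelevance al bl) (Prop_irrelevance ar br).
Qed.

Section TwoSheaves.
Variables (F G : sheaf X) (E E' : lmodType K).
Variables (g : forall U, F U -> E) (g' : forall U, G U -> E').
Hypotheses (gm : germ_map g) (gm' : germ_map g').

Lemma germ_hom_eq U (a b : hom_on F G U) :
  (forall W (h : W `<=` U) s, g' (a W h s) = g' (b W h s)) -> a = b.
Proof. by move=> e; apply: hom_eq => W h s; apply: (germ_inj gm'); exact: e. Qed.

(** The image of a section is obtained by gluing, from its germ. *)
Lemma hom_of_linear U (f : E -> E') : linear f ->
  (forall p v, U p -> germ_stalk g p v -> germ_stalk g' p (f v)) ->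
  exists a : hom_on F G U, forall W (h : W `<=` U) s, g' (a W h s) = f (g s).
Proof.
move=> lf fstalk.
have ex W (h : W `<=` U) (s : F W) : {s' : G W | g' s' = f (g s)}.
  apply: cid; apply: (germ_glue gm') => p pW.
  by apply: fstalk; [exact: h | exact: germ_stalk_sec].
have linear_ex W h : linear (fun s : F W => sval (ex W h s)).
  move=> c s s'; apply: (germ_inj gm').
  rewrite (germD gm') (germZ gm') !(svalP (ex _ _ _)).
  by rewrite (germD gm) (germZ gm) lf.
have res_ex V W (hV : V `<=` U) (hW : W `<=` U) (h : W `<=` V) s :
    res G h (sval (ex V hV s)) = sval (ex W hW (res F h s)).
  apply: (germ_inj gm').
  by rewrite (germ_res gm') !(svalP (ex _ _ _)) (germ_res gm).
by exists (Defs.Hom linear_ex res_ex) => W h s /=; rewrite (svalP (ex _ _ _)).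
Qed.

Hypothesis regX : forall f : K, exists W : open X, f \in regular_on W.

(** On germs a morphism of sheaves is a single linear map: every vector is the
    germ of a section over some smaller open set, and the germ of the image
    does not depend on that section. *)
Lemma linear_of_hom U (a : hom_on F G U) :
  exists f : E -> E', linear f /\ (forall W (h : W `<=` U) s, g' (a W h s) = f (g s)).
Proof.
have wd W (h : W `<=` U) s W' (h' : W' `<=` U) s' : g s = g s' ->
    g' (a W h s) = g' (a W' h' s').
  move=> e.
  rewrite -(germ_res gm' (@openIl _ _ W W')) -[RHS](germ_res gm' (@openIr _ _ W W')).
  have hI : openI W W' `<=` U by apply: subset_trans h; exact: openIl.
  rewrite !(hom_res_comm _ _ hI); congr (g' (a _ _ _)).
  by apply: (germ_inj gm); rewrite !(germ_res gm).
have ex v : {W : open X & {h : W `<=` U & {s : F W | g s = v}}}.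
  by have [W /cid[h /cid[s es]]] := cid (germ_surj_in gm U v); exists W, h, s.
pose f v : E' := g' (a _ (projT1 (projT2 (ex v))) (sval (projT2 (projT2 (ex v))))).
have fE W (h : W `<=` U) s : g' (a W h s) = f (g s).
  by apply: wd; rewrite (svalP (projT2 (projT2 (ex _)))).
exists f; split=> // c v w.
have [W1 [h1 [s1 e1]]] := germ_surj_in gm U v.
have [W2 [h2 [s2 e2]]] := germ_surj_in gm W1 w.
have [W3 cW3] := regX c; pose W := openI W2 W3.
have hW1 : W `<=` W1 by apply: subset_trans h2; exact: openIl.
have hW2 : W `<=` W2 by exact: openIl.
have hU : W `<=` U by apply: subset_trans h1.
have cW : c \in regular_on W.
  by apply/regular_onP => p [_ pW3]; move/regular_onP: cW3; apply.
have es1 : g (res F hW1 s1) = v by rewrite (germ_res gm).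
have es2 : g (res F hW2 s2) = w by rewrite (germ_res gm).
have := fE W hU (Regular cW *: res F hW1 s1 + res F hW2 s2).
rewrite hom_linear (germD gm') (germZ gm') !fE (germD gm) (germZ gm) es1 es2.
by move=> <-.
Qed.

Lemma linear_of_hom_stalk U (a : hom_on F G U) (f : E -> E') :
  (forall W (h : W `<=` U) s, g' (a W h s) = f (g s)) ->
  forall p v, U p -> germ_stalk g p v -> germ_stalk g' p (f v).
Proof.
move=> fE p v pU [W [pW [s <-]]].
have h := @openIr _ _ W U; have pWU : openI W U p by [].
exists (openI W U), pWU, (a _ h (res F (@openIl _ _ W U) s)).
by rewrite fE (germ_res gm).
Qed.
End TwoSheaves.

Lemma subconst_germ_map (E : lmodType K) (L : stalks X E) :
  (forall v, exists U : open X, forall p, U p -> L p v) ->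
  germ_map (F := subconst_sheaf L) (fun U s => elt_of s).
Proof.
move=> Lsurj; split=> //= [U s s'|v]; first exact: val_inj.
have [U hU] := Lsurj v; have sU : v \in subconst L U by exact/subconstP.
by exists U, (SubconstSec sU).
Qed.
End Germs.

(** * Lattices over the projective line *)

Section Lattices.
Variable k : closedFieldType.
Local Notation K := (ratfun k).
Local Notation t := (tvar k).
Local Notation O x := (@local_ring k (P1 k) x).

(** The columns of [B] form a basis of [L x] over the local ring. *)
Definition frame_at n (L : pt (P1 k) -> 'cV[K]_n -> Prop) x (B : 'M[K]_n) : Prop :=
  B \in unitmx /\ forall v, L x v <-> invmx B *m v \is a mxOver (O x).

Definition locally_free n (L : pt (P1 k) -> 'cV[K]_n -> Prop) : Prop :=
  forall p, exists U : open (P1 k), U p /\ exists B, forall x, U x -> frame_at L x B.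

Lemma local_div_trans x (f g h : K) :
  g != 0 -> f / g \in O x -> g / h \in O x -> f / h \in O x.
Proof.
move=> ng fg gh; have -> : f / h = f / g * (g / h) by rewrite mulrA divfK.
exact: rpredM.
Qed.

Lemma local_div_total x (f g : K) : (f / g \in O x) || (g / f \in O x).
Proof.
by case: (local_ring_total x (f / g)); rewrite ?invf_div => ->; rewrite ?orbT.
Qed.

(** Among the maximal minors of a matrix of generators take one dividing all the
    others in the local ring at [x], which exists in a valuation ring; by Cramer's
    rule all the generators are combinations, regular at [x], of the columns of
    that minor.  [S] is the matrix selecting them. *)
Lemma local_basis x n N (W : 'M[K]_(n, N)) : row_free W ->
  exists S : 'M[K]_(N, n), [/\ forall y, S \is a mxOver (O y),
    W *m S \in unitmx & invmx (W *m S) *m W \is a mxOver (O x)].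
Proof.
move=> rW; pose D (s : {ffun 'I_n -> 'I_N}) := \det (colsub s W).
pose ord (f g : K) := f / g \in O x.
have rWT : row_full W^T by rewrite /row_full mxrank_tr.
have D0 : D (fullrankfun rWT) != 0.
  have := fullrowsub_unit rWT; rewrite -unitmx_tr unitmxE unitfE.
  by congr (\det _ != 0); apply/matrixP => i j; rewrite !mxE.
pose ordV f g := ord g f.
case: (extremum_inP (ord := ordV) (P := [pred s | D s != 0]) (F := D)
         (i0 := fullrankfun rWT)) => //.
- by move=> s /= ns; rewrite /ordV /ord divff // rpred1.
- by move=> s2 s1 s3 n2 _ _ h12 h23; exact: local_div_trans h23 h12.
- by move=> s1 s2 _ _; exact: local_div_total.
move=> s /= ns smax.
pose S : 'M[K]_(N, n) := \matrix_(i, j) (i == s j)%:R.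
have eWS : W *m S = colsub s W.
  apply/matrixP => i j; rewrite !mxE (bigD1 (s j)) //= big1 ?addr0 => [|l nl].
    by rewrite mxE eqxx mulr1.
  by rewrite mxE (negPf nl) mulr0.
have uB : W *m S \in unitmx by rewrite eWS unitmxE unitfE.
exists S; split=> //.
  by move=> y; apply/mxOverP => i j; rewrite mxE; case: eqP; rewrite ?rpred0 ?rpred1.
apply/mxOverP => j l; pose s' : {ffun 'I_n -> 'I_N} := [ffun i => if i == j then l else s i].
suff -> : (invmx (W *m S) *m W) j l = D s' / D s.
  have [->|ns'] := eqVneq (D s') 0; first by rewrite mul0r rpred0.
  exact: smax.
rewrite /invmx uB -scalemxAl mxE eWS mulrC; congr (_ / _).
rewrite mxE /D (expand_det_col _ j); apply: eq_bigr => i _.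
rewrite !mxE ffunE eqxx mulrC; congr (_ * _).
rewrite /cofactor; congr (_ * \det _); apply/matrixP => a b.
by rewrite !mxE ffunE eq_sym (negPf (neq_lift _ _)).
Qed.

Section OneLattice.
Variables (n : nat) (L : pt (P1 k) -> 'cV[K]_n -> Prop) (x : pt (P1 k)) (B : 'M[K]_n).
Hypothesis frB : frame_at L x B.

Lemma frame_unit : B \in unitmx. Proof. by case: frB. Qed.

Lemma frameP v : L x v <-> invmx B *m v \is a mxOver (O x).
Proof. by case: frB => _; apply. Qed.

Lemma lattice0 : L x 0.
Proof. by apply/frameP; rewrite mulmx0 rpred0. Qed.

Lemma latticeD v w : L x v -> L x w -> L x (v + w).
Proof. by move=> /frameP hv /frameP hw; apply/frameP; rewrite mulmxDr rpredD. Qed.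

Lemma latticeZ f v : f \in O x -> L x v -> L x (f *: v).
Proof. by move=> hf /frameP hv; apply/frameP; rewrite -scalemxAr mxOverZ. Qed.

Lemma lattice_sum m (v : 'I_m -> 'cV[K]_n) : (forall i, L x (v i)) -> L x (\sum_i v i).
Proof. by move=> hv; elim/big_ind: _ => //; [exact: lattice0|exact: latticeD]. Qed.

Lemma lattice_frame (w : 'cV[K]_n) : L x (B *m w) <-> w \is a mxOver (O x).
Proof. by split=> [/frameP|h]; [|apply/frameP]; rewrite mulKmx // frame_unit. Qed.

Lemma lattice_stable (M : 'M[K]_n) :
  (forall v, L x v -> L x (M *m v)) <-> invmx B *m M *m B \is a mxOver (O x).
Proof.
have uB := frame_unit; split=> [h|hM v /frameP hv].
- apply/mxOverP => i j.
  have : L x (M *m (B *m delta_mx j 0)).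
    apply/h/lattice_frame/mxOverP => a b.
    by rewrite mxE; case: (_ && _); rewrite ?rpred0 ?rpred1.
  move/frameP/mxOverP => /(_ i 0).
  by rewrite !mulmxA -colE mxE.
- by apply/frameP; rewrite -{1}[v](mulKVmx uB) !mulmxA -mulmxA mxOverM.
Qed.

(** This is Nakayama's lemma: a kernel vector of the matrix of the residues would
    give a combination with constant coefficients divisible by the local parameter
    within the lattice, and a matrix with invertible residue is invertible over
    the local ring. *)
Lemma frame_of_independent (U : 'M[K]_n) : (forall j, L x (col j U)) ->
  (forall c : 'cV[k]_n, c != 0 -> ~ L x ((uniformizer x)^-1 *: (U *m cst_mx c))) ->
  frame_at L x U.
Proof.
move=> hU indep; have uB := frame_unit; pose G := invmx B *m U.
have lG : G \is a mxOver (O x).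
  by apply/mxOverP => i j; have /frameP/mxOverP/(_ i 0) := hU j; rewrite colE mulmxA -colE mxE.
have uG : residue_mx x G \in unitmx.
  rewrite -unitmx_tr unitmxE unitfE; apply/negP => /det0P[c nc cG].
  apply: (indep c^T); first by rewrite trmx_eq0.
  apply/frameP; rewrite -scalemxAr mulmxA -/G; apply/mxOverP => i j.
  rewrite mxE; apply: value0_uniformizer.
  have lc := cst_mx_local x c^T.
  have := residue_mxM lG lc.
  rewrite residue_cst_mx -[residue_mx x G]trmxK -trmx_mul cG trmx0.
  move=> /matrixP /(_ i j); rewrite mxE [RHS]mxE => <-.
  by apply: residueP; apply/mxOverP: i j; exact: mxOverM.
have [uG' lG'] := residue_unitmx lG uG.
have eU : B *m G = U by rewrite /G (mulKVmx uB).
have uU : U \in unitmx by rewrite -eU unitmx_mul uB.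
split=> // v; split=> [/frameP hv|hv].
- suff -> : invmx U *m v = invmx G *m (invmx B *m v) by exact: mxOverM.
  apply: (canLR (mulKmx uU)).
  by rewrite -eU -mulmxA (mulKVmx uG') (mulKVmx uB).
- apply/frameP; suff -> : invmx B *m v = G *m (invmx U *m v) by exact: mxOverM.
  by rewrite /G -mulmxA (mulKVmx uU).
Qed.
End OneLattice.

Section LocallyFree.
Variables (n : nat) (L : pt (P1 k) -> 'cV[K]_n -> Prop).
Hypothesis Lfree : locally_free L.

Lemma locally_free_frame x : exists B, frame_at L x B.
Proof. by have [U [xU [B hB]]] := Lfree x; exists B; exact: hB. Qed.

(** A single frame is valid at almost all points, and there stability means that
    finitely many functions are regular. *)
Lemma stable_cofinite (M : 'M[K]_n) :
  exists U : open (P1 k), forall x, U x <-> (forall v, L x v -> L x (M *m v)).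
Proof.
have [U [_ [B hB]]] := Lfree None.
have fin : finite_set (~` [set x | forall v, L x v -> L x (M *m v)]).
  apply: sub_finite_set (open_cofinite (openI U (regular_locus (invmx B *m M *m B)))).
  by move=> x /= nM [xU /regular_locusP xM]; apply: nM; apply/(lattice_stable (hB x xU)).
by exists (Open fin).
Qed.

Lemma locally_free_generic v : exists U : open (P1 k), forall x, U x -> L x v.
Proof.
have [U [_ [B hB]]] := Lfree None.
exists (openI U (regular_locus (invmx B *m v))) => x [xU /regular_locusP xv].
exact/(frameP (hB x xU)).
Qed.
End LocallyFree.
End Lattices.

(** * The Birkhoff-Grothendieck theorem *)

Section Birkhoff.
Variable k : closedFieldType.
Local Notation K := (ratfun k).
Local Notation t := (tvar k).
Local Notation O x := (@local_ring k (P1 k) x).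

Lemma common_denominator m n (M : 'M[K]_(m, n)) : exists2 D : {poly k}, D != 0 &
  forall a, fracp D *: M \is a mxOver (O (Some a)).
Proof.
have den (ij : 'I_m * 'I_n) :
    exists v : {poly k}, v != 0 /\ exists u, fracp v * M ij.1 ij.2 = fracp u.
  move: (M _ _); apply: ratfunW => u v nv; exists v; split=> //; exists u.
  by rewrite mulrC fracpK.
have [d hd] := choice den; exists (\prod_ij d ij).
  by apply/prodf_neq0 => ij _; case: (hd ij).
move=> a; apply/mxOverP => i j; rewrite mxE (bigD1 (i, j)) //= mulrC rmorphM /= mulrA.
have [_ [u /= eu]] := hd (i, j); rewrite [M i j * _]mulrC eu -rmorphM.
exact: poly_local.
Qed.

Lemma change_frame n (c : K) (A B : 'M[K]_n) (v : 'cV[K]_n) : B \in unitmx ->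
  c *: (invmx A *m v) = (c *: (invmx A *m B)) *m (invmx B *m v).
Proof. by move=> uB; rewrite -scalemxAl -mulmxA mulKVmx. Qed.

Lemma tpow_local_oo (e : nat) : t ^- e \in O (None : pt (P1 k)).
Proof. by rewrite -exprVn rpredX // (P1_value_local (tV_value_oo k)). Qed.

Lemma fracp_local_oo (D : {poly k}) : fracp D / t ^+ size D \in O (None : pt (P1 k)).
Proof.
apply: (P1_value_local (c := D`_(size D) / ('X^(size D))`_(size D))).
exists (size D), D, 'X^(size D); rewrite size_polyXn coefXn eqxx oner_neq0.
by rewrite rmorphXn.
Qed.

Variables (n : nat) (L : pt (P1 k) -> 'cV[K]_n -> Prop).
Hypothesis Lfree : locally_free L.

(** The global sections of [L(d)], the poles at infinity being allowed up to
    order [d]. *)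
Definition twisted_section (d : int) (v : 'cV[K]_n) : Prop :=
  (forall a, L (Some a) v) /\ L None (t ^ (- d) *: v).
Local Notation S := twisted_section.

(** The frame [B] at infinity is a frame outside a finite set, and at each of the
    remaining points it differs from a frame by a rational matrix, whose
    denominators are collected in [D]. *)
Lemma bounded_denominators : exists B (D : {poly k}), [/\ frame_at L None B, D != 0,
  forall a v, L (Some a) v -> fracp D *: (invmx B *m v) \is a mxOver (O (Some a)) &
  forall a v, invmx B *m v \is a mxOver (O (Some a)) -> L (Some a) (fracp D *: v)].
Proof.
have [U [Uoo [B hB]]] := Lfree None; have uB := frame_unit (hB _ Uoo).
have /finite_seqP[s es] := open_cofinite U.
suff [D nD [h1 h2]] : exists2 D : {poly k}, D != 0 & 
  (forall a v, Some a \in s -> L (Some a) v ->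
     fracp D *: (invmx B *m v) \is a mxOver (O (Some a))) /\
  (forall a v, Some a \in s -> invmx B *m v \is a mxOver (O (Some a)) ->
     L (Some a) (fracp D *: v)).
  exists B, D; split=> // [|a v hv|a v hv]; first exact: hB.
  - have [/h1|/negP nas] := boolP (Some a \in s); first exact.
    have aU : U (Some a).
      by apply: contrapT => nU; apply: nas; have : (~` U) (Some a) by []; rewrite es.
    by apply: mxOverZ; [exact: poly_local|exact/(frameP (hB _ aU))].
  - have [/h2|/negP nas] := boolP (Some a \in s); first exact.
    have aU : U (Some a).
      by apply: contrapT => nU; apply: nas; have : (~` U) (Some a) by []; rewrite es.
    by apply: (latticeZ (hB _ aU)); [exact: poly_local|exact/(frameP (hB _ aU))].
elim: s {es} => [|x s [D nD [h1 h2]]]; first by exists 1; rewrite ?oner_neq0.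
have [Bx hx] := locally_free_frame Lfree x; have uBx := frame_unit hx.
have [D1 nD1 hD1] := common_denominator (invmx B *m Bx).
have [D2 nD2 hD2] := common_denominator (invmx Bx *m B).
exists (D * (D1 * D2)); rewrite ?mulf_neq0 //; split=> a v.
- rewrite inE => /predU1P[ax|/h1 h] hv; last first.
    by rewrite rmorphM mulrC -scalerA mxOverZ ?poly_local ?h.
  rewrite -ax in hx; rewrite mulrA mulrAC rmorphM -scalerA mxOverZ ?poly_local //.
  by rewrite (change_frame _ _ _ uBx) mxOverM ?hD1 //; exact/(frameP hx).
- have [Ba ha] := locally_free_frame Lfree (Some a).
  rewrite inE => /predU1P[ax|/h2 h] hv; last first.
    rewrite mulrC rmorphM -scalerA; apply: (latticeZ ha) (poly_local _ _) _.
    exact: h.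
  rewrite -ax in hx; rewrite mulrA rmorphM -scalerA.
  apply: (latticeZ hx) (poly_local _ _) _; apply/(frameP hx); rewrite -scalemxAr.
  by rewrite (change_frame _ _ _ uB) mxOverM ?hD2.
Qed.

(** In the frame [B] and up to the denominator [D], a section has polynomial
    coordinates, which vanish as soon as they have a zero at infinity. *)
Lemma twisted_section_bounded :
  exists d0 : int, forall d v, S d v -> v != 0 -> d0 <= d.
Proof.
have [B [D [hB nD h1 _]]] := bounded_denominators; have uB := frame_unit hB.
exists (- (size D)%:Z) => d v [hv hvoo]; rewrite leNgt; apply: contraNN => ltd.
suff w0 : invmx B *m v = 0 by rewrite -(mulKVmx uB v) w0 mulmx0.
apply/matrixP => i j; rewrite [RHS]mxE ord1.
set f := (invmx B *m v) i 0.
have fD a : fracp D * f \in O (Some a : pt (P1 k)).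
  by have /mxOverP/(_ i 0) := h1 a v (hv a); rewrite mxE.
have foo : t ^ (- d) * f \in O (None : pt (P1 k)).
  by have /frameP := hvoo; move=> /(_ _ hB) /mxOverP /(_ i 0); rewrite -scalemxAr mxE.
have [p ep] := local_finite_poly fD.
pose e := `|- d - (size D)%:Z|%N.
have eE : - d - (size D)%:Z = e by rewrite /e; lia.
have egt0 : (0 < e)%N by rewrite /e; lia.
have [c ec] : exists c, fracp ('X^e * p) = fracp c%:P :> K.
  apply: local_everywhere_cst => -[a|]; first exact: poly_local.
  rewrite rmorphM rmorphXn /= -ep [t ^+ e]exprnP -eE expfzDr ?t_neq0 //.
  have shuffle (F : comNzRingType) (x y z w : F) : x * y * (z * w) = z * y * (x * w).
    by ring.
  by rewrite shuffle rpredM // -exprnN fracp_local_oo.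
have pc : 'X^e * p = c%:P by apply/eqP; rewrite -tofrac_eq ec.
have c0 : c = 0.
  have := congr1 (fun q : {poly k} => q.[0]) pc.
  by rewrite hornerM hornerXn expr0n -leqn0 leqNgt egt0 mul0r hornerC.
have /eqP : fracp ('X^e * p) = 0 :> K by rewrite pc c0 rmorph0.
rewrite rmorphM rmorphXn /= mulf_eq0 expf_eq0 (negPf (t_neq0 k)) andbF /= -ep.
by rewrite mulf_eq0 tofrac_eq0 (negPf nD) => /eqP.
Qed.

Lemma twisted_section_generic v : exists (f : K) d, f != 0 /\ S d (f *: v).
Proof.
have [B [D [hB nD _ h2]]] := bounded_denominators; have uB := frame_unit hB.
have [D2 nD2 hD2] := common_denominator (invmx B *m v).
set f := fracp (D * D2); have nf : f != 0 by rewrite fracp_neq0 ?mulf_neq0.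
have /choice[N hN] (i : 'I_n) : exists N, forall e, (N <= e)%N ->
    P1_value None ((f *: (invmx B *m v)) i 0 / t ^+ (0 + e)) 0.
  exact: tpow_value_oo.
exists f, (\max_i N i)%N%:Z; split=> //; split=> [a|].
  by rewrite /f rmorphM -scalerA; apply: h2; rewrite -scalemxAr.
apply/(frameP hB); rewrite -!scalemxAr; apply/mxOverP => i j; rewrite ord1.
rewrite mxE -exprnN mulrC; apply: (P1_value_local (c := 0)).
by apply: hN; exact: leq_bigmax.
Qed.

Lemma twisted_section_minimum (X : {vspace 'cV[K]_n}) : X != fullv ->
  exists d v, [/\ S d v, v \notin X & forall e w, S e w -> w \notin X -> d <= e].
Proof.
move=> nX; have [d0 hd0] := twisted_section_bounded.
have [v vX] : exists v, v \notin X.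
  apply/not_existsP => h; move/negP: nX; apply; rewrite eqEsubv subvf.
  by apply/subvP => v _; apply/negPn/negP/h.
have [f [d [nf Sd]]] := twisted_section_generic v.
have fvX : f *: v \notin X by rewrite rpredZeq negb_or nf.
have ne0 w : w \notin X -> w != 0 by apply: contraNneq => ->; rewrite mem0v.
pose P m := `[< exists2 w, S (d0 + m%:Z) w & w \notin X >].
have exP : exists m, P m.
  exists `|d - d0|%N; apply/asboolP; exists (f *: v) => //.
  by have := hd0 _ _ Sd (ne0 _ fvX); move=> ?; rewrite [_ + _](_ : _ = d) //; lia.
case: (ex_minnP exP) => m /asboolP[w Sw wX] min.
exists (d0 + m%:Z), w; split=> // e u Se uX.
have := hd0 _ _ Se (ne0 _ uX) => le_e.
have := min `|e - d0|%N; have eE : d0 + `|e - d0|%N%:Z = e by lia.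
move=> /(_ _); have Pe : P `|e - d0|%N by apply/asboolP; exists u; rewrite ?eE.
by move=> /(_ Pe); lia.
Qed.

(** Successive minima: each vector is, among the sections independent of the
    previous ones, one with the mildest pole at infinity.  They are numbered
    backwards, [X i] being spanned by the vectors of index larger than [i]; the
    degrees of the summands, opposite to the [d i], are then nondecreasing. *)
Lemma successive_minima : exists (b : 'I_n -> 'cV[K]_n) (d : 'I_n -> int)
    (X : 'I_n -> {vspace 'cV[K]_n}),
  [/\ forall i, S (d i) (b i), forall i j : 'I_n, (i < j)%N -> b j \in X i,
      forall i j : 'I_n, (i <= j)%N -> (X j <= X i)%VS, forall i, b i \notin X i &
      forall i e w, S e w -> w \notin X i -> d i <= e].
Proof.
suff [s [ss hs]] : exists s : seq (int * 'cV[K]_n), size s = n /\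
    forall j, (j < n)%N -> let X := <<take j (unzip2 s)>>%VS in
    [/\ S (nth (0, 0) s j).1 (nth (0, 0) s j).2, (nth (0, 0) s j).2 \notin X &
        forall e w, S e w -> w \notin X -> (nth (0, 0) s j).1 <= e].
  pose r (i : 'I_n) := rev_ord i.
  exists (fun i => (nth (0, 0) s (r i)).2), (fun i => (nth (0, 0) s (r i)).1),
    (fun i => <<take (r i) (unzip2 s)>>%VS).
  split=> [i|i j ltij|i j leij|i|i]; try by have [] := hs (r i) (ltn_ord _).
  - have ltr : (r j < r i)%N by rewrite /r /=; have := ltn_ord j; lia.
    apply: memv_span.
    rewrite -(nth_map _ (0 : 'cV[K]_n) snd) ?ss // -(nth_take _ ltr) mem_nth //.
    by rewrite size_take size_map ss ltn_ord.
  - have ler : (r j <= r i)%N by rewrite /r /=; have := ltn_ord j; lia.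
    by apply: sub_span => v; rewrite -(take_takel (unzip2 s) ler); exact: mem_take.
suff H m : (m <= n)%N -> exists s : seq (int * 'cV[K]_n), size s = m /\
    forall j, (j < m)%N -> let X := <<take j (unzip2 s)>>%VS in
    [/\ S (nth (0, 0) s j).1 (nth (0, 0) s j).2, (nth (0, 0) s j).2 \notin X &
        forall e w, S e w -> w \notin X -> (nth (0, 0) s j).1 <= e].
  exact: H.
elim: m => [|m IH] lemn; first by exists [::].
have [s [ss hs]] := IH (ltnW lemn).
have nX : <<unzip2 s>>%VS != fullv.
  apply: contraTneq lemn => e; rewrite -leqNgt.
  have := dim_span (unzip2 s); rewrite e dimvf /dim /= muln1 size_map ss.
  by [].
have [d [v [Sd vX min]]] := twisted_section_minimum nX.
have eX j : (j <= m)%N -> take j (unzip2 (rcons s (d, v))) = take j (unzip2 s).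
  by move=> lejm; rewrite /unzip2 map_rcons -cats1 takel_cat // size_map ss.
exists (rcons s (d, v)); rewrite size_rcons ss; split=> // j.
rewrite ltnS => lejm; rewrite eX //.
move: lejm; rewrite leq_eqVlt => /predU1P[->|ltjm].
  by rewrite take_oversize ?size_map ?ss // nth_rcons ss ltnn eqxx.
by rewrite nth_rcons ss ltjm; exact: hs.
Qed.

(** The vectors of successive minima are a frame at every point: otherwise a
    combination of them with constant coefficients could be divided by a local
    parameter, and the quotient would have a milder pole at infinity than its
    leading term, against the minimality of the latter. *)
Lemma birkhoff_grothendieck : exists B (d : 'I_n -> int),
  [/\ forall i j : 'I_n, (i <= j)%N -> d i <= d j, forall a, frame_at L (Some a) B &
      frame_at L None (B *m diag_mx (\row_i t ^ d i))].
Proof.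
have [b [d [X [Sd bX subX nX min]]]] := successive_minima.
pose B : 'M[K]_n := \matrix_(i, j) b j i 0.
have colB j : col j B = b j by apply/matrixP => i l; rewrite !mxE ord1.
have mulB w : B *m w = \sum_j w j 0 *: b j.
  apply/matrixP => i l; rewrite mxE summxE; apply: eq_bigr => j _.
  by rewrite !mxE ord1 mulrC.
have d_anti (i j : 'I_n) : (i <= j)%N -> d j <= d i.
  move=> leij; apply: min (Sd i) _; apply: contraNN (nX i).
  exact: (subvP (subX i j leij)).
have lead (f : 'I_n -> K) i e : f i != 0 -> (forall j : 'I_n, (j < i)%N -> f j = 0) ->
    S e (\sum_j f j *: b j) -> d i <= e.
  move=> nfi fj Se; apply: min Se _.
  rewrite (bigD1 i) //= rpredDr; first by rewrite rpredZeq negb_or nfi nX.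
  apply: rpred_sum => j nji; have [ltji|ltij|eij] := ltngtP j i.
  - by rewrite fj // scale0r rpred0.
  - by rewrite memvZ ?bX.
  - by move: nji; rewrite -val_eqE /= eij eqxx.
have leading (c : 'cV[k]_n) : c != 0 ->
    exists2 i, c i 0 != 0 & forall j : 'I_n, (j < i)%N -> c j 0 = 0.
  move=> nc; have [i0 ni0] : exists i, c i 0 != 0.
    by apply/existsP; apply: contraNT nc => /existsPn h; apply/eqP/matrixP => i j;
      rewrite ord1 mxE; apply/eqP/negPn/h.
  case: (arg_minnP (P := [pred i | c i 0 != 0]) (fun i : 'I_n => i : nat) ni0).
  move=> i ni mini; exists i => // j ltji.
  by apply: contraTeq ltji => nj; rewrite -leqNgt mini.
have tle (i j : 'I_n) : (i <= j)%N -> L None (t ^ (- d i) *: b j).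
  move=> leij; have [M hM] := locally_free_frame Lfree None.
  have -> : t ^ (- d i) = t ^- `|d i - d j| * t ^ (- d j).
    have := d_anti _ _ leij => le_d.
    by rewrite exprnN -expfzDr ?t_neq0 //; congr (t ^ _); lia.
  by rewrite -scalerA; apply: (latticeZ hM); [exact: tpow_local_oo|case: (Sd j)].
exists B, (fun i => - d i); split=> [i j leij|a|]; first by rewrite lerN2 d_anti.
- have [M hM] := locally_free_frame Lfree (Some a).
  apply: (frame_of_independent hM) => [j|c nc Lc]; first by rewrite colB; case: (Sd j).
  have [i nci cj] := leading c nc.
  pose f j := (uniformizer (Some a))^-1 * fracp (c j 0)%:P : K.
  have Ec : (uniformizer (Some a))^-1 *: (B *m cst_mx c) = \sum_j f j *: b j.
    by rewrite mulB scaler_sumr; apply: eq_bigr => j _; rewrite mxE scalerA.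
  rewrite Ec in Lc; suff : d i <= d i - 1 by lia.
  apply: (lead f) => [|j ltji|].
  + by rewrite mulf_neq0 ?invr_eq0 ?uniformizer_neq0 // fracp_neq0 // polyC_eq0.
  + by rewrite /f cj // rmorph0 mulr0.
  split=> [a'|].
  + have [->//|naa'] := eqVneq a' a.
    have [M' hM'] := locally_free_frame Lfree (Some a').
    apply: (lattice_sum hM') => j; apply: (latticeZ hM'); last by case: (Sd j).
    rewrite rpredM ?cst_local // uniformizerV_local //.
    by apply: contra_neq naa' => -[].
  + have [M' hM'] := locally_free_frame Lfree None.
    rewrite scaler_sumr; apply: (lattice_sum hM') => j.
    have [/cj cj0|leij] := ltnP j i.
      by rewrite /f cj0 rmorph0 mulr0 scale0r scaler0; exact: lattice0 hM'.
    have -> : t ^ (- (d i - 1)) *: (f j *: b j) =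
        (t / uniformizer (Some a) * fracp (c j 0)%:P) *: (t ^ (- d i) *: b j).
      rewrite !scalerA; congr (_ *: _); rewrite opprB addrC expfzDr ?t_neq0 // expr1z.
      have shuffle (F : comNzRingType) (x y z w : F) : x * y * (z * w) = y * z * w * x.
        by ring.
      exact: shuffle.
    apply: (latticeZ hM'); last exact: tle.
    by rewrite rpredM ?cst_local // uniformizerV_oo.
- have [M hM] := locally_free_frame Lfree None.
  have colU j : col j (B *m diag_mx (\row_i t ^ (- d i))) = t ^ (- d j) *: b j.
    by rewrite mul_mx_diag -colB; apply/matrixP => i l; rewrite !mxE mulrC.
  apply: (frame_of_independent hM) => [j|c nc Lc]; first by rewrite colU; exact: tle.
  have [i nci cj] := leading c nc.
  pose f j := t ^ (d i) * (t ^ (- d j) * fracp (c j 0)%:P) : K.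
  have Ec : (uniformizer None)^-1 *: (B *m diag_mx (\row_i t ^ (- d i)) *m cst_mx c) =
      t ^ (- (d i - 1)) *: \sum_j f j *: b j.
    rewrite -mulmxA mulB !scaler_sumr; apply: eq_bigr => j _.
    rewrite /= invrK !scalerA mul_diag_mx !mxE /f; congr (_ *: _).
    rewrite [RHS]mulrA -expfzDr ?t_neq0 // (_ : - (d i - 1) + d i = 1) ?expr1z //.
    by lia.
  rewrite Ec in Lc; suff : d i <= d i - 1 by lia.
  apply: (lead f) => [|j ltji|].
  + by rewrite !mulf_neq0 ?texp_neq0 // fracp_neq0 // polyC_eq0.
  + by rewrite /f cj // rmorph0 !mulr0.
  split=> // a; have [M' hM'] := locally_free_frame Lfree (Some a).
  apply: (lattice_sum hM') => j.
  have [/cj cj0|leij] := ltnP j i.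
    by rewrite /f cj0 rmorph0 !mulr0 scale0r; exact: lattice0 hM'.
  apply: (latticeZ hM'); last by case: (Sd j).
  rewrite /f mulrA -expfzDr ?t_neq0 // rpredM ?cst_local //.
  have -> : d i - d j = `|d i - d j|%N by have := d_anti _ _ leij; lia.
  by rewrite -exprnP -rmorphXn poly_local.
Qed.

End Birkhoff.

(** * Vector bundles as families of lattices *)

Section Bundles.
Variable k : closedFieldType.
Local Notation K := (ratfun k).
Local Notation t := (tvar k).
Local Notation O x := (@local_ring k (P1 k) x).

Lemma regular_generic (f : K) : exists W : open (P1 k), f \in regular_on W.
Proof.
exists (regular_locus (f%:M : 'M_1)); apply/regular_onP => p /regular_locusP/mxOverP/(_ 0 0).
by rewrite mxE.
Qed.

Implicit Types U W : open (P1 k).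

Section BundleGerms.
Variables (n : nat) (V : sheaf (P1 k)).

Definition basis_on (U : open (P1 k)) (e : 'I_n -> V U) : Prop :=
  forall (W : open (P1 k)) (h : W `<=` U) (s : V W),
  exists! c : 'rV['O W]_n, s = \sum_i c 0 i *: res V h (e i).

Definition coords (W : open (P1 k)) (c : 'rV['O W]_n) : 'cV[K]_n := \col_i rat_of (c 0 i).

Lemma coords_inj W : injective (@coords W).
Proof.
move=> c c' /matrixP e; apply/rowP => i; apply: val_inj.
by have := e i 0; rewrite !mxE.
Qed.

Lemma coords_local W (c : 'rV['O W]_n) x : W x -> coords c \is a mxOver (O x).
Proof. by move=> xW; apply/mxOverP => i j; rewrite mxE; exact: rat_of_local. Qed.

Lemma coordsP (W : open (P1 k)) (v : 'cV[K]_n) : (forall x, W x -> v \is a mxOver (O x)) ->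
  exists c : 'rV['O W]_n, coords c = v.
Proof.
move=> hv; have reg i : v i 0 \in regular_on W.
  by apply/regular_onP => x /hv /mxOverP.
exists (\row_i Regular (reg i)); apply/matrixP => i j.
by rewrite ord1 !mxE.
Qed.

Lemma res_lincomb (U W : open (P1 k)) (h : W `<=` U) (c : 'rV['O U]_n) (s : 'I_n -> V U) :
  res V h (\sum_i c 0 i *: s i) = \sum_i (map_mx (fun_res h) c) 0 i *: res V h (s i).
Proof.
rewrite sheaf_res_sum; apply: eq_bigr => i _.
by rewrite (resZ (sheafP V)) mxE.
Qed.

Lemma coords_res (U W : open (P1 k)) (h : W `<=` U) (c : 'rV['O U]_n) :
  coords (map_mx (fun_res h) c) = coords c.
Proof. by apply/matrixP => i j; rewrite !mxE. Qed.

Lemma basis_coords U (e : 'I_n -> V U) : basis_on e ->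
  forall W (h : W `<=` U) (c c' : 'rV['O W]_n),
  \sum_i c 0 i *: res V h (e i) = \sum_i c' 0 i *: res V h (e i) -> c = c'.
Proof.
move=> he W h c c' ecc'.
have [d [_ hd]] := he W h (\sum_i c 0 i *: res V h (e i)).
by rewrite -(hd c erefl) -(hd c' ecc').
Qed.

(** In a local basis the coordinates of a section are rational functions, which
    are determined on any smaller open set. *)
Lemma bundle_res_inj (U W : open (P1 k)) (h : W `<=` U) :
  vector_bundle n V -> injective (res V h).
Proof.
move=> hV s s' ess'; pose J := {p | U p}.
have loc (j : J) : {Up : open (P1 k) | Up (sval j) /\ exists e : 'I_n -> V Up, basis_on e}.
  by apply: cid; have [Up [? [e he]]] := hV (sval j); exists Up; split=> //; exists e.
apply: (res_sep (sheafP V) (V := fun j => openI U (sval (loc j)))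
         (h := fun j => @openIl _ _ U (sval (loc j)))).
  move=> p pU; exists (exist _ p pU) => //; split=> //.
  by case: (svalP (loc (exist _ p pU))).
move=> j; have [_ [e he]] := svalP (loc j); set Up := sval _ in e he *.
have [c [ec _]] := he (openI U Up) (@openIr _ _ _ _) (res V (@openIl _ _ _ _) s).
have [c' [ec' _]] := he (openI U Up) (@openIr _ _ _ _) (res V (@openIl _ _ _ _) s').
suff ecc : c = c' by rewrite ec ec' ecc.
have hW : openI W Up `<=` openI U Up by move=> x [/h].
have hWU := @openIr _ _ W Up.
suff : map_mx (fun_res hW) c = map_mx (fun_res hW) c'.
  by move=> /(congr1 (@coords _)); rewrite !coords_res => /coords_inj.
have resE (d : 'rV_n) s0 :
    res V (@openIl _ _ U Up) s0 = \sum_i d 0 i *: res V (@openIr _ _ U Up) (e i) ->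
    res V (@openIl _ _ W Up) (res V h s0) = \sum_i (map_mx (fun_res hW) d) 0 i *: res V hWU (e i).
  move=> /(congr1 (res V hW)); rewrite res_lincomb.
  have hWs : openI W Up `<=` U by move=> x [/h].
  rewrite (res_comp (sheafP V) _ _ hWs) (res_comp (sheafP V) _ _ hWs) => ->.
  by apply: eq_bigr => i _; rewrite (res_comp (sheafP V) _ _ hWU).
by apply: (basis_coords he (h := hWU)); rewrite -(resE _ _ ec) -(resE _ _ ec') ess'.
Qed.

(** The germ of a section is given by its coordinates in a fixed local basis; in
    another local basis the coordinates change by an invertible matrix [B] over
    [K]. *)
Lemma bundle_germ : vector_bundle n V ->
  exists g : forall U, V U -> 'cV[K]_n, germ_map g /\ locally_free (germ_stalk g).
Proof.
move=> hV; have [U0 [_ [e0 he0]]] := hV None.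
have [cf cfP] : exists cf : forall U, V U -> 'rV['O (openI U U0)]_n,
    forall U (s : V U), res V (@openIl _ _ U U0) s =
    \sum_i cf U s 0 i *: res V (@openIr _ _ U U0) (e0 i).
  pose ex U (s : V U) := cid (he0 (openI U U0) (@openIr _ _ _ _) (res V (@openIl _ _ _ _) s)).
  by exists (fun U s => sval (ex U s)) => U s; case: (svalP (ex U s)).
pose g U (s : V U) : 'cV[K]_n := coords (cf U s).
have gE U W (s : V U) (h : W `<=` U) (h0 : W `<=` U0) (c : 'rV['O W]_n) :
    res V h s = \sum_i c 0 i *: res V h0 (e0 i) -> g U s = coords c.
  move=> es; have hW : W `<=` openI U U0 by move=> x xW; split; [apply: (h x)|apply: (h0 x)].
  rewrite /g -(coords_res hW); congr coords; apply: (basis_coords he0 (h := h0)).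
  rewrite -es -(res_comp (sheafP V) (@openIl _ _ U U0) hW) cfP res_lincomb.
  by apply: eq_bigr => i _; rewrite (res_comp (sheafP V) _ _ h0).
have gD U : {morph g U : s s' / s + s'}.
  move=> s s'; rewrite (gE _ _ _ (@openIl _ _ U U0) (@openIr _ _ U U0) (cf U s + cf U s')).
    by apply/matrixP => i j; rewrite !mxE.
  rewrite (resD (sheafP V)) !cfP -big_split; apply: eq_bigr => i _ /=.
  by rewrite mxE scalerDl.
have gZ U (f : 'O U) s : g U (f *: s) = rat_of f *: g U s.
  rewrite (gE _ _ _ (@openIl _ _ U U0) (@openIr _ _ U U0) (fun_res (@openIl _ _ U U0) f *: cf U s)).
    by apply/matrixP => i j; rewrite !mxE.
  rewrite (resZ (sheafP V)) cfP scaler_sumr; apply: eq_bigr => i _.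
  by rewrite mxE scalerA.
have gres U W (h : W `<=` U) s : g W (res V h s) = g U s.
  apply/esym; have hW : openI W U0 `<=` U by move=> x [/h].
  apply: (gE _ _ _ hW (@openIr _ _ W U0)).
  by rewrite -cfP (res_comp (sheafP V) _ _ hW).
have ginj U : injective (g U).
  move=> s s' /coords_inj e.
  by apply: (bundle_res_inj (h := @openIl _ _ U U0) hV); rewrite !cfP e.
have glin U (m : 'rV['O U]_n) (s : 'I_n -> V U) :
    g U (\sum_i m 0 i *: s i) = (\matrix_(a, i) g U (s i) a 0) *m coords m.
  have g0 : g U 0 = 0 by apply: (addrI (g U 0)); rewrite -gD !addr0.
  rewrite (big_morph (g U) (gD U) g0); apply/matrixP => a b; rewrite ord1 summxE mxE.
  by apply: eq_bigr => i _; rewrite gZ !mxE mulrC.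
have ge0 W (h : W `<=` U0) (c : 'rV['O W]_n) : g W (\sum_i c 0 i *: res V h (e0 i)) = coords c.
  by apply: (gE _ _ _ (@subset_refl _ W) h); rewrite (res_id (sheafP V)).
clearbody g; have gm : germ_map g.
  split=> // v.
  have [x|c ec] := @coordsP (openI U0 (regular_locus v)) v; first by case.
  by exists (openI U0 (regular_locus v)),
    (\sum_i c 0 i *: res V (@openIl _ _ _ _) (e0 i)); rewrite ge0.
exists g; split=> // p; have [U [pU [e he]]] := hV p; exists U; split=> //.
pose B : 'M[K]_n := \matrix_(a, i) g U (e i) a 0; exists B.
have gB W (h : W `<=` U) (c : 'rV['O W]_n) : g W (\sum_i c 0 i *: res V h (e i)) = B *m coords c.
  by rewrite glin; congr (_ *m _); apply/matrixP => a i; rewrite !mxE gres.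
have uB : B \in unitmx.
  have /choice[w hw] (i : 'I_n) : exists w : 'cV[K]_n, B *m w = delta_mx i 0.
    have [W [h [s <-]]] := germ_surj_in gm U (delta_mx i 0).
    by have [c [-> _]] := he W h s; exists (coords c); rewrite gB.
  pose A : 'M[K]_n := \matrix_(j, i) w i j 0.
  suff BA : B *m A = 1%:M by exact: (proj1 (mulmx1_unit BA)).
  apply/matrixP => a i; have /matrixP/(_ a 0) := hw i.
  rewrite [X in X = _]mxE [in X in _ = X -> _]mxE andbT => ewi.
  rewrite mxE [RHS]mxE -ewi; apply: eq_bigr => j _.
  by rewrite [A j i]mxE.
move=> x xU; split=> // v; split.
- move=> [W [xW [s <-]]].
  have [c [ec _]] := he (openI W U) (@openIr _ _ _ _) (res V (@openIl _ _ _ _) s).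
  by rewrite -(gres _ _ (@openIl _ _ W U)) ec gB mulKmx // coords_local.
- move=> hv; have [y|c ec] := @coordsP (openI U (regular_locus (invmx B *m v))) (invmx B *m v).
    by case.
  have xW : openI U (regular_locus (invmx B *m v)) x by [].
  exists (openI U (regular_locus (invmx B *m v))), xW,
    (\sum_i c 0 i *: res V (@openIl _ _ _ _) (e i)).
  by rewrite gB ec mulKVmx.
Qed.
End BundleGerms.

Section SubconstBundle.
Variables (n : nat) (L : stalks (P1 k) 'cV[K]_n).
Hypothesis Lfree : locally_free L.
Local Notation V := (subconst_sheaf L).

Lemma subconst_bundle : vector_bundle n V.
Proof.
move=> p; have [U [pU [B hB]]] := Lfree p; exists U; split=> //.
have uB := frame_unit (hB _ pU).
have colB i : col i B \in subconst L U.
  apply/subconstP => x xU; rewrite colE; apply/(lattice_frame (hB x xU))/mxOverP => a b.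
  by rewrite mxE; case: (_ && _); rewrite ?rpred0 ?rpred1.
exists (fun i => SubconstSec (colB i)) => W h s.
have eltE (c : 'rV['O W]_n) :
    elt_of (\sum_i c 0 i *: res V h (SubconstSec (colB i))) = B *m coords c.
  rewrite (big_morph (fun s : V W => elt_of s) (id1 := 0) (op1 := +%R)) //=.
  apply/matrixP => a b; rewrite ord1 summxE mxE; apply: eq_bigr => i _.
  by rewrite !mxE mulrC.
have [x xW|c ec] := @coordsP n W (invmx B *m elt_of s).
  apply/(frameP (hB x (h x xW))); have /subconstP := elt_ofP s; exact.
exists c; split=> [|c' ec'].
  by apply: val_inj; rewrite /= eltE ec mulKVmx.
by apply: coords_inj; rewrite ec ec' eltE mulKmx.
Qed.

Lemma subconst_bundle_germ : germ_map (F := V) (fun U s => elt_of s).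
Proof. by apply: subconst_germ_map; exact: locally_free_generic. Qed.

Lemma subconst_bundle_stalk x v :
  germ_stalk (F := V) (fun U s => elt_of s) x v <-> L x v.
Proof.
split=> [[U [xU [s <-]]]|hv]; first by have /subconstP := elt_ofP s; apply.
have [U [xU [B hB]]] := Lfree x.
pose W := openI U (regular_locus (invmx B *m v)).
have vW : v \in subconst L W.
  by apply/subconstP => y [yU yv]; apply/(frameP (hB y yU)).
have xW : W x by split=> //; apply/(frameP (hB x xU)).
by exists W, xW, (SubconstSec vW).
Qed.

Section SubconstFibre.
Variables (p : pt (P1 k)) (B : 'M[K]_n).
Hypothesis hB : exists U : open (P1 k), U p /\ forall x, U x -> frame_at L x B.

Let frB : frame_at L p B. Proof. by have [U [pU]] := hB; apply. Qed.

Definition subconst_ev (U : open (P1 k)) (pU : U p) (s : V U) : 'cV[k]_n :=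
  residue_mx p (invmx B *m elt_of s).

Let coord_local (U : open (P1 k)) (pU : U p) (s : V U) :
  invmx B *m elt_of s \is a mxOver (O p).
Proof. by apply/(frameP frB); have /subconstP := elt_ofP s; apply. Qed.

Lemma subconst_evD U (pU : U p) : {morph subconst_ev pU : s s' / s + s'}.
Proof. by move=> s s'; rewrite /subconst_ev /= mulmxDr residue_mxD ?coord_local. Qed.

Lemma subconst_evZ (U : open (P1 k)) (pU : U p) (f : 'O U) c s :
  value p f c -> subconst_ev pU (f *: s) = c *: subconst_ev pU s.
Proof.
move=> hf; rewrite /subconst_ev /= -scalemxAr residue_mxZ ?coord_local ?rat_of_local //.
by rewrite (residueE hf).
Qed.

Lemma subconst_ev_res (U W : open (P1 k)) (pU : U p) (pW : W p) (h : W `<=` U) s :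
  subconst_ev pW (res V h s) = subconst_ev pU s.
Proof. by []. Qed.

Lemma subconst_ev_surj v : exists (U : open (P1 k)) (pU : U p) s, subconst_ev pU s = v.
Proof.
have [U [pU fr]] := hB.
have vU : B *m cst_mx v \in subconst L U.
  by apply/subconstP => x xU; apply/(lattice_frame (fr x xU)); exact: cst_mx_local.
exists U, pU, (SubconstSec vU).
by rewrite /subconst_ev /= mulKmx ?(frame_unit frB) // residue_cst_mx.
Qed.

Lemma subconst_ev_ker (U : open (P1 k)) (pU : U p) s : subconst_ev pU s = 0 ->
  exists (W : open (P1 k)) (h : W `<=` U), W p /\
  exists m (f : 'I_m -> 'O W) (u : 'I_m -> V W),
  (forall j, value p (f j) 0) /\ res V h s = \sum_j f j *: u j.
Proof.
move=> s0; have [U1 [pU1 fr]] := hB.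
set w := invmx B *m elt_of s.
pose W := openI (openI U U1) (regular_locus w).
have wW x : W x -> w \is a mxOver (O x) by case.
have [c ec] := @coordsP n W w wW.
have colB j : col j B \in subconst L W.
  apply/subconstP => x [[_ xU1] _]; rewrite colE.
  apply/(lattice_frame (fr x xU1))/mxOverP => a b.
  by rewrite mxE; case: (_ && _); rewrite ?rpred0 ?rpred1.
have hW : W `<=` U by move=> x [[]].
exists W, hW; split; first by split=> //; exact: coord_local.
exists n, (fun j => c 0 j), (fun j => SubconstSec (colB j)); split=> [j|].
  have -> : rat_of (c 0 j) = w j 0 by rewrite -ec mxE.
  have -> : 0 = residue p (w j 0) by have /matrixP/(_ j 0) := s0; rewrite !mxE.
  by apply: residueP; have /mxOverP := coord_local pU s; apply.
apply: val_inj; rewrite /= (big_morph (fun s : V W => elt_of s) (id1 := 0) (op1 := +%R)) //=.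
rewrite -(mulKVmx (frame_unit frB) (elt_of s)) -/w -ec.
apply/matrixP => a b; rewrite ord1 summxE mxE; apply: eq_bigr => i _.
by rewrite !mxE mulrC.
Qed.

Definition subconst_frame : fibre_frame V p n :=
  FibreFrame subconst_evD subconst_evZ subconst_ev_res subconst_ev_surj subconst_ev_ker.
End SubconstFibre.
End SubconstBundle.
End Bundles.

(** * Twists *)

Section Twisting.
Variable k : closedFieldType.
Local Notation K := (ratfun k).
Local Notation t := (tvar k).
Local Notation O x := (@local_ring k (P1 k) x).
Implicit Types U W : open (P1 k).

Lemma bijective_of_inj_surj (T T' : Type) (f : T -> T') :
  injective f -> (forall y, exists x, f x = y) -> bijective f.
Proof.
move=> injf surjf; have [h hK] := boolp.choice surjf.
by exists h => [x|//]; apply: injf; rewrite hK.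
Qed.

Lemma linear_subconst_iso (F : sheaf (P1 k)) (E E' : lmodType K)
    (g : forall U, F U -> E) (L : stalks (P1 k) E') (f : E -> E') :
  germ_map g -> linear f -> bijective f ->
  (forall p v, germ_stalk g p v <-> L p (f v)) -> sheaf_iso F (subconst_sheaf L).
Proof.
move=> gm lf [f' fK f'K] stalkE.
have secE W (s : F W) : f (g W s) \in subconst L W.
  by apply/subconstP => p pW; apply/stalkE; exact: germ_stalk_sec.
have lin W (h : W `<=` openT (P1 k)) :
    linear (fun s : F W => SubconstSec (secE W s) : subconst_sheaf L W).
  by move=> c s s'; apply: val_inj; rewrite /= (germD gm) (germZ gm) lf.
have comm U W (hU : U `<=` openT _) (hW : W `<=` openT _) (h : W `<=` U) (s : F U) :
    res (subconst_sheaf L) h (SubconstSec (secE U s) : subconst_sheaf L U) =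
    SubconstSec (secE W (res F h s)).
  by apply: val_inj; rewrite /= (germ_res gm).
exists (Defs.Hom lin comm) => W h; apply: bijective_of_inj_surj => [s s'|y] /=.
  by move=> /(congr1 val) /= /(can_inj fK) /(germ_inj gm).
have [|s es] := germ_glue gm (U := W) (v := f' (elt_of y)).
  by move=> p pW; apply/stalkE; rewrite f'K; have /subconstP := elt_ofP y; apply.
by exists s; apply: val_inj; rewrite /= es f'K.
Qed.

Section TwistGerms.
Variables (V : sheaf (P1 k)) (E : lmodType K) (g : forall U, V U -> E).
Hypothesis gm : germ_map g.
Variable i : int.

Definition twist_germ U (s : twist V i U) : E := g (twist_pair s).1.

Lemma twist_germ_oo U (s : twist V i U) : twist_germ s = t ^ i *: g (twist_pair s).2.
Proof.
have /twist_predP /(congr1 (g (U := _))) := twist_pairP s.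
by rewrite (germ_res gm) (germZ gm) (germ_res gm).
Qed.

Lemma twist_germ_map : germ_map twist_germ.
Proof.
split.
- by move=> U s s'; exact: (germD gm).
- by move=> U f s; exact: (germZ gm).
- by move=> U W h s; exact: (germ_res gm).
- move=> U s s' e; have e1 : (twist_pair s).1 = (twist_pair s').1 by exact: (germ_inj gm) e.
  have e2 : (twist_pair s).2 = (twist_pair s').2.
    apply: (germ_inj gm); move: e; rewrite !twist_germ_oo => /(congr1 (GRing.scale (t ^ (- i)))).
    by rewrite !scalerA -expfzDr ?t_neq0 // addNr expr0z !scale1r.
  by apply: val_inj; rewrite /= [twist_pair s]surjective_pairing e1 e2 -surjective_pairing.
- move=> v; have [U [s <-]] := germ_surj gm v.
  exists (chart0 U), (Defs.lift0 i (@openIr _ _ U (compl1 _)) (res V (@chart0_sub _ U) s)).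
  by rewrite /twist_germ /= !(germ_res gm).
Qed.

Lemma twist_stalk_finite a v :
  germ_stalk twist_germ (Some a) v <-> germ_stalk g (Some a) v.
Proof.
split=> [[U [aU [s <-]]]|[U [aU [s <-]]]].
  have aU0 : chart0 U (Some a) by [].
  by exists (chart0 U), aU0, (twist_pair s).1.
have aU0 : chart0 U (Some a) by [].
exists (chart0 U), aU0, (Defs.lift0 i (@openIr _ _ U (compl1 _)) (res V (@chart0_sub _ U) s)).
by rewrite /twist_germ /= !(germ_res gm).
Qed.

Lemma twist_stalk_oo v :
  germ_stalk twist_germ None v <-> germ_stalk g None (t ^ (- i) *: v).
Proof.
split=> [[U [ooU [s <-]]]|[U [ooU [s es]]]].
  have ooU' : chartoo U None by [].
  exists (chartoo U), ooU', (twist_pair s).2; rewrite twist_germ_oo scalerA.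
  by rewrite -expfzDr ?t_neq0 // addNr expr0z scale1r.
have ooU' : chartoo U None by [].
exists (chartoo U), ooU', (liftoo i (@openIr _ _ U (compl1 _)) (res V (@chartoo_sub _ U) s)).
rewrite twist_germ_oo /= !(germ_res gm) es scalerA -expfzDr ?t_neq0 //.
by rewrite subrr expr0z scale1r.
Qed.

Section TwistHom.
Variables (U : open (P1 k)) (a : hom_on V V U).

Lemma twist_hom_subproof W (h : W `<=` U) (s : twist V i W) :
  (a _ (subset_trans (@chart0_sub _ W) h) (twist_pair s).1,
   a _ (subset_trans (@chartoo_sub _ W) h) (twist_pair s).2) \in @twist_pred _ V i W.
Proof.
have hW : overlap W `<=` U by move=> x [[/h]].
have /twist_predP e := twist_pairP s; apply/twist_predP => /=.
rewrite (hom_res_comm a _ hW) e (hom_res_comm a _ hW).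
by rewrite (linear_funZ (hom_linear a hW)).
Qed.

Definition twist_hom_fun W (h : W `<=` U) (s : twist V i W) : twist V i W :=
  TwistSec (twist_hom_subproof h s).

Lemma twist_hom_linear W (h : W `<=` U) : linear (twist_hom_fun h).
Proof. by move=> c s s'; apply: val_inj; congr pair; exact: hom_linear. Qed.

Lemma twist_hom_res (U' W : open (P1 k)) (hU : U' `<=` U) (hW : W `<=` U) (h : W `<=` U') s :
  res (twist V i) h (twist_hom_fun hU s) = twist_hom_fun hW (res (twist V i) h s).
Proof. by apply: val_inj; congr pair; exact: hom_res_comm. Qed.

Definition twist_hom : hom_on (twist V i) (twist V i) U :=
  Defs.Hom twist_hom_linear twist_hom_res.

Variables (n : nat).

Lemma fibre_action_twist0 (e : fibre_frame V (Some 0) n) M :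
  fibre_action (twist_frame0 i e) twist_hom M <-> fibre_action e a M.
Proof.
split=> [act W h pW s|act W h pW s]; last exact: act.
have hU := subset_trans (@chart0_sub _ W) h.
have /= := act (chart0 W) hU (chart0_mem pW)
  (Defs.lift0 i (@openIr _ _ W (compl1 _)) (res V (@chart0_sub _ W) s)).
rewrite /twist_ev0 /=.
by rewrite -(hom_res_comm a hU) -(hom_res_comm a h) !(ev_res e (chart0_mem pW)) !(ev_res e pW).
Qed.

Lemma fibre_action_twistoo (e : fibre_frame V None n) M :
  fibre_action (twist_frameoo i e) twist_hom M <-> fibre_action e a M.
Proof.
split=> [act W h pW s|act W h pW s]; last exact: act.
have hU := subset_trans (@chartoo_sub _ W) h.
have /= := act (chartoo W) hU (chartoo_mem pW)
  (liftoo i (@openIr _ _ W (compl1 _)) (res V (@chartoo_sub _ W) s)).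
rewrite /twist_evoo /=.
by rewrite -(hom_res_comm a hU) -(hom_res_comm a h) !(ev_res e (chartoo_mem pW)) !(ev_res e pW).
Qed.
End TwistHom.

Lemma twist_hom_germ U (a : hom_on V V U) (f : E -> E) :
  linear f -> (forall W (h : W `<=` U) s, g (a W h s) = f (g s)) ->
  forall W (h : W `<=` U) s, twist_germ (twist_hom a W h s) = f (twist_germ s).
Proof. by move=> lf fE W h s; rewrite /twist_germ /= fE. Qed.

Lemma twist_hom_inj U : injective (@twist_hom U).
Proof.
move=> a b eab; have [f [lf fE]] := linear_of_hom gm gm (@regular_generic k) a.
have [f' [lf' fE']] := linear_of_hom gm gm (@regular_generic k) b.
have ff' v : f v = f' v.
  have [W [h [s <-]]] := germ_surj_in twist_germ_map U v.
  by rewrite -(twist_hom_germ lf fE h) -(twist_hom_germ lf' fE' h) eab.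
by apply: (germ_hom_eq gm) => W h s; rewrite fE fE' ff'.
Qed.

(** The stalks of the twist are those of the bundle, multiplied by [t ^ i] at
    infinity, so they are respected by the same linear maps. *)
Lemma twist_hom_surj U (b : hom_on (twist V i) (twist V i) U) :
  exists a : hom_on V V U, twist_hom a = b.
Proof.
have [f [lf fE]] := linear_of_hom twist_germ_map twist_germ_map (@regular_generic k) b.
have fstalk := linear_of_hom_stalk twist_germ_map fE.
have fZ := linear_funZ lf.
have [|a aE] := hom_of_linear gm gm (U := U) lf.
  move=> [c|] v pU; first by move=> /twist_stalk_finite h; apply/twist_stalk_finite/fstalk.
  have vE : v = t ^ (- i) *: (t ^ i *: v).
    by rewrite scalerA -expfzDr ?t_neq0 // addNr expr0z scale1r.
  by rewrite {1}vE => /twist_stalk_oo h; rewrite vE fZ; apply/twist_stalk_oo/fstalk.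
exists a; apply: (germ_hom_eq twist_germ_map) => W h s.
by rewrite (twist_hom_germ lf aE) fE.
Qed.

(** Twisting does not change the sheaf of endomorphisms nor its action on the
    fibres. *)
Lemma twist_AVI n (e0 : fibre_frame V (Some 0) n) (eoo : fibre_frame V None n) I A :
  isomorphic_to_AVI e0 eoo I A ->
  isomorphic_to_AVI (twist_frame0 i e0) (twist_frameoo i eoo) I A.
Proof.
move=> [phi iso]; exists (fun (U : open (nodal_curve k)) x => twist_hom (phi U x)); split.
- by move=> U x y; rewrite (isoAVI_D iso); apply: hom_eq => W h s; exact: val_inj.
- move=> U f x; rewrite (isoAVI_Z iso); apply: hom_eq => W h s; apply: val_inj.
  by congr pair => /=; congr (_ *: _); exact: val_inj.
- move=> U; rewrite (isoAVI_1 iso); apply: hom_eq => W h s; apply: val_inj => /=.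
  by rewrite -surjective_pairing.
- move=> U x y; rewrite (isoAVI_M iso); apply: hom_eq => W h s; exact: val_inj.
- move=> U U' h x; rewrite (isoAVI_res iso); apply: hom_eq => W hW s; apply: val_inj => /=.
  by congr pair; apply: (congr1 (fun h' => phi U x _ h' _)); exact: Prop_irrelevance.
- by move=> U x y /twist_hom_inj /(isoAVI_inj iso).
- move=> U b; have [a <-] := twist_hom_surj b; split=> [sec|[x /twist_hom_inj <-]].
    have [x <-] : exists x, phi U x = a; last by exists x.
    apply/(isoAVI_im iso) => UN; have [M [MI M0 Moo]] := sec UN.
    by exists M; split=> //; [apply/fibre_action_twist0|apply/fibre_action_twistoo].
  move=> UN; have /(_ UN) [M [MI M0 Moo]] := iffRL (isoAVI_im iso _) (ex_intro _ x erefl).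
  by exists M; split=> //; [apply/fibre_action_twist0|apply/fibre_action_twistoo].
Qed.
End TwistGerms.
End Twisting.

(** * Splitting type of the bundle *)

Section Splitting.
Variable k : closedFieldType.
Local Notation K := (ratfun k).
Local Notation t := (tvar k).
Local Notation O x := (@local_ring k (P1 k) x).

Implicit Types U W : open (P1 k).

(** The unit is a nonzero global section, so it spans them all. *)
Lemma h0_scalar (A : algsheaf (nodal_curve k)) : h0 A 1 ->
  forall x : A (openT (nodal_curve k)), exists c, x = constO (openT _) c *: 1.
Proof.
move=> [e he] x; have [c [ex _]] := he x; have [c1 [e1 _]] := he (1 : asec A _).
rewrite big_ord1 in ex; rewrite big_ord1 in e1.
have nc1 : c1 0 ord0 != 0.
  apply: contra_neq (oner_neq0 (asec A (openT _))) => c0.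
  rewrite e1 c0 [constO _ _](_ : _ = 0) ?scale0r //.
  by apply: val_inj; rewrite /= rmorph0.
exists (c 0 ord0 / c1 0 ord0); rewrite ex e1 scalerA; congr (_ *: _); apply: val_inj.
by rewrite /= -rmorphM -polyCM divfK.
Qed.

(** Near [p] the endomorphism is [u] times another one, and [u] vanishes at
    [p]. *)
Lemma fibre_action_zero (V : sheaf (P1 k)) (E : lmodType K) (g : forall U, V U -> E)
    (p : pt (P1 k)) n (e : fibre_frame V p n) (U : open (P1 k)) (a : hom_on V V U)
    (f : E -> E) (u : K) :
  germ_map g -> (forall W (h : W `<=` U) s, g W (a W h s) = f (g W s)) ->
  P1_value p u 0 -> u != 0 -> (forall v, germ_stalk g p v -> germ_stalk g p (u^-1 *: f v)) ->
  fibre_action e a 0.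
Proof.
move=> gm fE u0 nu fu W h pW s.
have [U' [pU' [s' es']]] := fu _ (germ_stalk_sec g s pW).
have [U1 hU1] : exists U1 : open (P1 k), forall x, U1 x <-> u \in O x.
  exists (regular_locus (u%:M : 'M_1)) => x; rewrite regular_locusP.
  by split=> [/mxOverP/(_ 0 0)|ux]; rewrite ?mxE // mxOver_scalar ?rpred0.
pose W' := openI (openI W U') U1.
have uW' : u \in regular_on W' by apply/regular_onP => x [_ /hU1].
have hW : W' `<=` W by move=> x [[]].
have hU' : W' `<=` U' by move=> x [[]].
have pW' : W' p by split=> //; apply/hU1; exact: P1_value_local u0.
rewrite mul0mx -(ev_res e pW pW' hW).
have -> : res V hW (a W h s) = Regular uW' *: res V hU' s'.
  apply: (germ_inj gm); rewrite (germZ gm) !(germ_res gm) es' fE scalerA.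
  by rewrite divff // scale1r.
by rewrite (evZ e _ _ (c := 0)) ?scale0r.
Qed.

Lemma two_consecutive_values n (d : 'I_n -> int) :
  (forall i j : 'I_n, (i <= j)%N -> d i <= d j) -> (forall i j, d j <= d i + 1) ->
  exists (d0 : int) m, (m <= n)%N /\
    forall j : 'I_n, d j = d0 + (if (j < m)%N then 0 else 1).
Proof.
move=> mono close.
have [d0 hd0] : exists d0, forall j, d0 <= d j <= d0 + 1.
  case: n d mono close => [|n] d mono close; first by exists 0 => -[].
  by exists (d ord0) => j; rewrite close mono.
pose P m := [forall j : 'I_n, (m <= j)%N ==> (d j == d0 + 1)].
have exP : exists m, P m.
  by exists n; apply/forallP => j; rewrite leqNgt ltn_ord.
case: (ex_minnP exP) => m /forallP Pm min; exists d0, m; split.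
  by apply: min; apply/forallP => j; rewrite leqNgt ltn_ord.
move=> j; case: ltnP => [ltjm|lemj]; last by have /implyP/(_ lemj)/eqP := Pm j.
have [dj|ndj] := eqVneq (d j) (d0 + 1); last by have := hd0 j; move: ndj; lia.
suff /min : P j by rewrite leqNgt ltjm.
apply/forallP => j'; apply/implyP => lejj'.
by have := hd0 j'; have := mono _ _ lejj'; rewrite dj; lia.
Qed.

Section Degrees.
Variables (n : nat) (V : sheaf (P1 k)) (g : forall U, V U -> 'cV[K]_n).
Hypothesis gm : germ_map g.
Variables (B : 'M[K]_n) (d : 'I_n -> int).
Hypothesis frB : forall a, frame_at (germ_stalk g) (Some a) B.
Hypothesis frBoo : frame_at (germ_stalk g) None (B *m diag_mx (\row_i t ^ d i)).

Let uB : B \in unitmx := frame_unit (frB 0).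

(** It sends the [i]-th vector of the frame to the [j]-th one and kills the
    others. *)
Definition elementary (i j : 'I_n) : 'M[K]_n := B *m delta_mx j i *m invmx B.

Lemma elementary_finite (i j : 'I_n) u a v : u \in O (Some a) ->
  germ_stalk g (Some a) v -> germ_stalk g (Some a) (u *: (elementary i j *m v)).
Proof.
move=> hu /(frameP (frB a)) hv; apply: (latticeZ (frB a) hu).
rewrite /elementary -!mulmxA; apply/(lattice_frame (frB a))/mxOverM => //.
by apply/mxOverP => i' j'; rewrite mxE; case: (_ && _); rewrite ?rpred0 ?rpred1.
Qed.

Lemma elementary_oo (i j : 'I_n) u v : u * t ^ (d i - d j) \in O None ->
  germ_stalk g None v -> germ_stalk g None (u *: (elementary i j *m v)).
Proof.
pose BD := B *m diag_mx (\row_i t ^ d i).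
have fr : frame_at (germ_stalk g) None BD := frBoo.
move=> hu /(frameP fr) hv; have uBD := frame_unit fr.
have key : u *: (elementary i j *m BD) = BD *m ((u * t ^ (d i - d j)) *: delta_mx j i).
  suff dd : u *: (delta_mx j i *m diag_mx (\row_i t ^ d i)) =
      diag_mx (\row_i t ^ d i) *m ((u * t ^ (d i - d j)) *: delta_mx j i).
    rewrite /elementary /BD [_ *m (B *m _)]mulmxA (mulmxKV uB).
    by rewrite -[in LHS]mulmxA scalemxAr dd mulmxA.
  rewrite mul_mx_diag mul_diag_mx; apply/matrixP => a b; rewrite !mxE.
  case: eqP => [->|_] /=; last by rewrite !(mulr0, mul0r).
  case: eqP => [->|_] /=; last by rewrite !(mulr0, mul0r).
  rewrite mul1r mulr1 mulrCA -expfzDr ?t_neq0 //; congr (_ * t ^ _).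
  by rewrite addrC subrK.
have -> : u *: (elementary i j *m v) =
    BD *m ((u * t ^ (d i - d j)) *: delta_mx j i *m (invmx BD *m v)).
  by rewrite mulmxA -key -scalemxAl -[elementary i j *m BD *m _]mulmxA (mulKVmx uBD).
apply/(lattice_frame fr)/mxOverM => //; apply: mxOverZ => //.
by apply/mxOverP => i' j'; rewrite mxE; case: (_ && _); rewrite ?rpred0 ?rpred1.
Qed.

Lemma tpow_neg_oo (e : int) : e <= 0 -> t ^ e \in O (None : pt (P1 k)).
Proof.
move=> e0; have -> : e = - `|e|%N%:Z by lia.
by rewrite -exprnN tpow_local_oo.
Qed.

(** If [d j >= d i + 2], then [t] times the elementary endomorphism from the
    [i]-th summand to the [j]-th one vanishes at both zero and infinity; it belongs
    to the order, as [0] is in [I], but it is not a scalar. *)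
Lemma degrees_close (e0 : fibre_frame V (Some 0) n) (eoo : fibre_frame V None n) I
    (A : algsheaf (nodal_curve k)) :
  h0 A 1 -> isomorphic_to_AVI e0 eoo I A -> forall i j, d j <= d i + 1.
Proof.
move=> hA [phi iso] i j; rewrite leNgt; apply/negP => lt_d.
pose f v : 'cV[K]_n := t *: (elementary i j *m v).
have lf : linear f.
  by move=> c v w; rewrite /f mulmxDr scalerDr -scalemxAr !scalerA mulrC.
have [|N NE] := hom_of_linear gm gm (U := Defs.preim (openT (nodal_curve k))) lf.
  move=> [a|] v _ hv; first by apply: elementary_finite => //; exact: poly_local.
  apply: elementary_oo => //; rewrite -{1}[t]expr1z -expfzDr ?t_neq0 // tpow_neg_oo //.
  by lia.
have Nsec : AVI_section e0 eoo I N.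
  move=> _; exists 0; split; first exact: mem0v.
  - apply: (fibre_action_zero e0 gm NE (t_value 0) (t_neq0 k)) => v hv.
    rewrite /f scalerA mulVf ?t_neq0 //; apply: elementary_finite => //.
    by rewrite rpred1.
  - apply: (fibre_action_zero eoo gm NE (tV_value_oo k)) => [|v hv].
      by rewrite invr_eq0 t_neq0.
    rewrite /f invrK scalerA; apply: elementary_oo => //.
    rewrite -{1 2}[t]expr1z -!expfzDr ?t_neq0 // tpow_neg_oo //.
    by lia.
have [x ex] := iffLR (isoAVI_im iso _) Nsec.
have [c ec] := h0_scalar hA x.
have fc v : f v = fracp c%:P *: v.
  have [W [h [s <-]]] := germ_surj_in gm (Defs.preim (openT (nodal_curve k))) v.
  rewrite -(NE W h) -ex ec (isoAVI_Z iso) (isoAVI_1 iso).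
  by rewrite /= (germZ gm).
have := fc (B *m delta_mx i 0); rewrite /f /elementary -mulmxA mulKmx //.
rewrite -mulmxA mul_delta_mx scalemxAr [RHS]scalemxAr => /(can_inj (mulKmx uB)).
have nij : (j == i) = false.
  by apply: contraTF lt_d => /eqP ->; rewrite -leNgt lerDl.
move=> /matrixP/(_ j 0); rewrite [LHS]mxE [RHS]mxE [delta_mx j 0 j 0]mxE [delta_mx i 0 j 0]mxE.
rewrite nij eqxx mulr1 mulr0 => t0.
by have := t_neq0 k; rewrite t0 eqxx.
Qed.

(** The isomorphism is given by the coordinates in the frame [B]. *)
Lemma line_sum_iso (i : int) (m : nat) :
  (forall j : 'I_n, d j + i = if (j < m)%N then 0 else 1) ->
  sheaf_iso (twist V i) (line_sum (fun j : 'I_n => if (j < m)%N then 0 else 1)).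
Proof.
move=> hd; pose f (v : 'cV[K]_n) : 'rV[K]_n := (invmx B *m v)^T.
apply: (linear_subconst_iso (twist_germ_map gm i) (f := f)).
- by move=> c v w; rewrite /f mulmxDr linearD -scalemxAr linearZ.
- exists (fun w => B *m w^T) => v; first by rewrite /f trmxK mulKVmx.
  by rewrite /f mulKmx // trmxK.
have coordE v j : f v 0 j = (invmx B *m v) j 0 by rewrite mxE.
move=> [a|] v.
- apply: (iff_trans (twist_stalk_finite gm i a v)).
  apply: (iff_trans (frameP (frB a) v)); split.
    by move=> /mxOverP h j; have /local_ringP[c hc] := h j 0; exists c; rewrite coordE.
  by move=> h; apply/mxOverP => j j'; rewrite ord1 -coordE; apply/local_ringP; exact: h.
- pose BD := B *m diag_mx (\row_i t ^ d i).
  have fr : frame_at (germ_stalk g) None BD := frBoo.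
  apply: (iff_trans (twist_stalk_oo gm i v)).
  apply: (iff_trans (frameP fr _)); have uBD := frame_unit fr.
  have E j : (invmx BD *m (t ^ (- i) *: v)) j 0 =
      f v 0 j / t ^ (if (j < m)%N then 0 else 1).
    have Ew : invmx BD *m (t ^ (- i) *: v) = t ^ (- i) *: \col_j (t ^ (- d j) * f v 0 j).
      rewrite -scalemxAr; congr (_ *: _); apply: (canLR (mulKmx uBD)).
      rewrite /BD -mulmxA mul_diag_mx -{1}(mulKVmx uB v); congr (_ *m _).
      apply/matrixP => a b; rewrite [RHS]mxE [X in _ = X * _]mxE [X in _ = _ * X]mxE.
      rewrite ord1 mulrA -expfzDr ?t_neq0 // subrr expr0z mul1r.
      exact/esym/coordE.
    rewrite Ew mxE [X in _ * X]mxE mulrA -expfzDr ?t_neq0 // -(hd j) mulrC.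
    by rewrite invr_expz opprD [- d j - i]addrC.
  split=> [/mxOverP h j|h].
    by have /local_ringP[c hc] := h j 0; exists c; rewrite -E.
  by apply/mxOverP => j j'; rewrite ord1 E; apply/local_ringP; exact: h.
Qed.
End Degrees.

Lemma splitting (n : nat) (A : algsheaf (nodal_curve k)) (V : sheaf (P1 k))
    (e0 : fibre_frame V (Some 0) n) (eoo : fibre_frame V None n)
    (I : {vspace 'M[k]_n * 'M[k]_n}) :
  h0 A 1 -> vector_bundle n V -> isomorphic_to_AVI e0 eoo I A ->
  exists (i : int) (m : nat),
    [/\ (m <= n)%N,
        isomorphic_to_AVI (twist_frame0 i e0) (twist_frameoo i eoo) I A
      & sheaf_iso (twist V i) (line_sum (fun j : 'I_n => if (j < m)%N then 0 else 1))].
Proof.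
move=> hA hV iso; have [g [gm Lfree]] := bundle_germ hV.
have [B [d [mono frB frBoo]]] := birkhoff_grothendieck Lfree.
have [d0 [m [lemn dE]]] := two_consecutive_values mono (degrees_close gm frB frBoo hA iso).
exists (- d0), m; split=> //; first exact: (twist_AVI gm).
apply: (line_sum_iso gm frB frBoo) => j; rewrite dE addrAC subrr add0r.
by [].
Qed.
End Splitting.

(** * The lattices generated by an order *)

Section OrderGerms.
Variables (k : fieldType) (X : curve k).
Local Notation K := (ratfun k).
Implicit Types U W : open X.

(** Near any point of [U] the functions killing [s] are generated by finitely many
    of them.  If one of these is not zero, then [s] vanishes there, the sheaf being
    torsion free; they cannot all be zero, because on [W], which meets every open
    set, [s] is killed by 1. *)
Lemma torsion_free_res_eq0 (F : sheaf X) U W (h : W `<=` U) (s : F U) :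
  torsion_free F -> finite_type_relations F -> res F h s = 0 -> s = 0.
Proof.
move=> tf ftr s0.
have res0 U' W' (h' : W' `<=` U') : res F h' 0 = 0.
  by apply: (addrI (res F h' 0)); rewrite -(resD (sheafP F)) !addr0.
have loc (j : {p | U p}) : {U' : open X | U' (sval j) & exists h' : U' `<=` U, res F h' s = 0}.
  apply: cid2; have [U' [h' [pU' [l [r [rel exact_rel]]]]]] := ftr U 1%N (fun _ => s) _ (svalP j).
  exists U' => //; exists h'.
  have [/existsP[i ni]|/existsPn r0] := boolP [exists i, r i 0 != 0].
    have := rel i; rewrite big_ord1 => /tf[ri0|//].
    by move: ni; rewrite -[r i 0]/(r i ord0) ri0 eqxx.
  pose W' := openI U' W; have [q qW'] := open_nonempty W'.
  have hU : W' `<=` U by move=> x [/h'].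
  have [|W1 [hV [hU1 [_ [d hd]]]]] := exact_rel W' (@openIl _ _ _ _) hU (fun _ => 1) _ q qW'.
    by rewrite big_ord1 scale1r -(res_comp (sheafP F) h (@openIr _ _ U' W)) s0 res0.
  have /(congr1 val) /= := hd ord0; rewrite big1 => [/eqP|i _]; first by rewrite oner_eq0.
  have /negPn/eqP := r0 i; rewrite -[r i 0]/(r i ord0) => ->.
  by apply: val_inj; rewrite /= mulr0.
apply: (res_sep (sheafP F) (V := fun j => s2val (loc j))
  (h := fun j => sval (cid (s2valP' (loc j))))).
  by move=> p pU; exists (exist _ p pU) => //; exact: (s2valP (loc (exist _ p pU))).
by move=> j; rewrite (svalP (cid (s2valP' (loc j)))) res0.
Qed.

Variables (n : nat) (A : algsheaf X) (g : forall U, asec A U -> 'M[K]_n).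
Hypotheses (Aord : torsion_free A /\ coherent A) (gA : generic_stalk_iso g).

Lemma order_germ_map : germ_map (F := A) g.
Proof.
have [tf [_ ftr]] := Aord.
split; [exact: gstalkD gA|exact: gstalkZ gA|exact: gstalk_res gA| |exact: gstalk_surj gA].
move=> U x y /(gstalk_inj gA)[W [hU [hV e]]].
apply/eqP; rewrite -subr_eq0; apply/eqP; apply: (torsion_free_res_eq0 (F := A) (h := hU)) => //.
rewrite (Prop_irrelevance hV hU) in e.
apply: (addIr (res A hU y)); rewrite -(resD (sheafP A)) subrK add0r.
exact: e.
Qed.

Local Notation stalk := (germ_stalk (F := A) g).

Lemma order_stalk1 q : stalk q 1%:M.
Proof. by exists (openT X), I, (1 : asec A _); exact: gstalk1 gA _. Qed.

Lemma order_stalkM q M N : stalk q M -> stalk q N -> stalk q (M *m N).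
Proof.
move=> [U [qU [x <-]]] [W [qW [y <-]]]; have qI : openI U W q by [].
exists (openI U W), qI, (ares A (@openIl _ _ U W) x * ares A (@openIr _ _ U W) y).
by rewrite (gstalkM gA) !(gstalk_res gA).
Qed.

Lemma order_stalk_linear q c M N : stalk q M -> stalk q N -> stalk q (fracp c%:P *: M + N).
Proof.
move=> [U [qU [x <-]]] [W [qW [y <-]]]; have qI : openI U W q by [].
exists (openI U W), qI, (constO _ c *: ares A (@openIl _ _ U W) x + ares A (@openIr _ _ U W) y).
by rewrite (gstalkD gA) (gstalkZ gA) !(gstalk_res gA).
Qed.

(** The finite type condition, read on the germs. *)
Lemma order_generated q : exists U, U q /\ exists m (e : 'I_m -> 'M[K]_n),
  forall q', U q' -> (forall i, stalk q' (e i)) /\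
    forall M, stalk q' M -> exists c : 'I_m -> K,
      (forall i, c i \in local_ring q') /\ M = \sum_i c i *: e i.
Proof.
have [_ [ft _]] := Aord; have gm := order_germ_map.
have [U [qU [m [e he]]]] := ft q; exists U; split=> //.
exists m, (fun i => g (e i)) => q' q'U; split=> [i|M [W [q'W [x <-]]]].
  by exists U, q'U, (e i).
have q'I : openI W U q' by [].
have [W' [hV [hU [q'W' [c ec]]]]] :=
  he (openI W U) (@openIr _ _ _ _) (res A (@openIl _ _ W U) x) q' q'I.
exists (fun i => rat_of (c i)); split=> [i|]; first exact: rat_of_local.
have := congr1 (g (U := W')) ec.
rewrite (germ_res gm) (germ_res gm) (germ_sum gm) => ->; apply: eq_bigr => i _.
by rewrite (germZ gm) (germ_res gm).
Qed.
End OrderGerms.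

Section OrderLattice.
Variable k : closedFieldType.
Local Notation K := (ratfun k).
Local Notation t := (tvar k).
Local Notation C := (nodal_curve k).
Local Notation O x := (@local_ring k (P1 k) x).

Lemma local_pullback (f : K) x : f \in @local_ring k C (normalization x) -> f \in O x.
Proof. by move=> /local_ringP[c hc]; apply: (P1_value_local (c := c)); exact: hc. Qed.

Lemma image_open (U : open (P1 k)) :
  exists W : open C, forall q, W q <-> forall x, normalization x = q -> U x.
Proof.
have fin : finite_set (~` [set q : pt C | forall x, normalization x = q -> U x]).
  apply: (@sub_finite_set _ _ (@normalization k @` (~` U))).
    by move=> q /existsNP[x /not_implyP[<- nU]]; exists x.
  exact/finite_image/open_cofinite.
by exists (Open fin).
Qed.

Variables (n : nat) (A : algsheaf C) (g : forall U, asec A U -> 'M[K]_n).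
Hypotheses (Aord : torsion_free A /\ coherent A) (gA : generic_stalk_iso g).
Local Notation stalk := (germ_stalk (F := A) g).

(** The submodule of [K^n] generated by the standard lattice under the action of
    the stalk of the order, as the smallest one. *)
Definition order_lattice (x : pt (P1 k)) (v : 'cV[K]_n) : Prop :=
  forall S : 'cV[K]_n -> Prop,
  (forall w, w \is a mxOver (O x) -> S w) ->
  (forall v w, S v -> S w -> S (v - w)) ->
  (forall f v, f \in O x -> S v -> S (f *: v)) ->
  (forall M v, stalk (normalization x) M -> S v -> S (M *m v)) ->
  S v.

Lemma order_lattice_std x w : w \is a mxOver (O x) -> order_lattice x w.
Proof. by move=> hw S h _ _ _; exact: h. Qed.

Lemma order_lattice0 x : order_lattice x 0.
Proof. by apply: order_lattice_std; exact: rpred0. Qed.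

Lemma order_latticeB x v w : order_lattice x v -> order_lattice x w -> order_lattice x (v - w).
Proof. by move=> hv hw S h1 h2 h3 h4; apply: (h2); [exact: hv|exact: hw]. Qed.

Lemma order_latticeZ (x : pt (P1 k)) f c v :
  value x f c -> order_lattice x v -> order_lattice x (f *: v).
Proof. by move=> hf hv S h1 h2 h3 h4; apply: (h3); [exact: value_local hf|exact: hv]. Qed.

Lemma order_lattice_stable x M v :
  stalk (normalization x) M -> order_lattice x v -> order_lattice x (M *m v).
Proof. by move=> hM hv S h1 h2 h3 h4; apply: (h4) => //; exact: hv. Qed.

Definition order_stalks : stalks (P1 k) 'cV[K]_n :=
  Stalks order_lattice0 order_latticeB order_latticeZ.

(** The right-hand side is stable under the order since the [e i] generate its
    stalk, and this is why they need not be multiplied several times. *)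
Lemma order_latticeP x m (e : 'I_m -> 'M[K]_n) v :
  (forall i, stalk (normalization x) (e i)) ->
  (forall M, stalk (normalization x) M -> exists c : 'I_m -> K,
    (forall i, c i \in O x) /\ M = \sum_i c i *: e i) ->
  order_lattice x v <-> exists c : 'I_m -> 'cV[K]_n,
    (forall i, c i \is a mxOver (O x)) /\ v = \sum_i e i *m c i.
Proof.
move=> se ge; split=> [hv|[c [hc ->]]]; last first.
  elim/big_ind: _ => [|v1 v2 h1 h2|i _]; first exact: order_lattice0.
    by rewrite -[v2]opprK -[- v2]sub0r; do 2!apply: order_latticeB => //; exact: order_lattice0.
  by apply: order_lattice_stable (se i) _; exact: order_lattice_std.
apply: (hv (fun v => exists c : 'I_m -> 'cV[K]_n,
  (forall i, c i \is a mxOver (O x)) /\ v = \sum_i e i *m c i))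
  => [w hw|v1 v2 [c [hc ->]] [c' [hc' ->]]|f v1 hf [c [hc ->]]|M v1 sM [c [hc ->]]].
- have [c [hc e1]] := ge _ (order_stalk1 gA _).
  exists (fun i => c i *: w); split=> [i|]; first by rewrite mxOverZ.
  rewrite -{1}[w]mul1mx e1 mulmx_suml; apply: eq_bigr => i _.
  by rewrite -scalemxAl scalemxAr.
- exists (fun i => c i - c' i); split=> [i|]; first by rewrite rpredB.
  by rewrite -sumrB; apply: eq_bigr => i _; rewrite mulmxBr.
- exists (fun i => f *: c i); split=> [i|]; first by rewrite mxOverZ.
  by rewrite scaler_sumr; apply: eq_bigr => i _; rewrite scalemxAr.
- have /boolp.choice[b hb] (i : 'I_m) : exists b : 'I_m -> K,
      (forall l, b l \in O x) /\ M *m e i = \sum_l b l *: e l.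
    by apply: ge; exact: (order_stalkM gA).
  exists (fun l => \sum_i b i l *: c i); split=> [l|].
    by apply: rpred_sum => i _; rewrite mxOverZ //; case: (hb i).
  rewrite mulmx_sumr; transitivity (\sum_i \sum_l e l *m (b i l *: c i)).
    apply: eq_bigr => i _; rewrite mulmxA (proj2 (hb i)) mulmx_suml.
    by apply: eq_bigr => l _; rewrite -scalemxAl scalemxAr.
  by rewrite exchange_big; apply: eq_bigr => l _; rewrite mulmx_sumr.
Qed.

(** Generators [e] of the order near the image of a point generate the lattices
    near that point; columns of the [e i] forming a basis at the point form one
    wherever the coordinates of the other columns are regular. *)
Lemma order_locally_free : locally_free order_lattice.
Proof.
move=> p; have [U [qU [m [e he]]]] := order_generated Aord gA (normalization p).
have geP x : Defs.preim U x -> forall M, stalk (normalization x) M -> exists c : 'I_m -> K,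
    (forall i, c i \in O x) /\ M = \sum_i c i *: e i.
  move=> xU M sM; have [_ /(_ M sM)[c [hc eM]]] := he _ xU.
  by exists c; split=> // i; exact: local_pullback.
pose W := \mxrow_(i < m) e i.
have WE (c : 'I_m -> 'cV[K]_n) : W *m \mxcol_i c i = \sum_i e i *m c i.
  exact: mul_mxrow_mxcol.
have latP x v : Defs.preim U x -> order_lattice x v <->
    exists c : 'cV[K]_(\sum_(i < m) n), c \is a mxOver (O x) /\ v = W *m c.
  move=> xU; apply: (iff_trans (order_latticeP v (proj1 (he _ xU)) (geP _ xU))).
  split=> [[c [hc ->]]|[c [hc ->]]].
    exists (\mxcol_i c i); split; last by rewrite WE.
    by apply/mxOverP => a b; rewrite mxE; apply: (mxOverP (hc _)).
  exists (fun i => submxcol c i); split=> [i|].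
    by apply/mxOverP => a b; rewrite mxE; have /mxOverP := hc; apply.
  by rewrite -WE submxcolK.
have rW : row_free W.
  have [c [_ e1]] := geP p qU _ (order_stalk1 gA _).
  apply/row_freeP; exists (\mxcol_i (c i)%:M).
  rewrite mul_mxrow_mxcol e1; apply: eq_bigr => i _; exact: mul_mx_scalar.
have [Sel [lS uB lW]] := local_basis p rW.
exists (openI (Defs.preim U) (regular_locus (invmx (W *m Sel) *m W))); split=> //.
exists (W *m Sel) => x [xU /regular_locusP xW]; split=> // v.
apply: (iff_trans (latP x v xU)); split=> [[c [hc ->]]|hv].
  by rewrite mulmxA mxOverM.
exists (Sel *m (invmx (W *m Sel) *m v)); split; first by rewrite mxOverM ?lS.
by rewrite mulmxA mulKVmx.
Qed.
End OrderLattice.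

(** * The trace form *)

Section TraceForm.
Variable k : closedFieldType.
Local Notation K := (ratfun k).
Local Notation t := (tvar k).
Local Notation C := (nodal_curve k).
Local Notation O x := (@local_ring k (P1 k) x).

Lemma tr_delta_mul (F : fieldType) n (X : 'M[F]_n) i j : \tr (delta_mx j i *m X) = X i j.
Proof.
rewrite /mxtrace (bigD1 j) //= big1 => [|l nl].
  rewrite addr0 mxE (bigD1 i) //= big1 => [|l nl]; first by rewrite mxE !eqxx mul1r addr0.
  by rewrite mxE (negPf nl) andbF mul0r.
by rewrite mxE big1 // => l' _; rewrite mxE (negPf nl) mul0r.
Qed.

(** An elementary matrix is a product of two others passing through the index 0,
    and the product in the other order is a multiple of a fixed matrix. *)
Lemma trace_unique (F : fieldType) n (f : 'M[F]_n -> F^o) : (0 < n)%N -> linear f ->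
  (forall M N, f (M *m N) = f (N *m M)) -> exists h, forall M, f M = h * \tr M.
Proof.
case: n f => // n f _ lf fC; exists (f (delta_mx 0 0)) => M.
have f0 := linear_fun0 lf; have fZ := linear_funZ lf; have fD := linear_funD lf.
rewrite {1}[M]matrix_sum_delta (big_morph f fD f0) mulr_sumr.
apply: eq_bigr => i _; rewrite (big_morph f fD f0) (bigD1 i) //= big1 ?addr0 => [|j nji].
  rewrite fZ -(mul_delta_mx (0 : 'I_n.+1)) fC mul_delta_mx.
  by rewrite mulrC.
by rewrite fZ -(mul_delta_mx (0 : 'I_n.+1)) fC mul_delta_mx_0 // f0 scaler0.
Qed.

(** Away from the node the curve and the line have the same local rings. *)
Lemma nodal_regular (U : open (P1 k)) : exists W : open C, forall q, W q ->
  exists a, [/\ q = Some a, U (Some (val a)) &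
    forall f c, P1_value (Some (val a)) f c -> @value _ C q f c].
Proof.
have [W hW] := image_open U.
exists (openI W (compl1 (None : pt C))) => -[a|] [Wq nq]; last by case: nq.
exists a; split=> //.
  move/hW: Wq; apply; rewrite /= insubT ?(valP a) // => ?.
  by congr Some; exact: val_inj.
move=> f c hf x /(congr1 (omap val)); have [->|<-] := normalizationK x; last by move=> ->.
by rewrite /= insubF // eqxx.
Qed.

Lemma nodal_regular_generic (f : K) : exists W : open C, f \in regular_on W.
Proof.
have [W hW] := nodal_regular (regular_locus (f%:M : 'M_1)).
exists W; apply/regularP => q /hW[a [-> /regular_locusP/mxOverP/(_ 0 0) + h]].
by rewrite mxE mulr1n => /local_ringP[c hc]; exists c; exact: h.
Qed.

Lemma omega_germ_map : germ_map (F := omega k) (E := K^o) (fun U s => elt_of s).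
Proof.
apply: subconst_germ_map => f.
have [W hW] := nodal_regular (regular_locus (f%:M : 'M_1)); exists W => q /hW[a [-> + _]].
move=> /regular_locusP/mxOverP/(_ 0 0); rewrite mxE mulr1n => /local_ringP[c hc].
by exists c.
Qed.

Lemma omega_germ_stalk q (f : K) : omega_stalk q f ->
  germ_stalk (F := omega k) (E := K^o) (fun U s => elt_of s) q f.
Proof.
move=> hf; have [W hW] := nodal_regular (regular_locus (f%:M : 'M_1)).
have fin : finite_set (~` [set q' : pt C | omega_stalk q' f]).
  apply: sub_finite_set (open_cofinite W) => q' /= nf /hW[a [eq' + _]].
  move=> /regular_locusP/mxOverP/(_ 0 0); rewrite mxE mulr1n => /local_ringP[c hc].
  by apply: nf; rewrite eq'; exists c.
pose U := Open fin; have qU : U q by [].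
have fU : f \in subconst
    (Stalks (E := K^o) (@omega_stalk0 k) (@omega_stalkB k) (@omega_stalkZ k)) U.
  exact/subconstP.
by exists U, qU, (SubconstSec fU).
Qed.

(** The conditions at the node make [t * f] regular at zero and infinity, and a
    function regular everywhere is constant. *)
Lemma omega_global (f : K) : (forall q : pt C, omega_stalk q f) -> exists c, t * f = fracp c%:P.
Proof.
move=> hf; apply: local_everywhere_cst => -[a|].
  have [->|na] := eqVneq a 0.
    by have [r0 [roo [h _ _]]] := hf None; exact: P1_value_local h.
  have [c hc] := hf (Some (exist _ a na)).
  by rewrite rpredM ?poly_local //; exact: P1_value_local hc.
have [r0 [roo [_ h _]]] := hf None.
by rewrite -[t * f]opprK rpredN; exact: P1_value_local h.
Qed.

Variables (n : nat) (A : algsheaf C) (g : forall U, asec A U -> 'M[K]_n).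
Hypotheses (Aord : torsion_free A /\ coherent A) (gA : generic_stalk_iso g).
Local Notation gm := (order_germ_map Aord gA).
Hypothesis hk : [pchar k] =i pred0.
Variable tau : hom_on A (omega k) (openT C).
Hypotheses (tau_sph : spherical_form tau) (tau_sym : Defs.symmetric_form tau).

(** The unit of the order is not zero, and neither is its germ. *)
Lemma order_rank_gt0 : (0 < n)%N.
Proof.
rewrite lt0n; apply/eqP => n0; move: (g) (gA); rewrite n0 => g' gA'.
have [|W [hU [hV e]]] := gstalk_inj gA' (U := openT C) (V := openT C) (x := 1) (y := 0).
  by apply/matrixP => -[].
move: e; rewrite (ares1 A) => e1.
have : ares A hV (0 : asec A _) = 0.
  have := resD (algsheafP A) hV 0 0; rewrite addr0 => e0.
  by apply: (addrI (ares A hV 0)); rewrite addr0 -e0.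
by rewrite -e1 => /eqP; rewrite oner_eq0.
Qed.

(** The form [tau] is the trace times a rational differential; the latter is
    [tau 1 / n], hence regular on the curve, hence a multiple of [dt / t]. *)
Lemma trace_form : exists c : k, c != 0 /\ forall W (x : asec A W),
  t * elt_of (happ tau (@sub_openT _ _ W) x) = fracp c%:P * \tr (g x).
Proof.
have [f [lf fE]] := linear_of_hom gm omega_germ_map nodal_regular_generic tau.
have fC M N : f (M *m N) = f (N *m M).
  have [W [h [x <-]]] := germ_surj_in gm (openT C) M.
  have [W' [h' [y <-]]] := germ_surj_in gm W N.
  have hW' : W' `<=` openT C by [].
  rewrite -(gstalk_res gA h' x) -!(gstalkM gA) -!(fE _ hW').
  by rewrite tau_sym.
have [h hf] := trace_unique order_rank_gt0 lf fC.
have nn : n%:R != 0 :> k by rewrite ((pcharf0P k).1 hk) -lt0n order_rank_gt0.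
have [c ec] : exists c, t * f 1%:M = fracp c%:P.
  apply: omega_global => q; rewrite -(gstalk1 gA (openT C)) -(fE _ (@sub_openT _ _ _)).
  by have /subconstP := elt_ofP (tau _ (@sub_openT _ _ (openT C)) 1); apply.
have th : t * h = fracp (c / n%:R)%:P.
  rewrite hf mxtrace1 in ec.
  have nK : n%:R != 0 :> K.
    by rewrite -(rmorph_nat (@FracField.tofrac {poly k})) fracp_neq0 // -polyC_natr polyC_eq0.
  apply: (mulIf nK); rewrite -mulrA ec.
  rewrite -[in RHS](rmorph_nat (@FracField.tofrac {poly k})) -rmorphM /=.
  by rewrite -polyC_natr -polyCM divfK.
exists (c / n%:R); split=> [|W x]; last by rewrite -th -mulrA -hf -(fE W (@sub_openT _ _ W)).
apply/eqP => c0; have [[W [hW [s /eqP ns]]] _] := tau_sph.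
apply: ns; apply: val_inj => /=; rewrite fE hf.
have /eqP : t * h = 0 by rewrite th c0 polyC0 rmorph0.
by rewrite mulf_eq0 (negPf (t_neq0 k)) => /eqP ->; rewrite mul0r.
Qed.

(** Multiplication by [M] followed by the form is a morphism from the order to the
    dualizing sheaf, hence by sphericity the multiplication by a section [y]
    followed by the form; and the trace pairing of matrices is nondegenerate. *)
Lemma self_dual (U : open C) (c : k) (M : 'M[K]_n) :
  (forall W (x : asec A W),
    t * elt_of (happ tau (@sub_openT _ _ W) x) = fracp c%:P * \tr (g x)) -> c != 0 ->
  (forall q N, U q -> germ_stalk (F := A) g q N ->
     omega_stalk q (fracp c%:P / t * \tr (N *m M))) ->
  exists y : asec A U, g y = M.
Proof.
move=> tauE nc hM; pose f N : K^o := fracp c%:P / t * \tr (N *m M).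
have lf : linear f.
  move=> b N N'; rewrite /f mulmxDl mxtraceD -scalemxAl mxtraceZ mulrDr.
  by rewrite mulrCA.
have [|a aE] := hom_of_linear gm omega_germ_map (U := U) lf.
  by move=> q N qU sN; apply: omega_germ_stalk; exact: hM sN.
have [nu_inv nuK nuVK] := (proj2 tau_sph) U.
pose y := nu_inv a; exists y.
suff tr0 N : \tr (N *m (g y - M)) = 0.
  apply/eqP; rewrite -subr_eq0; apply/eqP/matrixP => i j.
  by rewrite [RHS]mxE -(tr_delta_mul _ i j) tr0.
have [W [h [x <-]]] := germ_surj_in gm U N.
have := aE W h x; rewrite -(nuVK a) -/y /= => ea.
have := tauE W (x * ares A h y); rewrite ea (gstalkM gA) (gstalk_res gA) /f.
have nt := t_neq0 k; rewrite mulrA [fracp _ / t]mulrC mulrA divff // mul1r => etr.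
have nc' : fracp c%:P != 0 :> K by rewrite fracp_neq0 // polyC_eq0.
by rewrite mulmxBr linearB /= -(mulfI nc' etr) subrr.
Qed.
End TraceForm.

(** * Lifting endomorphisms of two fibres *)

Section Algebra.
Variable k : closedFieldType.
Local Notation K := (ratfun k).
Local Notation t := (tvar k).
Local Notation O x := (@local_ring k (P1 k) x).

(** Take a subspace contained in [P] of the largest dimension. *)
Lemma vspace_of_pred (vT : vectType k) (P : vT -> Prop) :
  P 0 -> (forall a x y, P x -> P y -> P (a *: x + y)) ->
  exists U : {vspace vT}, forall v, v \in U <-> P v.
Proof.
move=> P0 Plin; have PZ a x : P x -> P (a *: x) by move=> Px; rewrite -[_ *: _]addr0; exact: Plin.
pose Q d := `[< exists U : {vspace vT}, (forall v, v \in U -> P v) /\ \dim U = d >].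
have exQ : exists d, Q d.
  by exists 0%N; apply/asboolP; exists 0%VS; rewrite dimv0; split=> // v; rewrite memv0 => /eqP ->.
have bQ d : Q d -> (d <= \dim {:vT})%N.
  by move=> /asboolP[U [_ <-]]; exact/dimvS/subvf.
case: (ex_maxnP exQ bQ) => d /asboolP[U [hU dU]] maxd; exists U => v; split; first exact: hU.
move=> Pv; have sUv : (U <= U + <[v]>)%VS by exact: addvSl.
suff /eqP eU : (U == U + <[v]>)%VS.
  by rewrite eU; apply: (subvP (addvSr U _)); exact: memv_line.
rewrite -(dimv_leqif_eq sUv) eqn_leq dimvS //= dU; apply: maxd; apply/asboolP.
exists (U + <[v]>)%VS; split=> // w /memv_addP[u uU [w' /vlineP[a ->] ->]].
by rewrite addrC; apply: Plin => //; exact: hU.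
Qed.

Lemma linear_cV_matrix (R : comNzRingType) n (f : 'cV[R]_n -> 'cV[R]_n) : linear f ->
  exists M, forall v, f v = M *m v.
Proof.
move=> lf; exists (\matrix_(i, j) f (delta_mx j 0) i 0) => v.
rewrite {1}[v]matrix_sum_delta.
under eq_bigr => i _ do rewrite big_ord1.
rewrite (big_morph f (linear_funD lf) (linear_fun0 lf)).
apply/matrixP => i j; rewrite (ord1 j) summxE mxE; apply: eq_bigr => l _.
by rewrite (linear_funZ lf) !mxE mulrC.
Qed.

Lemma residue_perturb x n (M : 'M[k]_n) (E : 'M[K]_n) :
  (forall i j, P1_value x (E i j) 0) ->
  cst_mx M + E \is a mxOver (O x) /\ residue_mx x (cst_mx M + E) = M.
Proof.
move=> hE; have lE : E \is a mxOver (O x).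
  by apply/mxOverP => i j; exact: P1_value_local (hE i j).
split; first by rewrite rpredD ?cst_mx_local.
rewrite residue_mxD ?cst_mx_local // residue_cst_mx.
by apply/matrixP => i j; rewrite [LHS]mxE [X in _ + X]mxE (residueE (hE i j)) addr0.
Qed.

(** The function is [1 / (1 + t ^ N)]. *)
Lemma separating_function N : (0 < N)%N -> exists f : K,
  [/\ P1_value (Some 0) f 1, P1_value None (1 - f) 1 & 1 - f = t ^+ N * f].
Proof.
move=> N0; exists (1 + t ^+ N)^-1.
have one x : P1_value x (1 : K) 1 by have := P1_value_cst x (1 : k); rewrite polyC1 rmorph1.
have valD x (f f' : K) c c' : P1_value x f c -> P1_value x f' c' -> P1_value x (f + f') (c + c').
  move=> h h'; have := P1_valueB h (P1_valueN h'); by rewrite !opprK.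
have h0 : P1_value (Some 0) (1 + t ^+ N) 1.
  rewrite -[X in P1_value _ _ X]addr0; apply: valD => //.
  by exists 'X^N, 1; rewrite hornerXn expr0n hornerC oner_neq0 rmorphXn rmorph1 !divr1 eqn0Ngt N0.
have hoo : P1_value None (1 + t ^- N) 1.
  rewrite -[X in P1_value _ _ X]addr0; apply: valD => //.
  exists N, 1, 'X^N; rewrite size_poly1 size_polyXn coef1 coefXn eqxx oner_neq0 divr1.
  by rewrite rmorph1 rmorphXn div1r eqn0Ngt N0.
have gen (F : fieldType) (x : F) : x != 0 -> 1 + x != 0 ->
    1 - (1 + x)^-1 = x * (1 + x)^-1 /\ 1 - (1 + x)^-1 = (1 + x^-1)^-1.
  by move=> nx n1x; split; field; rewrite ?[x + 1]addrC ?nx n1x.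
have n1 : 1 + t ^+ N != 0.
  apply/eqP => e; rewrite e in h0; have := oner_neq0 k.
  by rewrite (P1_value_uniq h0 (P1_value0 _)) eqxx.
have [e1 e2] := gen _ _ (expf_neq0 N (t_neq0 k)) n1; split=> //.
- by rewrite -[X in P1_value _ _ X]invr1; apply: P1_valueV h0 (oner_neq0 k).
- by rewrite e2 -[X in P1_value _ _ X]invr1; apply: P1_valueV hoo (oner_neq0 k).
Qed.

(** The matrix of the endomorphism [M] in the frame [B]. *)
Definition conj_frame n (B M : 'M[K]_n) : 'M[K]_n := invmx B *m M *m B.

Lemma conj_frameM n (B M N : 'M[K]_n) : B \in unitmx ->
  conj_frame B (M *m N) = conj_frame B M *m conj_frame B N.
Proof. by move=> uB; rewrite /conj_frame !mulmxA mulmxK. Qed.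

Lemma conj_frame_tr n (B M : 'M[K]_n) : B \in unitmx -> \tr (conj_frame B M) = \tr M.
Proof. by move=> uB; rewrite /conj_frame mxtrace_mulC mulmxA mulmxV // mul1mx. Qed.

Lemma conj_frameK n (B M : 'M[K]_n) : B \in unitmx -> conj_frame B (B *m M *m invmx B) = M.
Proof. by move=> uB; rewrite /conj_frame !mulmxA mulVmx // mul1mx mulmxKV. Qed.

Lemma conj_frame0 n (B : 'M[K]_n) : conj_frame B 0 = 0.
Proof. by rewrite /conj_frame mulmx0 mul0mx. Qed.

Lemma conj_frame1 n (B : 'M[K]_n) : B \in unitmx -> conj_frame B 1%:M = 1%:M.
Proof. by move=> uB; rewrite /conj_frame mulmx1 mulVmx. Qed.

Lemma conj_frameD n (B M N : 'M[K]_n) : conj_frame B (M + N) = conj_frame B M + conj_frame B N.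
Proof. by rewrite /conj_frame mulmxDr mulmxDl. Qed.

Lemma conj_frameZ n (B M : 'M[K]_n) a : conj_frame B (a *: M) = a *: conj_frame B M.
Proof. by rewrite /conj_frame -scalemxAr -scalemxAl. Qed.

(** Choose a lift [X] for zero and a lift [Y] for infinity.  In the frames at the
    two points, [f X + (1 - f) Y] differs from the wanted matrices by multiples of
    [t ^ N] and of [t ^ - N], which vanish at zero and infinity when [N] is
    large. *)
Lemma approximation n (B0 Boo : 'M[K]_n) (M0 Moo : 'M[k]_n) :
  B0 \in unitmx -> Boo \in unitmx -> exists M : 'M[K]_n,
  [/\ conj_frame B0 M \is a mxOver (O (Some 0)), residue_mx (Some 0) (conj_frame B0 M) = M0,
      conj_frame Boo M \is a mxOver (O None) & residue_mx None (conj_frame Boo M) = Moo].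
Proof.
move=> u0 uoo.
have [X eX] : exists X, conj_frame B0 X = cst_mx M0.
  by exists (B0 *m cst_mx M0 *m invmx B0); exact: conj_frameK.
have [Y eY] : exists Y, conj_frame Boo Y = cst_mx Moo.
  by exists (Boo *m cst_mx Moo *m invmx Boo); exact: conj_frameK.
pose Z0 := conj_frame B0 Y - cst_mx M0; pose Zoo := conj_frame Boo X - cst_mx Moo.
have /boolp.choice[N1 hN1] (ij : 'I_n * 'I_n) := tpow_value0 (Z0 ij.1 ij.2).
have /boolp.choice[N2 hN2] (ij : 'I_n * 'I_n) := tpow_value_oo 0 (Zoo ij.1 ij.2).
(* the summand 1 gives [f] the value 1 at zero *)
pose N := (1 + maxn (\max_ij N1 ij) (\max_ij N2 ij))%N.
have [f [f0 foo ef]] := @separating_function N isT.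
have hZ0 i j : P1_value (Some 0) (((1 - f) *: Z0) i j) 0.
  have -> : ((1 - f) *: Z0) i j = Z0 i j * t ^+ N * f by rewrite mxE ef mulrC mulrA.
  rewrite -[X in P1_value _ _ X](mul0r (1 : k)); apply: P1_valueM f0.
  apply: (hN1 (i, j)); rewrite /N; have := leq_bigmax (F := N1) (i, j); lia.
have hZoo i j : P1_value None ((f *: Zoo) i j) 0.
  have -> : (f *: Zoo) i j = Zoo i j / t ^+ N * (1 - f).
    by rewrite mxE ef mulrA divfK ?expf_neq0 ?t_neq0 // mulrC.
  rewrite -[X in P1_value _ _ X](mul0r (1 : k)); apply: P1_valueM foo.
  apply: (hN2 (i, j)); rewrite /N; have := leq_bigmax (F := N2) (i, j); lia.
exists (f *: X + (1 - f) *: Y).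
have comb (P Q : 'M[K]_n) a b : a + b = 1 -> a *: P + b *: Q = P + b *: (Q - P).
  move=> ab; have -> : a = 1 - b by rewrite -ab addrK.
  by rewrite scalerBl scale1r scalerBr -addrA [- _ + _]addrC.
have f2 : (1 - f) + f = 1 by exact: subrK.
have f1 : f + (1 - f) = 1 by rewrite addrC.
have -> : conj_frame B0 (f *: X + (1 - f) *: Y) = cst_mx M0 + (1 - f) *: Z0.
  rewrite conj_frameD (conj_frameZ B0 X) (conj_frameZ B0 Y) eX; exact: comb f1.
have -> : conj_frame Boo (f *: X + (1 - f) *: Y) = cst_mx Moo + f *: Zoo.
  rewrite conj_frameD (conj_frameZ Boo X) (conj_frameZ Boo Y) eY addrC; exact: comb f2.
have [l0 r0] := residue_perturb M0 hZ0; have [loo roo] := residue_perturb Moo hZoo.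
by split; [exact: l0|exact: r0|exact: loo|exact: roo].
Qed.

(** The values of the sections near [p] fill the fibre. *)
Lemma fibre_action_uniq (V : sheaf (P1 k)) p n (e : fibre_frame V p n)
    (U : open (P1 k)) (a : hom_on V V U) M N :
  U p -> fibre_action e a M -> fibre_action e a N -> M = N.
Proof.
move=> pU hM hN; apply/matrixP => i j.
have [W [pW [s es]]] := ev_surj e (delta_mx j 0).
have pI : openI U W p by [].
have := hM _ (@openIl _ _ U W) pI (res V (@openIr _ _ U W) s).
rewrite (hN _ (@openIl _ _ U W) pI) (ev_res e pW) es -!colE => /matrixP/(_ i 0).
by rewrite !mxE.
Qed.
End Algebra.

(** * The bundle and the subalgebra of a spherical order *)

Section Assembly.
Variable k : closedFieldType.
Local Notation K := (ratfun k).
Local Notation t := (tvar k).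
Local Notation C := (nodal_curve k).
Local Notation O x := (@local_ring k (P1 k) x).
Local Notation endpair n := ('M[k]_n * 'M[k]_n)%type.

Variables (n : nat) (A : algsheaf C) (g : forall U, asec A U -> 'M[K]_n).
Hypotheses (Aord : torsion_free A /\ coherent A) (gA : generic_stalk_iso g).
Variable tau : hom_on A (omega k) (openT C).
Hypotheses (tau_sph : spherical_form tau).
Variable c : k.
Hypotheses (tauE : forall W (x : asec A W),
    t * elt_of (happ tau (@sub_openT _ _ W) x) = fracp c%:P * \tr (g x)) (nc : c != 0).

Local Notation gm := (order_germ_map Aord gA).
Local Notation stalk := (germ_stalk (F := A) g).
Local Notation L := (order_lattice g).
Let Lfree : locally_free L := order_locally_free Aord gA.

Variables (B0 Boo : 'M[K]_n).
Hypothesis ex0 : exists U : open (P1 k),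
  U (Some 0) /\ forall x, U x -> frame_at (order_stalks g) x B0.
Hypothesis exoo : exists U : open (P1 k),
  U None /\ forall x, U x -> frame_at (order_stalks g) x Boo.
Let fr0 : frame_at L (Some 0) B0. Proof. by have [U [U_0]] := ex0; apply. Qed.
Let froo : frame_at L None Boo. Proof. by have [U [Uoo]] := exoo; apply. Qed.

Definition stable x (M : 'M[K]_n) := forall v, L x v -> L x (M *m v).

(** The action on the fibres at zero and infinity, in the frames [B0] and [Boo]. *)
Definition node_action (M : 'M[K]_n) : endpair n :=
  (residue_mx (Some 0) (conj_frame B0 M), residue_mx None (conj_frame Boo M)).

Lemma stable_of_stalk x M : stalk (normalization x) M -> stable x M.
Proof. by move=> sM v; exact: order_lattice_stable. Qed.

Lemma stable0P M : stable (Some 0) M <-> conj_frame B0 M \is a mxOver (O (Some 0)).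
Proof. exact: lattice_stable fr0 M. Qed.

Lemma stableooP M : stable None M <-> conj_frame Boo M \is a mxOver (O None).
Proof. exact: lattice_stable froo M. Qed.

Lemma stableM x M N : stable x M -> stable x N -> stable x (M *m N).
Proof. by move=> hM hN v hv; rewrite -mulmxA; exact: hM (hN _ hv). Qed.

Lemma node_normalization (x : option k) : normalization x = None -> x = Some 0 \/ x = None.
Proof. by move=> e; case: (normalizationK x) => [->|->]; [left|right; rewrite e]. Qed.

Lemma normalization0 : normalization (Some 0 : option k) = None.
Proof. by rewrite /= insubF // eqxx. Qed.

Lemma stable_node M : stalk None M -> stable (Some 0) M /\ stable None M.
Proof. by split; apply: stable_of_stalk; rewrite ?normalization0. Qed.

Lemma node_actionM M N : stable (Some 0) M -> stable None M ->
  stable (Some 0) N -> stable None N ->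
  node_action (M *m N) = ((node_action M).1 *m (node_action N).1,
                          (node_action M).2 *m (node_action N).2).
Proof.
move=> /stable0P m0 /stableooP moo /stable0P n0 /stableooP noo.
congr pair.
  by rewrite -(residue_mxM m0 n0) -(conj_frameM _ _ (frame_unit fr0)).
by rewrite -(residue_mxM moo noo) -(conj_frameM _ _ (frame_unit froo)).
Qed.

Lemma node_actionD M N : stable (Some 0) M -> stable None M ->
  stable (Some 0) N -> stable None N ->
  node_action (M + N) = node_action M + node_action N.
Proof.
move=> /stable0P m0 /stableooP moo /stable0P n0 /stableooP noo.
congr pair; rewrite conj_frameD.
  exact: residue_mxD m0 n0.
exact: residue_mxD moo noo.
Qed.

Lemma node_actionZ a M : stable (Some 0) M -> stable None M ->
  node_action (fracp a%:P *: M) = a *: node_action M.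
Proof.
move=> /stable0P m0 /stableooP moo.
congr pair; rewrite conj_frameZ.
  by rewrite (residue_mxZ (cst_local _ _) m0) residue_cst.
by rewrite (residue_mxZ (cst_local _ _) moo) residue_cst.
Qed.

(** At the node the residues of [tr (N M) dt / t] are given by the pairing of
    the actions of [N] and [M] on the two fibres. *)
Lemma omega_node N M : stable (Some 0) N -> stable None N ->
  stable (Some 0) M -> stable None M ->
  omega_stalk (None : pt C) (fracp c%:P / t * \tr (N *m M)) <->
  trace_pairing (node_action N) (node_action M) = 0.
Proof.
move=> n0 noo m0 moo.
have nm := node_actionM n0 noo m0 moo.
have /stable0P s0 := stableM n0 m0; have /stableooP soo := stableM noo moo.
have [l0 r0] := residue_tr s0; have [loo roo] := residue_tr soo.
rewrite (conj_frame_tr _ (frame_unit fr0)) in l0 r0.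
rewrite (conj_frame_tr _ (frame_unit froo)) in loo roo.
have e1 : residue_mx (Some 0) (conj_frame B0 (N *m M)) = (node_action N).1 *m (node_action M).1.
  by have := congr1 fst nm.
have e2 : residue_mx None (conj_frame Boo (N *m M)) = (node_action N).2 *m (node_action M).2.
  by have := congr1 snd nm.
rewrite e1 in r0; rewrite e2 in roo.
have tE : t * (fracp c%:P / t * \tr (N *m M)) = fracp c%:P * \tr (N *m M).
  have gen (F : fieldType) (x y z : F) : x != 0 -> x * (y / x * z) = y * z.
    by move=> nx; rewrite mulrA mulrCA divff // mulr1.
  exact/gen/t_neq0.
have v0 : P1_value (Some 0) (fracp c%:P * \tr (N *m M))
    (c * \tr ((node_action N).1 *m (node_action M).1)).
  by apply: P1_valueM; [exact: P1_value_cst|rewrite -r0; exact: residueP].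
have voo : P1_value None (- (fracp c%:P * \tr (N *m M)))
    (- (c * \tr ((node_action N).2 *m (node_action M).2))).
  by apply: P1_valueN; apply: P1_valueM; [exact: P1_value_cst|rewrite -roo; exact: residueP].
rewrite /omega_stalk tE /trace_pairing; split=> [[r [r' [hr hr' rr']]]|e].
  move: rr'; rewrite (P1_value_uniq hr v0) (P1_value_uniq hr' voo) -mulrBr => /eqP.
  by rewrite mulf_eq0 (negPf nc) => /eqP.
exists (c * \tr ((node_action N).1 *m (node_action M).1)),
  (- (c * \tr ((node_action N).2 *m (node_action M).2))).
by split; [exact: v0|exact: voo|rewrite -mulrBr e mulr0].
Qed.

Lemma fibre_algebra : exists I : {vspace endpair n},
  forall y, y \in I <-> exists M, stalk None M /\ y = node_action M.
Proof.
apply: vspace_of_pred => [|a y y' [M [sM ->]] [N [sN ->]]].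
  exists 0; split.
    by exists (openT C), Logic.I, (0 : asec A _); exact: (germ0 gm).
  transitivity ((0, 0) : endpair n); first exact: erefl.
  by congr pair; rewrite conj_frame0 residue_mx0.
have [m0 moo] := stable_node sM; have [n0 noo] := stable_node sN.
exists (fracp a%:P *: M + N); split; first exact: (order_stalk_linear gA).
have scal x : is_true (fracp a%:P \in O x) by exact: cst_local.
rewrite node_actionD ?node_actionZ // => v hv; rewrite -scalemxAl.
  by apply: (latticeZ fr0) => //; exact: m0.
by apply: (latticeZ froo) => //; exact: moo.
Qed.

Variable I : {vspace endpair n}.
Hypothesis IE : forall y, y \in I <-> exists M, stalk None M /\ y = node_action M.

Lemma omega_of_product q N M : stalk q N -> stalk q M -> 
  omega_stalk q (fracp c%:P / t * \tr (N *m M)).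
Proof.
move=> sN sM; have [W [qW [x <-]]] := order_stalkM gA sN sM.
have -> : fracp c%:P / t * \tr (g x) = elt_of (happ tau (@sub_openT _ _ W) x).
  by rewrite mulrAC -tauE mulrAC divff ?t_neq0 // mul1r.
by have /subconstP := elt_ofP (happ tau (@sub_openT _ _ W) x); apply.
Qed.

(** By self-duality the traces of the products of [M] with the order have to
    satisfy the conditions of the dualizing sheaf.  Away from the node they are
    regular since [M] and the order stabilize the lattice; at the node the
    residues are given by the pairing. *)
Lemma order_section (U : open C) (M : 'M[K]_n) :
  (forall x, Defs.preim U x -> stable x M) ->
  (U None -> forall y, y \in I -> trace_pairing y (node_action M) = 0) ->
  exists y : asec A U, g y = M.
Proof.
move=> stM ortho; apply: (self_dual Aord gA tau_sph tauE nc) => q N qU sN.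
case: q qU sN => [a|] qU sN.
- have na : normalization (Some (val a)) = Some a.
    by rewrite /= insubT ?(valP a) // => ?; congr Some; exact: val_inj.
  have paU : Defs.preim U (Some (val a)) by move: qU; rewrite -{1}na.
  have [B frB] := locally_free_frame Lfree (Some (val a)).
  have sNM : stable (Some (val a)) (N *m M).
    by apply: stableM; [apply: stable_of_stalk; rewrite na|exact: stM paU].
  have /(lattice_stable frB) := sNM.
  move=> /residue_tr[+ _]; rewrite (conj_frame_tr _ (frame_unit frB)) => ltr.
  suff /local_ringP[r hr] : fracp c%:P / t * \tr (N *m M) \in O (Some (val a)) by exists r.
  by rewrite !rpredM ?cst_local // tV_local // (valP a).
- have [n0 noo] := stable_node sN.
  have p0 : Defs.preim U (Some 0) by move: qU; rewrite -normalization0.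
  apply/(omega_node n0 noo (stM _ p0) (stM None qU)).
  by apply: ortho => //; apply/IE; exists N.
Qed.

Lemma fibre_isotropic : isotropic I.
Proof.
move=> y y' /IE[N [sN ->]] /IE[M [sM ->]].
have [n0 noo] := stable_node sN; have [m0 moo] := stable_node sM.
by apply/omega_node => //; exact: omega_of_product.
Qed.

(** The matrix stabilizes the lattices at almost all points, so it is a section
    over a neighbourhood of the node. *)
Lemma node_order_section M : stable (Some 0) M -> stable None M ->
  (forall y, y \in I -> trace_pairing y (node_action M) = 0) -> stalk None M.
Proof.
move=> m0 moo ortho; have [U hU] := stable_cofinite Lfree M.
have [W hW] := image_open U.
have NW : W None by apply/hW => x /node_normalization[] ->; apply/hU.
have [x xW|_|y <-] := @order_section W M; [|exact: ortho|by exists W, NW, y].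
by apply/hU; move/hW: xW; apply.
Qed.

(** An element orthogonal to [I] lifts to a matrix stabilizing the lattices at zero
    and infinity, and the lift is in the order at the node by self-duality; so [I]
    is its own orthogonal. *)
Lemma fibre_maximal_isotropic : maximal_isotropic I.
Proof.
split=> [|J isoJ IJ]; first exact: fibre_isotropic.
apply/eqP; rewrite eqEsubv IJ andbT; apply/subvP => y yJ.
have [M [l0 r0 loo roo]] := approximation y.1 y.2 (frame_unit fr0) (frame_unit froo).
have yE : y = node_action M by rewrite /node_action r0 roo -surjective_pairing.
apply/IE; exists M; split=> //; apply: node_order_section.
- exact/stable0P.
- exact/stableooP.
- by move=> z zI; rewrite -yE; apply: isoJ => //; exact: (subvP IJ).
Qed.

Lemma fibre_unital_subalgebra : unital_subalgebra I.
Proof.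
split.
  apply/IE; exists 1%:M; split; first exact: (order_stalk1 gA).
  congr pair.
    by rewrite (conj_frame1 (frame_unit fr0)) residue_mx1.
  by rewrite (conj_frame1 (frame_unit froo)) residue_mx1.
move=> y y' /IE[N [sN ->]] /IE[M [sM ->]].
have [n0 noo] := stable_node sN; have [m0 moo] := stable_node sM.
apply/IE; exists (N *m M); split; first exact: (order_stalkM gA).
by rewrite node_actionM.
Qed.

Local Notation V := (subconst_sheaf (order_stalks g)).
Let VL : germ_map (F := V) (fun U s => elt_of s) :=
  subconst_bundle_germ (L := order_stalks g) Lfree.

Let e0 : fibre_frame V (Some 0) n := subconst_frame ex0.
Let eoo : fibre_frame V None n := subconst_frame exoo.

Section Phi.
Variables (U : open C) (x : asec A U).

Lemma order_act_subproof (W : open (P1 k)) (h : W `<=` Defs.preim U) (s : V W) :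
  g x *m elt_of s \in subconst (order_stalks g) W.
Proof.
apply/subconstP => p pW; apply: order_lattice_stable.
  by apply: (germ_stalk_sec (F := A)); exact: h.
by have /subconstP := elt_ofP s; apply.
Qed.

Definition order_act (W : open (P1 k)) (h : W `<=` Defs.preim U) (s : V W) : V W :=
  SubconstSec (order_act_subproof h s).

Lemma order_act_linear W h : linear (@order_act W h).
Proof. by move=> a s s'; apply: val_inj; rewrite /= mulmxDr scalemxAr. Qed.

Lemma order_act_res (W W' : open (P1 k)) (hW : W `<=` Defs.preim U)
    (hW' : W' `<=` Defs.preim U) (h : W' `<=` W) s :
  res V h (order_act hW s) = order_act hW' (res V h s).
Proof. exact: val_inj. Qed.

Definition order_hom : hom_on V V (Defs.preim U) := Defs.Hom order_act_linear order_act_res.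
End Phi.

Lemma fibre_action_frame p (B : 'M[K]_n)
    (ex : exists U : open (P1 k), U p /\ forall x, U x -> frame_at (order_stalks g) x B)
    (W : open (P1 k)) (a : hom_on V V W) (M : 'M[K]_n) :
  (forall (W' : open (P1 k)) (h : W' `<=` W) s, elt_of (a W' h s) = M *m elt_of s) -> stable p M ->
  fibre_action (subconst_frame ex) a (residue_mx p (conj_frame B M)).
Proof.
move=> aE sM W' h pW s; rewrite /= /subconst_ev aE.
have [U [pU /(_ p pU) frB]] := ex; have uB := frame_unit frB.
have ls : invmx B *m elt_of s \is a mxOver (O p).
  by apply/(frameP frB); have /subconstP := elt_ofP s; apply.
have lM : conj_frame B M \is a mxOver (O p) by exact: (iffLR (lattice_stable frB M) sM).
rewrite -(residue_mxM lM ls); congr residue_mx.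
by rewrite /conj_frame -!mulmxA (mulKVmx uB).
Qed.

(** An endomorphism of the bundle is a matrix stabilizing the lattices, and if its
    action on the two fibres is in [I] it is orthogonal to [I] by isotropy. *)
Lemma order_is_AVI : isomorphic_to_AVI e0 eoo I A.
Proof.
exists order_hom; split.
- by move=> U x y; apply: hom_eq => W h s; apply: val_inj; rewrite /= (gstalkD gA) mulmxDl.
- by move=> U f x; apply: hom_eq => W h s; apply: val_inj; rewrite /= (gstalkZ gA) scalemxAl.
- by move=> U; apply: hom_eq => W h s; apply: val_inj; rewrite /= (gstalk1 gA) mul1mx.
- by move=> U x y; apply: hom_eq => W h s; apply: val_inj; rewrite /= (gstalkM gA) mulmxA.
- by move=> U U' h x; apply: hom_eq => W hW s; apply: val_inj; rewrite /= (gstalk_res gA).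
- move=> U x y exy; apply: (germ_inj gm).
  suff e (v : 'cV[K]_n) : g x *m v = g y *m v.
    by apply/matrixP => i j; have /matrixP/(_ i 0) := e (delta_mx j 0); rewrite -!colE !mxE.
  have [W [h [s <-]]] := germ_surj_in VL (Defs.preim U) v.
  by have := congr1 (fun a : hom_on V V _ => elt_of (a W h s)) exy.
move=> U a; split=> [sec|[x <-] UN]; last first.
  have sx : stalk None (g x) by exists U, UN, x.
  have [s0 soo] := stable_node sx.
  exists (node_action (g x)); split; first by apply/IE; exists (g x).
    by apply: fibre_action_frame.
  by apply: fibre_action_frame.
have [f [lf fE]] := linear_of_hom VL VL (@regular_generic k) a.
have fstalk := linear_of_hom_stalk VL fE.
have [M fM] := linear_cV_matrix lf.
have aE (W : open (P1 k)) (h : W `<=` Defs.preim U) s : elt_of (a W h s) = M *m elt_of s.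
  by rewrite fE fM.
have stM x : Defs.preim U x -> stable x M.
  move=> xU v hv; rewrite -fM.
  apply/(subconst_bundle_stalk (L := order_stalks g) Lfree).
  by apply: fstalk => //; apply/(subconst_bundle_stalk (L := order_stalks g) Lfree).
have [|y ey] := order_section stM.
  move=> UN y yI.
  have p0 : Defs.preim U (Some 0) by move: (UN); rewrite -normalization0.
  have [N [NI N0 Noo]] := sec UN.
  have e1 := fibre_action_uniq p0 N0 (fibre_action_frame ex0 aE (stM _ p0)).
  have poo : Defs.preim U None by exact: UN.
  have e2 := fibre_action_uniq poo Noo (fibre_action_frame exoo aE (stM _ poo)).
  have -> : node_action M = N by rewrite [N]surjective_pairing e1 e2.
  exact: fibre_isotropic.
by exists y; apply: hom_eq => W h s; apply: val_inj; rewrite /= ey aE.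
Qed.
End Assembly.

Section Existence.
Variable k : closedFieldType.

Lemma spherical_order_is_AVI (hk : [pchar k] =i pred0) (n : nat)
    (A : algsheaf (nodal_curve k)) :
  is_order n A -> symmetric_spherical A ->
  exists (V : sheaf (P1 k)) (e0 : fibre_frame V (Some 0) n)
         (eoo : fibre_frame V None n) (I : {vspace 'M[k]_n * 'M[k]_n}),
  [/\ vector_bundle n V, maximal_isotropic_subalgebra I & isomorphic_to_AVI e0 eoo I A].
Proof.
move=> [tf coh [g gA]] [_ [tau [tau_sph tau_sym]]]; have Aord := conj tf coh.
have [c [nc tauE]] := trace_form Aord gA hk tau_sph tau_sym.
have Lfree := order_locally_free Aord gA.
have [U0 [U0_0 [B0 hB0]]] := Lfree (Some 0).
have [Uoo [Uoo_oo [Boo hBoo]]] := Lfree None.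
have ex0 : exists U : open (P1 k),
  U (Some 0) /\ forall x, U x -> frame_at (order_stalks g) x B0 by exists U0.
have exoo : exists U : open (P1 k),
  U None /\ forall x, U x -> frame_at (order_stalks g) x Boo by exists Uoo.
have [I IE] := fibre_algebra Aord gA ex0 exoo.
exists (subconst_sheaf (order_stalks g)), (subconst_frame ex0), (subconst_frame exoo), I.
split; [exact: subconst_bundle| |].
  split; first exact: (fibre_unital_subalgebra gA ex0 exoo IE).
  exact: (fibre_maximal_isotropic Aord gA tau_sph tauE nc ex0 exoo IE).
exact: (order_is_AVI Aord gA tau_sph tauE nc ex0 exoo IE).
Qed.
End Existence.

Theorem proposition1p8p2 (k : closedFieldType) (hk : [pchar k] =i pred0)
    (n : nat) (A : algsheaf (nodal_curve k)) :
  is_order n A -> symmetric_spherical A ->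
  (exists (V : sheaf (P1 k)) (e0 : fibre_frame V (Some 0) n)
          (eoo : fibre_frame V None n) (I : {vspace 'M[k]_n * 'M[k]_n}),
     [/\ vector_bundle n V, maximal_isotropic_subalgebra I
       & isomorphic_to_AVI e0 eoo I A])
  /\
  (forall (V : sheaf (P1 k)) (e0 : fibre_frame V (Some 0) n)
          (eoo : fibre_frame V None n) (I : {vspace 'M[k]_n * 'M[k]_n}),
     vector_bundle n V -> maximal_isotropic_subalgebra I ->
     isomorphic_to_AVI e0 eoo I A ->
     exists (i : int) (m : nat),
       [/\ (m <= n)%N,
           isomorphic_to_AVI (twist_frame0 i e0) (twist_frameoo i eoo) I A
         & sheaf_iso (twist V i)
             (line_sum (fun j : 'I_n => if (j < m)%N then 0 else 1))]).
Proof.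
move=> Aord sph; split; first exact: spherical_order_is_AVI hk n A Aord sph.
move=> V e0 eoo I hV _ iso; case: sph => hA _.
exact: splitting hA hV iso.
Qed.
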